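(* Let $\epsilon_0,r_0>0$ with $\epsilon_0\le r_0$, and let $n_0\ge2$ be an integer. There is a constant $r_1\in(0,r_0)$ and a function $m:(0,r_1)\to\mathbb{N}$ such that $$m(r)=\left(\frac{r_0}{r}\right)^{n_0-1}\left(\frac{1}{(n_0-1)\sqrt2\,\mathrm{e}^2}\cdot\frac{r_0}{\epsilon_0}+O\left(r^{n_0-1}\right)\right)$$ and for any map $f\in B(r_0,\epsilon_0,n_0)$ and any $r\in(0,r_1)$ the approximation error is bounded by $$\bigl\|\Phi^1_{X_{2m(r)}}-f\bigr\|_{r}\le4\,\epsilon_0\exp\left(-2\,m(r)\right),$$ where $X_{2m}$ is the symmetric interpolating vector field of order $2m$ of $f$.
   Context: For vectors in $\mathbb{C}^d$, $|\cdot|$ is the maximum component norm, and $\|\cdot\|_r$ is the supremum norm over the ball $\{x\in\mathbb{C}^d:|x|\le r\}$. $\mathrm{e}$ is the base of the natural logarithm. $\Phi^t_X$ is the time-$t$ map of the flow of $\dot x=X(x)$. The $O$-term is for $r\to0$. $B(r_0,\epsilon_0,n_0)$ is the set of local analytic diffeomorphisms $f$ of $\mathbb{C}^d$ at the origin, $f(0)=0$, such that the Taylor expansion of $f-\mathrm{id}$ at the origin has no terms of order less than $n_0$, the map $f$ and its inverse $f^{-1}$ are analytic on the ball $\{|x|\le r_0\}$, and $$\max\left(\|f-\mathrm{id}\|_{r_0},\|f^{-1}-\mathrm{id}\|_{r_0}\right)\le\epsilon_0.$$ For an integer $m\ge1$, the symmetric interpolating vector field of order $2m$ of $f$ (Stirling–Newton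 scheme) is $$X_{2m}(x)=\sum_{k=0}^{m-1}\frac{(-1)^k(k!)^2}{(2k+1)!}\cdot\frac{\Delta^{2k+1}(x_{-k-1})+\Delta^{2k+1}(x_{-k})}{2},$$ where $x_k=f^k(x)$ ($k\in\mathbb{Z}$) are the points of the orbit of $x$, $\Delta^1(x)=f(x)-x$ and $\Delta^{j+1}(x)=\Delta^j(f(x))-\Delta^j(x)$. *)

(* Defs.v *)
From HB Require Import structures.
From mathcomp Require Import all_boot all_order all_algebra finmap.
From mathcomp Require Import complex.
From mathcomp Require Import all_classical all_reals all_analysis.
From mathcomp.analysis Require Import showcase.summability.

Set Implicit Arguments.
Unset Strict Implicit.
Unset Printing Implicit Defensive.

Import Order.TTheory GRing.Theory Num.Theory.
Import numFieldNormedType.Exports.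

Local Open Scope classical_set_scope.
Local Open Scope ring_scope.
Local Open Scope complex_scope.

(* C^d is 'rV[R[i]]_d over an arbitrary R : realType; its library norm is the *)
(* maximum of the moduli of the components.  That norm takes its (real,       *)
(* nonnegative) values in R[i], hence the %:C and the complex.Re below.       *)

HB.instance Definition _ (R : realType) := NormedModule.copy R[i] R[i]^o.

Definition cball (R : realType) (d : nat) (r : R) : set 'rV[R[i]]_d :=
  [set x | `|x| <= r%:C].

Definition supnorm (R : realType) (d : nat) (r : R)
    (F : 'rV[R[i]]_d -> 'rV[R[i]]_d) : \bar R :=
  ereal_sup [set (complex.Re `|F x|)%:E | x in cball r].

Definition mdegree (d : nat) (al : {ffun 'I_d -> nat}) : nat :=
  (\sum_(i < d) al i)%N.

Definition monomial (R : realType) (d : nat) (h : 'rV[R[i]]_d)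
    (al : {ffun 'I_d -> nat}) : R[i] :=
  \prod_(i < d) h ord0 i ^+ al i.

(* Near a, F is the sum of the power series in x - a with coefficients c.     *)
(* The multi-indices are summed as an unordered family (limit over the        *)
(* directed set of finite sets of multi-indices).                             *)
Definition taylor_expansion (R : realType) (d : nat)
    (F : 'rV[R[i]]_d -> 'rV[R[i]]_d) (a : 'rV[R[i]]_d)
    (c : {ffun 'I_d -> nat} -> 'rV[R[i]]_d) : Prop :=
  \forall h \near (0 : 'rV[R[i]]_d),
    partial_sum (fun al => monomial h al *: c al) @ totally --> F (a + h).

Definition analytic_at (R : realType) (d : nat)
    (F : 'rV[R[i]]_d -> 'rV[R[i]]_d) (a : 'rV[R[i]]_d) : Prop :=
  exists c, taylor_expansion F a c.

(* The map f together with its inverse finv.  Both are represented by total   *)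
(* functions whose values outside cball r0 and its vicinity are irrelevant;   *)
(* they are mutually inverse as germs at the origin.                          *)
Record in_B (R : realType) (d : nat) (r0 eps0 : R) (n0 : nat)
    (f finv : 'rV[R[i]]_d -> 'rV[R[i]]_d) : Prop := InB {
  B_f0 : f 0 = 0;
  B_finvK : \forall x \near (0 : 'rV[R[i]]_d), f (finv x) = x;
  B_fK : \forall x \near (0 : 'rV[R[i]]_d), finv (f x) = x;
  B_f_analytic : forall x, cball r0 x -> analytic_at f x;
  B_finv_analytic : forall x, cball r0 x -> analytic_at finv x;
  B_order : exists2 c, taylor_expansion (fun x => f x - x) 0 c &
    forall al, (mdegree al < n0)%N -> c al = 0;
  B_close : (maxe (supnorm r0 (fun x => (f x - x)%R))
                  (supnorm r0 (fun x => (finv x - x)%R)) <= eps0%:E)%E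
}.

Definition orbit_pt (R : realType) (d : nat)
    (f finv : 'rV[R[i]]_d -> 'rV[R[i]]_d) (x : 'rV[R[i]]_d) (k : int) :
    'rV[R[i]]_d :=
  match k with
  | Posz n => iter n f x
  | Negz n => iter n.+1 finv x
  end.

Fixpoint fdiff (R : realType) (d : nat) (f : 'rV[R[i]]_d -> 'rV[R[i]]_d)
    (j : nat) (x : 'rV[R[i]]_d) : 'rV[R[i]]_d :=
  if j is j'.+1 then fdiff f j' (f x) - fdiff f j' x else x.

(* The vector field X_{2m}. *)
Definition interp_field (R : realType) (d : nat)
    (f finv : 'rV[R[i]]_d -> 'rV[R[i]]_d) (m : nat) (x : 'rV[R[i]]_d) :
    'rV[R[i]]_d :=
  \sum_(k < m)
    ((-1) ^+ k * (k`! ^ 2)%:R / ((2 * k + 1)`!)%:R) *: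
    (2^-1 *: (fdiff f (2 * k + 1) (orbit_pt f finv x (- k.+1%:Z)) +
              fdiff f (2 * k + 1) (orbit_pt f finv x (- k%:Z)))).

(* X_{2m} is only meaningful where the points x_{-m}, ..., x_m form an orbit  *)
(* segment of f inside the ball on which f and its inverse are given.  The    *)
(* equation f x_k = x_{k+1} is a condition for k < 0 only: off a neighborhood *)
(* of the origin f (finv x) need not be x.                                    *)
Definition interp_dom (R : realType) (d : nat) (r0 : R)
    (f finv : 'rV[R[i]]_d -> 'rV[R[i]]_d) (m : nat) : set 'rV[R[i]]_d :=
  [set x |
    (forall k : int, - m%:Z <= k <= m%:Z -> cball r0 (orbit_pt f finv x k)) /\
    (forall k : int, - m%:Z <= k < m%:Z ->
       f (orbit_pt f finv x k) = orbit_pt f finv x (k + 1))].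

(* g solves x' = X(x) in D on the time interval [0, T]; the derivative in the *)
(* real time variable is taken on the real and imaginary parts of components. *)
Definition integral_curve (R : realType) (d : nat) (D : set 'rV[R[i]]_d)
    (X : 'rV[R[i]]_d -> 'rV[R[i]]_d) (T : R) (g : R -> 'rV[R[i]]_d) : Prop :=
  forall t : R, 0 <= t <= T ->
    D (g t) /\
    forall i : 'I_d,
      is_derive t 1 (fun s => complex.Re (g s ord0 i))
                    (complex.Re (X (g t) ord0 i)) /\
      is_derive t 1 (fun s => complex.Im (g s ord0 i))
                    (complex.Im (X (g t) ord0 i)).

Definition flow_rel (R : realType) (d : nat) (D : set 'rV[R[i]]_d)
    (X : 'rV[R[i]]_d -> 'rV[R[i]]_d) (T : R) (x : 'rV[R[i]]_d) :
    set 'rV[R[i]]_d :=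
  [set y | exists g, [/\ g 0 = x, integral_curve D X T g & g T = y]].

(* The time-T map (T >= 0), with a junk value where flow_rel has no element.  *)
Definition flow (R : realType) (d : nat) (D : set 'rV[R[i]]_d)
    (X : 'rV[R[i]]_d -> 'rV[R[i]]_d) (T : R) (x : 'rV[R[i]]_d) : 'rV[R[i]]_d :=
  xget 0 (flow_rel D X T x).

(* Main.v *)
Require Import Defs.
From HB Require Import structures.
From mathcomp Require Import all_boot all_order all_algebra finmap.
From mathcomp Require Import cyclic separable cyclotomic complex.
From mathcomp Require Import all_classical all_reals all_analysis.
From mathcomp Require Import ring lra zify.
From mathcomp.analysis Require Import showcase.summability.

Set Implicit Arguments.
Unset Strict Implicit.
Unset Printing Implicit Defensive.

Import Order.TTheory GRing.Theory Num.Theory.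
Import numFieldNormedType.Exports.

Local Open Scope classical_set_scope.
Local Open Scope ring_scope.

(* Write nu = n0 - 1.  While |x| stays small, one step of f or f^-1 lowers     *)
(* |x|^-nu by at most about nu eps0 / r0^(nu+1), so that                       *)
(* orbits of length m(r) issued from the ball of radius R1 = r e^(2/nu) stay   *)
(* in the ball of radius rho = 4 e^2 r.  There X = X_2m is bounded by          *)
(* O(sqrt m) times the displacement of f and has a small Lipschitz constant,   *)
(* so its flow maps the ball of radius R0 = r e^(1/nu) into that of radius R1  *)
(* and |Phi^1 - f| <= 4 eps0 (1 - e^(-1/nu)) on the former.                    *)
(* The Newton interpolation polynomial t |-> U_x(t) of degree 2m through       *)
(* x_0, ..., x_2m satisfies f(U_x(t)) = U_x(t+1) up to O(|x|^(1+nu(2m+1))),    *)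
(* because the defect vanishes at 2m nodes while |x|^-nu is the size of the    *)
(* disc of t's on which it is under control.  As the Stirling formula is exact *)
(* on polynomials of degree 2m, U_x solves x' = X(x) up to the same order, and *)
(* so Phi^1 - f has order 1 + nu(2m+1) at the origin.  The Schwarz lemma, from *)
(* radius R0 down to r = R0 e^(-1/nu), then yields the factor exp(-2m).        *)
(* Holomorphy of several variables enters only through uniform approximation   *)
(* by polynomial maps ([papprox]), a property stable under composition and     *)
(* uniform limits, and through the maximum principle in one variable.          *)

(** * The real-valued norm *)

Section RealNorm.
Variables (R : realType).
Implicit Types (V : normedModType R[i]).

Definition nr V (x : V) : R := complex.Re `|x|.

Lemma nrE V (x : V) : (nr x)%:C%C = `|x|.
Proof. by rewrite /nr RRe_real// normr_real. Qed.

Lemma nr_le V (x : V) (c : R) : (nr x <= c) = (`|x| <= c%:C%C).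
Proof. by rewrite -nrE lecR. Qed.

Lemma nr_ge0 V (x : V) : 0 <= nr x.
Proof. by rewrite -ler0c nrE normr_ge0. Qed.

Lemma nr_eq0 V (x : V) : (nr x == 0) = (x == 0).
Proof. by rewrite -(inj_eq (@complexI R)) nrE normr_eq0. Qed.

Lemma nr0 V : nr (0 : V) = 0.
Proof. by apply/eqP; rewrite nr_eq0. Qed.

Lemma nrN V (x : V) : nr (- x) = nr x.
Proof. by rewrite /nr normrN. Qed.

Lemma nrB V (x y : V) : nr (x - y) = nr (y - x).
Proof. by rewrite /nr distrC. Qed.

Lemma nrD V (x y : V) : nr (x + y) <= nr x + nr y.
Proof. by rewrite -lecR rmorphD /= !nrE ler_normD. Qed.

Lemma nrBD V (x y z : V) : nr (x - z) <= nr (x - y) + nr (y - z).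
Proof. by apply: le_trans (nrD _ _); rewrite addrA subrK. Qed.

Lemma nrBle V (x y : V) : nr (x - y) <= nr x + nr y.
Proof. by rewrite -(nrN y); exact: nrD. Qed.

Lemma nr_leD V (x y : V) : nr x <= nr y + nr (x - y).
Proof. by rewrite addrC; apply: le_trans (nrD _ _); rewrite subrK. Qed.

Lemma nr_dist V (x y : V) : `|nr x - nr y| <= nr (x - y).
Proof.
by rewrite ler_norml; have := nr_leD x y; have := nr_leD y x; rewrite (nrB y); lra.
Qed.

Lemma nr_sum V (I : Type) (s : seq I) (P : pred I) (F : I -> V) :
  nr (\sum_(i <- s | P i) F i) <= \sum_(i <- s | P i) nr (F i).
Proof.
elim/big_rec2: _ => [|i y x _ h]; first by rewrite nr0.
by apply: le_trans (nrD _ _) _; rewrite lerD2l.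
Qed.

Lemma nrZ V (a : R[i]) (x : V) : nr (a *: x) = nr a * nr x.
Proof. by apply: complexI; rewrite nrE normrZ rmorphM /= !nrE. Qed.

Lemma nrM (a b : R[i]) : nr (a * b) = nr a * nr b.
Proof. by apply: complexI; rewrite nrE normrM rmorphM /= !nrE. Qed.

Lemma nr1 : nr (1 : R[i]) = 1.
Proof. by apply: complexI; rewrite nrE normr1. Qed.

Lemma nrX (a : R[i]) n : nr (a ^+ n) = nr a ^+ n.
Proof. by elim: n => [|n ih]; rewrite ?expr0 ?nr1// !exprS nrM ih. Qed.

Lemma nrV (a : R[i]) : nr a^-1 = (nr a)^-1.
Proof. by apply: complexI; rewrite nrE normfV fmorphV /= nrE. Qed.

Lemma nrC (a : R) : nr (a%:C%C : R[i]) = `|a|.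
Proof. by rewrite /nr normc_def /= expr0n addr0 sqrtr_sqr. Qed.

Lemma nr_nat n : nr (n%:R : R[i]) = n%:R.
Proof. by apply: complexI; rewrite nrE normr_nat rmorph_nat. Qed.

Lemma nr_ReIm (z : R[i]) : nr z <= `|complex.Re z| + `|complex.Im z|.
Proof.
rewrite {1}[z]complexE; apply: le_trans (nrD _ _) _.
by rewrite nrM !nrC (_ : nr _ = 1) ?mul1r// /nr normc_def /= expr0n add0r expr1n sqrtr1.
Qed.

Lemma nr_ge_Re (z : R[i]) : `|complex.Re z| <= nr z.
Proof. by rewrite -lecR nrE normc_ge_Re. Qed.

Lemma nr_ge_Im (z : R[i]) : `|complex.Im z| <= nr z.
Proof.
rewrite /nr normc_def /= -[X in X <= _]sqrtr_sqr ler_wsqrtr// lerDr sqr_ge0//.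
Qed.

Lemma mx_normr_le d (x : 'rV[R[i]]_d) (c : R[i]) : 0 <= c ->
  (`|x| <= c) <-> (forall i, `|x ord0 i| <= c).
Proof.
move=> c0; rewrite [X in X <= _]mx_normE.
have -> : (((\big[Order.max/0%:nng]_i0 `|x i0.1 i0.2|%:nng)%:num <= c) =
   (\big[Order.max/0%:nng]_i0 `|x i0.1 i0.2|%:nng <= NngNum c0)) by rewrite -num_le.
split.
  by move=> /bigmax_leP[_ h] i; have := h (ord0, i) isT; rewrite -num_le.
move=> h; apply/bigmax_leP; split; first by rewrite -num_le.
by move=> [a i] _ /=; rewrite -num_le /= (ord1 a); exact: h.
Qed.

Lemma nr_row_le d (x : 'rV[R[i]]_d) (c : R) : 0 <= c ->
  (nr x <= c) <-> (forall i, nr (x ord0 i) <= c).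
Proof.
move=> c0; rewrite nr_le mx_normr_le ?lecR ?ler0c//.
by split => h i; have := h i; rewrite nr_le.
Qed.

Lemma nr_coord d (x : 'rV[R[i]]_d) i : nr (x ord0 i) <= nr x.
Proof. by move: i; apply/nr_row_le => //; exact: nr_ge0. Qed.

Lemma cballE d (c : R) (x : 'rV[R[i]]_d) : cball c x <-> nr x <= c.
Proof. by rewrite nr_le. Qed.

Lemma near_nr V (P : V -> Prop) (a : V) :
  (\forall x \near a, P x) <-> exists2 s : R, 0 < s & forall h, nr h <= s -> P (a + h).
Proof.
split.
  move=> /nbhs_ballP[e /= e0 he].
  have er : (complex.Re e)%:C%C = e by rewrite RRe_real// ger0_real// ltW.
  have re0 : 0 < complex.Re e by rewrite -ltcR er.
  exists (complex.Re e / 2); first by rewrite divr_gt0.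
  move=> h hh; apply: he; rewrite -ball_normE /= opprD addrA subrr sub0r normrN.
  by rewrite -nrE -er ltcR; apply: le_lt_trans hh _; rewrite ltr_pdivrMr// ltr_pMr// ltr1n.
move=> [s s0 h]; apply/nbhs_ballP; exists (s%:C%C) => /=; first by rewrite ltcR.
move=> x; rewrite -ball_normE /= => hx.
rewrite -[x](subrKC a); apply: h; rewrite nr_le distrC; exact: ltW.
Qed.

End RealNorm.

(** * The maximum principle *)

Section MaximumPrinciple.
Variables (R : realType).
Local Notation C := R[i].

Lemma cvg_nr (T : topologicalType) (f : T -> R) (a : T) :
  (forall e, 0 < e -> \forall x \near a, `|f x - f a| <= e) -> {for a, continuous f}.
Proof.
move=> h; apply/cvgrPdist_le => e e0; near=> x; rewrite distrC.
by near: x; exact: h.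
Unshelve. all: by end_near. Qed.

Lemma complex_of_pair_continuous : continuous (fun p : R * R => Complex p.1 p.2 : C).
Proof.
move=> [a b]; apply/cvgrPdist_le => e e0.
have er : (complex.Re e)%:C%C = e by rewrite RRe_real// ger0_real// ltW.
have re0 : 0 < complex.Re e by rewrite -ltcR er.
have h2 : 0 < complex.Re e / 2 by rewrite divr_gt0.
have h1 : \forall p \near (a, b), `|a - p.1| <= complex.Re e / 2.
  have : (fun p : R * R => p.1) x @[x --> (a, b)] --> a by exact: cvg_fst.
  by move/cvgrPdist_le; exact.
have h3 : \forall p \near (a, b), `|b - p.2| <= complex.Re e / 2.
  have : (fun p : R * R => p.2) x @[x --> (a, b)] --> b by exact: cvg_snd.
  by move/cvgrPdist_le; exact.
near=> p; rewrite -er -nr_le; apply: le_trans (nr_ReIm _) _ => /=.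
rewrite [leRHS]splitr lerD//; [near: p; exact: h1|near: p; exact: h3].
Unshelve. all: by end_near. Qed.

Lemma disc_compact : compact [set z : C | nr z <= 1].
Proof.
pose g := fun p : R * R => Complex p.1 p.2 : C.
pose B := `[-1 : R, 1]%classic `*` `[-1 : R, 1]%classic.
have cB : compact (g @` B).
  apply: continuous_compact.
    by apply: continuous_subspaceT; exact: complex_of_pair_continuous.
  by apply: compact_setX; exact: segment_compact.
apply: subclosed_compact cB _.
  move=> z hz /=; rewrite leNgt; apply/negP => h.
  have [|w [/= hw]] := hz [set w : C | 1 < nr w].
    apply/near_nr; exists ((nr z - 1) / 2); first by rewrite divr_gt0// subr_gt0.
    move=> k hk; have := nr_leD z (z + k); rewrite opprD addrA subrr add0r nrN /=.
    by lra.
  by rewrite ltNge hw.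
move=> [a b] /= h; exists (a, b) => //=; split => /=; rewrite in_itv /= -ler_norml.
  by apply: le_trans h; exact: (nr_ge_Re (Complex a b)).
by apply: le_trans h; exact: (nr_ge_Im (Complex a b)).
Qed.

(* Leading-term alternative, as for a convergent power series at [a]. *)
Definition leading_term (psi : C -> C) (a : C) : Prop :=
  (exists2 s : R, 0 < s & forall h, nr h <= s -> psi (a + h) = psi a) \/
  (exists k c (K s : R), [/\ (0 < k)%N, c != 0, 0 < s &
     forall h, nr h <= s -> nr (psi (a + h) - psi a - c * h ^+ k) <= K * nr h ^+ k.+1]).

Lemma leading_term_near psi a : leading_term psi a ->
  forall e : R, 0 < e -> \forall x \near a, nr (psi x - psi a) <= e.
Proof.
move=> + e e0; case=> [[s s0 h]|[k [c [K [s [k0 c0 s0 h]]]]]]; apply/near_nr.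
  by exists s => // x hx; rewrite h// subrr nr0 ltW.
pose M := nr c + `|K| + 1.
have M1 : 1 <= M by rewrite /M lerDr addr_ge0// nr_ge0.
have M0 : 0 < M by lra.
exists (Num.min s (Num.min 1 (e / M))).
  by rewrite !lt_min s0 ltr01 divr_gt0.
move=> x; rewrite !le_min => /andP[xs /andP[x1 xe]].
apply: le_trans (nr_leD _ (c * x ^+ k)) _.
have xk : nr x ^+ k <= nr x.
  by case: k k0 {h} => // k _; rewrite exprS ler_piMr ?nr_ge0// exprn_ile1// nr_ge0.
have xk1 : nr x ^+ k.+1 <= nr x.
  by rewrite exprS ler_piMr ?nr_ge0// exprn_ile1// nr_ge0.
have h1 := h _ xs; rewrite nrM nrX.
have : nr c * nr x ^+ k <= nr c * nr x by rewrite ler_wpM2l// nr_ge0.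
have : K * nr x ^+ k.+1 <= `|K| * nr x.
  apply: le_trans (ler_norm _) _; rewrite normrM ler_wpM2l//.
  by rewrite ger0_norm// exprn_ge0// nr_ge0.
have : nr x * M <= e by rewrite -ler_pdivlMr.
by have := nr_ge0 x; rewrite /M; nra.
Qed.

Lemma leading_term_max psi a : leading_term psi a -> psi a != 0 ->
  (exists2 s : R, 0 < s & forall h, nr h <= s -> nr (psi (a + h)) <= nr (psi a)) ->
  exists2 s : R, 0 < s & forall h, nr h <= s -> nr (psi (a + h)) = nr (psi a).
Proof.
move=> lt pa0 [t t0 ht]; case: lt => [[s s0 h]|[k [c [K [s [k0 c0 s0 h]]]]]].
  by exists s => // x hx; rewrite h.
exfalso; pose v := k.-root (psi a / c).
have vk : v ^+ k = psi a / c by rewrite /v rootCK.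
have v0 : v != 0.
  by apply/eqP => v0; move: vk; rewrite v0 expr0n gtn_eqF//= => /esym/eqP; rewrite mulf_eq0 invr_eq0 (negbTE pa0) (negbTE c0).
have nv0 : 0 < nr v by rewrite lt_neqAle eq_sym nr_eq0 v0 nr_ge0.
have np0 : 0 < nr (psi a) by rewrite lt_neqAle eq_sym nr_eq0 pa0 nr_ge0.
pose K1 := `|K| * nr v ^+ k.+1 + 1.
have K10 : 0 < K1 by rewrite ltr_wpDl// mulr_ge0// exprn_ge0// nr_ge0.
pose x := Num.min (Num.min t s / nr v) (nr (psi a) / K1).
have x0 : 0 < x by rewrite lt_min !divr_gt0// lt_min t0.
have nx : nr (x%:C%C * v) = x * nr v by rewrite nrM nrC gtr0_norm.
have : x * nr v <= Num.min t s by rewrite -ler_pdivlMr// ge_min lexx.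
rewrite le_min => /andP[xt xs].
have := ht (x%:C%C * v); rewrite nx => /(_ xt) h1.
have := h (x%:C%C * v); rewrite nx => /(_ xs).
rewrite [(_ * v) ^+ _]exprMn vk mulrCA [c * _]mulrC divfK// => h2.
have e1 : nr (psi a + (x%:C%C) ^+ k * psi a) = (1 + x ^+ k) * nr (psi a).
  rewrite -[X in nr (X + _)]mul1r -mulrDl nrM -rmorphXn /= -[1](rmorph1 (real_complex R)).
  by rewrite -rmorphD nrC ger0_norm// addr_ge0// exprn_ge0// ltW.
have := nr_leD (psi a + (x%:C%C) ^+ k * psi a) (psi (a + x%:C%C * v)).
rewrite e1 nrB opprD addrA => h3.
have xk : 0 < x ^+ k by rewrite exprn_gt0.
have h4 : K * (x * nr v) ^+ k.+1 < x ^+ k * nr (psi a).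
  rewrite exprMn exprSr (_ : K * _ = x ^+ k * (x * (K * nr v ^+ k.+1))); last by ring.
  rewrite ltr_pM2l//.
  have : x * K1 <= nr (psi a) by rewrite -ler_pdivlMr// /x ge_min lexx orbT.
  apply: lt_le_trans; rewrite ltr_pM2l// /K1.
  rewrite (@le_lt_trans _ _ (`|K| * nr v ^+ k.+1)) ?ltrDl ?ltr01//.
  by rewrite ler_wpM2r ?ler_norm// exprn_ge0// nr_ge0.
by lra.
Qed.

Lemma maximum_principle (psi : C -> C) (B : R) :
  (forall z, nr z <= 1 -> leading_term psi z) ->
  (forall z, nr z = 1 -> nr (psi z) <= B) ->
  forall z, nr z <= 1 -> nr (psi z) <= B.
Proof.
move=> lt hB z hz; set K := [set z : C | nr z <= 1].
have cf : {within K, continuous (fun z => nr (psi z))}.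
  apply: continuous_in_subspaceT => a /[!inE] /= Ka; apply: cvg_nr => e e0.
  have := leading_term_near (lt _ Ka) e0; apply: filterS => x hx.
  by apply: le_trans hx; exact: nr_dist.
have K0 : K !=set0 by exists 0; rewrite /K /= nr0 ler01.
have [c /[!inE] Kc mc] := compact_EVT_max K0 disc_compact cf.
have zc : nr (psi z) <= nr (psi c) by apply: mc; rewrite inE.
apply: (le_trans zc); rewrite leNgt; apply/negP => Bc.
set V := nr (psi c) in mc Bc zc.
have B0 : 0 <= B by apply: le_trans (hB 1 (nr1 _)); rewrite nr_ge0.
pose A := [set w | K w /\ nr (psi w) = V].
have cA : compact A.
  apply: subclosed_compact disc_compact _; last by move=> w [].
  have Kcl : closed K.
    by apply: compact_closed disc_compact; exact: norm_hausdorff.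
  move=> w hw; have Kw : K w.
    by apply: Kcl; apply: closure_subset hw; move=> ? [].
  split=> //; apply/eqP; rewrite -subr_eq0 -normr_eq0; apply/eqP/le_anti.
  rewrite normr_ge0 andbT; apply/ler_addgt0Pr => e e0; rewrite add0r.
  have [y [[Ky <-] /= hy]] := hw _ (leading_term_near (lt _ Kw) e0).
  by apply: le_trans hy; rewrite distrC nr_dist.
have A0 : A !=set0 by exists c.
have cn : {within A, continuous (fun z : C => nr z)}.
  apply: continuous_subspaceT => a; apply: cvg_nr => e e0.
  apply/near_nr; exists e => // h he.
  by apply: le_trans (nr_dist _ _) _; rewrite addrC addKr.
have [w /[!inE] -[Kw Vw] mw] := compact_EVT_max A0 cA cn.
have w1 : nr w < 1.
  rewrite lt_neqAle Kw andbT; apply/eqP => /hB; rewrite Vw; lra.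
have pw0 : psi w != 0 by rewrite -nr_eq0 Vw gt_eqF//; lra.
have [|s s0 hs] := leading_term_max (lt _ Kw) pw0.
  exists (1 - nr w); first by rewrite subr_gt0.
  move=> h hh; rewrite Vw; apply: mc; rewrite inE /K /=.
  by apply: le_trans (nrD _ _) _; lra.
pose u : C := w + (w == 0)%:R.
have wu t : 0 < t -> nr w < nr (w + t%:C%C * u).
  move=> t0; rewrite /u; case: (eqVneq w 0) => [->|w0].
    by rewrite nr0 !add0r mulr1 nrC gtr0_norm.
  rewrite addr0 -{2}[w]mul1r -mulrDl nrM -[1](rmorph1 (real_complex R)) -rmorphD nrC.
  rewrite gtr0_norm ?ltr_pMl ?ltrDl//; first by rewrite lt_neqAle eq_sym nr_eq0 w0 nr_ge0.
  lra.
pose t := Num.min s (1 - nr w) / (nr u + 1).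
have nu1 : 0 < nr u + 1 by have := nr_ge0 u; lra.
have t0 : 0 < t by rewrite divr_gt0// lt_min s0 subr_gt0.
have : nr (t%:C%C * u) <= Num.min s (1 - nr w).
  rewrite nrM nrC gtr0_norm// /t mulrAC ler_pdivrMr// ler_wpM2l//.
    by rewrite ltW// lt_min s0 subr_gt0.
  by rewrite lerDl.
rewrite le_min => /andP[h1 h2].
have : w + t%:C%C * u \in A.
  rewrite inE; split; first by rewrite /K /=; apply: le_trans (nrD _ _) _; lra.
  by rewrite hs.
by move=> /mw; have := wu _ t0; lra.
Qed.

End MaximumPrinciple.

(** * Schwarz lemma and Cauchy estimates in one variable *)

Section LocallyAnalytic.
Variables (R : realType).
Local Notation C := R[i].

Definition expansion (phi : C -> C) (a : C) (c : nat -> C) (K s : R) : Prop :=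
  0 < s /\ forall h, nr h <= s -> forall n,
    nr (phi (a + h) - \sum_(j < n) c j * h ^+ j) <= K * (nr h / s) ^+ n.

Definition ana1 (phi : C -> C) (a : C) : Prop := exists c K s, expansion phi a c K s.

Lemma expansion_ge0 phi a c K s : expansion phi a c K s -> 0 <= K.
Proof.
move=> [s0 /(_ 0)]; rewrite nr0 => /(_ (ltW s0) 0%N).
by rewrite expr0 mulr1; apply: le_trans; rewrite nr_ge0.
Qed.

Lemma expansion_shrink phi a c K s t : expansion phi a c K s -> 0 < t -> t <= s ->
  expansion phi a c K t.
Proof.
move=> e t0 ts; have K0 := expansion_ge0 e; case: e => s0 e; split=> // h ht n.
apply: le_trans (e _ (le_trans ht ts) n) _; rewrite ler_wpM2l// lerXn2r ?nnegrE//.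
- by rewrite divr_ge0 ?nr_ge0// ltW.
- by rewrite divr_ge0 ?nr_ge0// ltW.
- by rewrite ler_wpM2l ?nr_ge0// lef_pV2.
Qed.

Lemma expansionD phi chi a c e K L s :
  expansion phi a c K s -> expansion chi a e L s ->
  expansion (fun z => phi z + chi z) a (fun j => c j + e j) (K + L) s.
Proof.
move=> [s0 hc] [_ he]; split => // h hs n.
have -> : phi (a + h) + chi (a + h) - \sum_(j < n) (c j + e j) * h ^+ j =
  (phi (a + h) - \sum_(j < n) c j * h ^+ j) + (chi (a + h) - \sum_(j < n) e j * h ^+ j).
  rewrite -addrACA -opprD -big_split /=; congr (_ - _).
  by apply: eq_bigr => i _; rewrite mulrDl.
by apply: le_trans (nrD _ _) _; rewrite mulrDl lerD// ?hc ?he.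
Qed.

Lemma ana1D phi chi a : ana1 phi a -> ana1 chi a -> ana1 (fun z => phi z + chi z) a.
Proof.
move=> [c [K [s hc]]] [e [L [t he]]].
have [[s0 _] [t0 _]] := (hc, he).
have m0 : 0 < Num.min s t by rewrite lt_min s0.
do 3 eexists; apply: expansionD.
- by apply: expansion_shrink hc m0 _; rewrite ge_min lexx.
- by apply: expansion_shrink he m0 _; rewrite ge_min lexx orbT.
Qed.

Lemma expansion_rot (phi : C -> C) (a : C) c K s (u w : C) : nr w = 1 ->
  expansion phi (w * a) c K s ->
  expansion (fun z => u * phi (w * z)) a (fun j => u * (c j * w ^+ j)) (nr u * K) s.
Proof.
move=> w1 [s0 hc]; split => // h hs n.
rewrite mulrDr; have -> : \sum_(j < n) u * (c j * w ^+ j) * h ^+ j =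
   u * (\sum_(j < n) c j * (w * h) ^+ j).
  by rewrite mulr_sumr; apply: eq_bigr => i _; rewrite exprMn !mulrA.
have := hc (w * h); rewrite nrM w1 mul1r => /(_ hs n) hh.
by rewrite -mulrBr nrM -mulrA ler_wpM2l ?nr_ge0.
Qed.

Lemma ana1_rot (phi : C -> C) (a u w : C) : nr w = 1 ->
  ana1 phi (w * a) -> ana1 (fun z => u * phi (w * z)) a.
Proof. by move=> w1 [c [K [s h]]]; do 3 eexists; exact: expansion_rot h. Qed.

Lemma expansion_poly0 (P : {poly C}) :
  expansion (fun z => P.[z]) 0 (fun j => P`_j) (\sum_(j < size P) nr P`_j) 1.
Proof.
split => // h h1 n; rewrite add0r divr1 horner_coef.
have -> : \sum_(i < size P) P`_i * h ^+ i - \sum_(j < n) P`_j * h ^+ j =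
   \sum_(i < size P | (n <= i)%N) P`_i * h ^+ i.
  have -> : \sum_(j < n) P`_j * h ^+ j = \sum_(i < size P | (i < n)%N) P`_i * h ^+ i.
    rewrite (big_ord_widen_cond (maxn n (size P)) xpredT (fun i => P`_i * h ^+ i)) ?leq_maxl//.
    rewrite [RHS](big_ord_widen_cond (maxn n (size P)) (fun i => i < n)%N (fun i => P`_i * h ^+ i)) ?leq_maxr//=.
    rewrite big_mkcond [RHS]big_mkcond; apply: eq_bigr => i _ /=.
    case: ltnP => //= _; case: ltnP => // hi; by rewrite nth_default// mul0r.
  rewrite [X in X - _](bigID (fun i : 'I__ => (i < n)%N)) /= addrAC subrr add0r.
  by apply: eq_bigl => i; rewrite -leqNgt.
apply: le_trans (nr_sum _ _ _) _; rewrite mulr_suml.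
rewrite [leRHS](bigID (fun i : 'I__ => (n <= i)%N)) /= -[leLHS]addr0 lerD//.
  apply: ler_sum => i ni; rewrite nrM nrX ler_wpM2l ?nr_ge0//.
  by rewrite ler_wiXn2l ?nr_ge0.
by apply: sumr_ge0 => i _; rewrite mulr_ge0 ?exprn_ge0 ?nr_ge0.
Qed.

Lemma ana1_shift phi a : ana1 (fun z => phi (a + z)) 0 -> ana1 phi a.
Proof.
move=> [c [K [s [s0 h]]]]; exists c, K, s; split => // x hx n.
by have := h _ hx n; rewrite add0r.
Qed.

Lemma ana1_poly (P : {poly C}) a : ana1 (fun z => P.[z]) a.
Proof.
apply: ana1_shift; pose Q := P \Po (a%:P + 'X).
have -> : (fun z => P.[a + z]) = (fun z => Q.[z]).
  by apply/funext => z; rewrite /Q horner_comp hornerD hornerC hornerX.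
by do 3 eexists; exact: expansion_poly0.
Qed.

Lemma leading_order (chi : C -> C) (c : C) k n (K L s : R) : c != 0 -> 0 < s ->
  (forall h, nr h <= s -> nr (chi h - c * h ^+ k) <= K * nr h ^+ k.+1) ->
  (forall h, nr h <= s -> nr (chi h) <= L * nr h ^+ n) -> (n <= k)%N.
Proof.
move=> c0 s0 hK hL; rewrite leqNgt; apply/negP => kn.
have nc0 : 0 < nr c by rewrite lt_neqAle eq_sym nr_eq0 c0 nr_ge0.
pose M := `|K| + `|L| + 1.
have M0 : 0 < M by rewrite ltr_wpDl// addr_ge0.
pose t := Num.min (Num.min 1 s) (nr c / (2 * M)).
have t0 : 0 < t by rewrite !lt_min ltr01 s0 divr_gt0// mulr_gt0.
have nt : nr (t%:C%C : C) = t by rewrite nrC gtr0_norm.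
have t1 : t <= 1 by rewrite !ge_min lexx.
have ts : t <= s by rewrite !ge_min lexx orbT.
have := hK t%:C%C; have := hL t%:C%C; rewrite nt => /(_ ts) h1 /(_ ts) h2.
have := nr_leD (c * t%:C%C ^+ k) (chi t%:C%C); rewrite nrM nrX nt nrB => h3.
have h4 : K * t ^+ k.+1 <= `|K| * t ^+ k.+1 by rewrite ler_wpM2r ?ler_norm// exprn_ge0// ltW.
have tn : t ^+ n <= t ^+ k.+1 by rewrite ler_wiXn2l// ltW.
have tn0 : 0 <= t ^+ n by rewrite exprn_ge0// ltW.
have h5 : L * t ^+ n <= `|L| * t ^+ k.+1.
  by apply: le_trans (ler_wpM2r tn0 (ler_norm L)) _; rewrite ler_wpM2l.
have : t * (2 * M) <= nr c by rewrite -ler_pdivlMr ?mulr_gt0// ge_min lexx orbT.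
have tk : 0 < t ^+ k by rewrite exprn_gt0.
rewrite -(ler_pM2l tk) mulrA -exprSr => h6.
have tk1 : 0 < t ^+ k.+1 by rewrite exprn_gt0.
by rewrite /M in h6; nra.
Qed.

Lemma expansion_bound phi a c K s n : expansion phi a c K s ->
  forall h, nr h <= s -> nr (phi (a + h) - \sum_(j < n) c j * h ^+ j) <= K / s ^+ n * nr h ^+ n.
Proof.
move=> [s0 e] h hs; apply: le_trans (e _ hs n) _.
by rewrite expr_div_n mulrA mulrAC.
Qed.

Lemma ana1_lead chi a : ana1 chi a -> chi a = 0 ->
  (exists2 s : R, 0 < s & forall h, nr h <= s -> chi (a + h) = 0) \/
  (exists k c (K s : R), [/\ (0 < k)%N, c != 0, 0 < s &
     forall h, nr h <= s -> nr (chi (a + h) - c * h ^+ k) <= K * nr h ^+ k.+1]).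
Proof.
move=> [c [K [s e]]] a0; have K0 := expansion_ge0 e; have [s0 he] := e.
have c0 : c 0%N = 0.
  have := he 0; rewrite nr0 => /(_ (ltW s0) 1%N).
  rewrite addr0 a0 big_ord1 expr0 mulr1 mul0r expr1 mulr0 sub0r nrN => h.
  by apply/eqP; rewrite -nr_eq0 eq_le h nr_ge0.
have [hn|] := pselect (exists j, c j != 0); last first.
  move=> /forallNP hj; left; exists (s / 2); first by rewrite divr_gt0.
  move=> h hs; apply/eqP; rewrite -nr_eq0 eq_le nr_ge0 andbT.
  have hs1 : nr h <= s by apply: le_trans hs _; rewrite ler_pdivrMr// ler_peMr ?ler1n// ltW.
  have q0 : 0 <= nr h / s by rewrite divr_ge0 ?nr_ge0// ltW.
  have q : nr h / s <= 2^-1 by rewrite ler_pdivrMr// mulrC.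
  rewrite leNgt; apply/negP => p0.
  have [n hn] : exists n, K * 2^-1 ^+ n < nr (chi (a + h)).
    have : (fun n => K * 2^-1 ^+ n) @ \oo --> K * 0.
      by apply: cvgMr; apply: cvg_expr; rewrite ger0_norm// invf_lt1// ltr1n.
    rewrite mulr0 => /cvgrPdist_lt /(_ _ p0)[N _ /(_ N (leqnn N))] /=.
    rewrite sub0r normrN => hh; exists N; apply: le_lt_trans hh; exact: ler_norm.
  have := he _ hs1 n; rewrite big1 ?subr0; last first.
    by move=> i _; have /negP/negPn/eqP -> := hj i; rewrite mul0r.
  apply/negP; rewrite -ltNge; apply: le_lt_trans hn; rewrite ler_wpM2l//.
  by rewrite lerXn2r// nnegrE invr_ge0.
right; pose k := ex_minn hn; exists k, (c k), (K / s ^+ k.+1), s.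
rewrite /k; case: ex_minnP => {}k ck hk; split => //.
  by rewrite lt0n; apply: contraNneq ck => ->; rewrite c0.
move=> h hs; have := expansion_bound k.+1 e hs.
rewrite big_ord_recr /= big1 ?add0r// => i _.
case: (eqVneq (c i) 0) => [->|/hk]; first by rewrite mul0r.
by rewrite leqNgt ltn_ord.
Qed.

Lemma ana1_order phi n : ana1 phi 0 ->
  (exists L s : R, 0 < s /\ forall h, nr h <= s -> nr (phi h) <= L * nr h ^+ n) ->
  exists c (K s : R), 0 < s /\ forall h, nr h <= s -> nr (phi h - c * h ^+ n) <= K * nr h ^+ n.+1.
Proof.
move=> [c [K [s e]]] [L [t [t0 hL]]]; have [s0 _] := e.
have cz j : (j < n)%N -> c j = 0.
  elim/ltn_ind: j => j ih jn; apply/eqP; apply/negPn/negP => cj.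
  suff : (n <= j)%N by rewrite leqNgt jn.
  apply: (@leading_order phi (c j) j n (K / s ^+ j.+1) L (Num.min s t)) => //.
  - by rewrite lt_min s0.
  - move=> h; rewrite le_min => /andP[hs _].
    have := expansion_bound j.+1 e hs; rewrite add0r big_ord_recr /= big1 ?add0r// => i _.
    by rewrite ih ?mul0r// (ltn_trans _ jn).
  - by move=> h; rewrite le_min => /andP[_]; exact: hL.
exists (c n), (K / s ^+ n.+1), s; split=> // h hs.
have := expansion_bound n.+1 e hs; rewrite add0r big_ord_recr /= big1 ?add0r// => i _.
by rewrite cz ?mul0r.
Qed.

Lemma powB_bound (a : C) n : exists M : R, forall h : C, nr h <= 1 ->
  nr ((a + h) ^+ n - a ^+ n) <= M * nr h.
Proof.
elim: n => [|n [M ih]]; first by exists 0 => h _; rewrite !expr0 subrr nr0 mul0r.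
exists ((nr a + 1) * M + nr a ^+ n) => h h1.
have -> : (a + h) ^+ n.+1 - a ^+ n.+1 = (a + h) * ((a + h) ^+ n - a ^+ n) + h * a ^+ n.
  by rewrite !exprS; ring.
apply: le_trans (nrD _ _) _; rewrite !nrM nrX mulrDl lerD//; last by rewrite mulrC.
rewrite -mulrA; apply: ler_pM; rewrite ?nr_ge0 ?ih//.
by apply: le_trans (nrD _ _) _; rewrite lerD2l.
Qed.

Lemma leading_term_div phi (a : C) n : ana1 phi a -> a != 0 ->
  leading_term (fun z => phi z / z ^+ n) a.
Proof.
move=> pa a0; set b := phi a / a ^+ n.
have na0 : 0 < nr a by rewrite lt_neqAle eq_sym nr_eq0 a0 nr_ge0.
pose chi z := phi z + (- b *: 'X^n).[z].
have chiE z : chi z = phi z - b * z ^+ n by rewrite /chi hornerZ hornerXn mulNr.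
have ac : ana1 chi a by apply: ana1D pa _; exact: ana1_poly.
have c0 : chi a = 0 by rewrite chiE /b divfK ?subrr// expf_neq0.
have nz h : nr h <= nr a / 2 -> nr a / 2 <= nr (a + h).
  by move=> hh; have := nr_leD a (a + h); rewrite opprD addrA subrr add0r nrN; lra.
have nz0 h : nr h <= nr a / 2 -> a + h != 0.
  by move=> /nz hh; rewrite -nr_eq0 gt_eqF//; lra.
have phE h : nr h <= nr a / 2 -> phi (a + h) / (a + h) ^+ n - b = chi (a + h) / (a + h) ^+ n.
  by move=> /nz0 hh; rewrite chiE mulrBl mulfK// expf_neq0.
case: (ana1_lead ac c0) => [[s s0 hs]|[k [c [K [s [k0 cn0 s0 hs]]]]]].
  left; exists (Num.min s (nr a / 2)); first by rewrite lt_min s0 divr_gt0.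
  move=> h; rewrite le_min => /andP[h1 h2].
  by apply/eqP; rewrite -subr_eq0 phE// hs// mul0r.
right; have [M hM] := powB_bound a n.
pose D := (2 / nr a) ^+ n.
exists k, (c / a ^+ n), (`|K| * D + nr c * (`|M| * (D / nr a ^+ n))),
  (Num.min s (Num.min 1 (nr a / 2))); split=> //.
  by rewrite mulf_neq0// invr_eq0 expf_neq0.
  by rewrite !lt_min s0 ltr01 divr_gt0.
move=> h; rewrite !le_min => /and3P[h1 h2 h3]; rewrite phE//.
have D1 : nr (a + h) ^- n <= D.
  rewrite /D -exprVn lerXn2r ?nnegrE ?invr_ge0 ?nr_ge0//; first by rewrite divr_ge0// ltW.
  rewrite -[_ / nr a]invrK invf_div lef_pV2 ?posrE ?nz// ?divr_gt0//.
  by apply: lt_le_trans (nz _ h3); rewrite divr_gt0.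
have D0 : 0 <= D by rewrite exprn_ge0// divr_ge0// ltW.
have aI : a ^+ n != 0 by rewrite expf_neq0.
have ahI : (a + h) ^+ n != 0 by rewrite expf_neq0// nz0.
have -> : chi (a + h) / (a + h) ^+ n - c / a ^+ n * h ^+ k =
  (chi (a + h) - c * h ^+ k) / (a + h) ^+ n
   - c * (h ^+ k * (((a + h) ^+ n - a ^+ n) * ((a + h) ^- n / a ^+ n))).
  by field; rewrite aI ahI.
apply: le_trans (nrBle _ _) _; rewrite [leRHS]mulrDl lerD//.
  rewrite nrM nrV nrX -mulrA [D * _]mulrC mulrA; apply: ler_pM => //.
  - by rewrite nr_ge0.
  - by rewrite invr_ge0 exprn_ge0// nr_ge0.
  - by apply: le_trans (hs _ h1) _; rewrite ler_wpM2r ?ler_norm// exprn_ge0// nr_ge0.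
rewrite nrM -[leRHS]mulrA ler_wpM2l ?nr_ge0//.
rewrite nrM nrX exprSr [leRHS]mulrC -mulrA ler_wpM2l ?exprn_ge0 ?nr_ge0//.
rewrite nrM mulrA [nr h * _]mulrC; apply: ler_pM; rewrite ?nr_ge0//.
  apply: le_trans (hM _ h2) _; by rewrite ler_wpM2r ?ler_norm// nr_ge0.
rewrite nrM !nrV !nrX ler_wpM2r// invr_ge0 exprn_ge0// nr_ge0//.
Qed.

Lemma leading_term_div0 (phi : C -> C) n (c : C) (K s : R) : ana1 phi 0 -> 0 < s ->
  (forall h, nr h <= s -> nr (phi h - c * h ^+ n) <= K * nr h ^+ n.+1) ->
  leading_term (fun z => if z == 0 then c else phi z / z ^+ n) 0.
Proof.
move=> pa s0 hK.
pose chi z := phi z + (- c *: 'X^n).[z].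
have chiE z : chi z = phi z - c * z ^+ n by rewrite /chi hornerZ hornerXn mulNr.
have ac : ana1 chi 0 by apply: ana1D pa _; exact: ana1_poly.
have c0 : chi 0 = 0.
  apply/eqP; rewrite -nr_eq0 eq_le nr_ge0 andbT chiE.
  by have := hK 0; rewrite nr0 exprS mul0r mulr0; apply; exact: ltW.
case: (ana1_lead ac c0) => [[t t0 ht]|[k [e [L [t [k0 e0 t0 ht]]]]]].
  left; exists t => // h h1; rewrite add0r eqxx; case: eqVneq => // h0.
  by have := ht _ h1; rewrite add0r chiE => /subr0_eq ->; rewrite mulfK// expf_neq0.
have nk : (n < k)%N.
  apply: (@leading_order chi e k n.+1 L K (Num.min s t)) => //.
  - by rewrite lt_min s0.
  - by move=> h; rewrite le_min => /andP[_ /ht]; rewrite add0r.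
  - by move=> h; rewrite le_min => /andP[h1 _]; rewrite chiE hK.
right; exists (k - n)%N, e, L, t; split=> //; first by rewrite subn_gt0.
move=> h h1; rewrite add0r eqxx; case: eqVneq => [->|h0].
  by rewrite subrr sub0r nrN nr0 !expr0n/= subn_eq0 leqNgt nk mulr0 nr0 mulr0.
have -> : phi h / h ^+ n - c - e * h ^+ (k - n) = (chi h - e * h ^+ k) / h ^+ n.
  by rewrite chiE -{2}(subnK (ltnW nk)) exprD mulrA !mulrBl !mulfK ?expf_neq0.
rewrite nrM nrV nrX ler_pdivrMr ?exprn_gt0 ?lt_neqAle ?nr_ge0 ?andbT 1?eq_sym ?nr_eq0//.
rewrite -mulrA -exprD -subSn ?(ltnW nk)// subnK; last by rewrite ltnW// ltnW.
by have := ht _ h1; rewrite add0r.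
Qed.

Lemma schwarz_ana (phi : C -> C) n (B : R) :
  (forall z, nr z <= 1 -> ana1 phi z) ->
  (exists L s : R, 0 < s /\ forall h, nr h <= s -> nr (phi h) <= L * nr h ^+ n) ->
  (forall z, nr z = 1 -> nr (phi z) <= B) ->
  forall z, nr z <= 1 -> nr (phi z) <= B * nr z ^+ n.
Proof.
move=> an hL hB.
have a0 : ana1 phi 0 by apply: an; rewrite nr0.
have [c [K [s [s0 hK]]]] := ana1_order a0 hL.
pose psi z := if z == 0 then c else phi z / z ^+ n.
have hpsi : forall z, nr z <= 1 -> nr (psi z) <= B.
  apply: maximum_principle => z hz.
    case: (eqVneq z 0) => [->|z0]; first exact: leading_term_div0 hK.
    case: (leading_term_div n (an _ hz) z0) => [[t t0 ht]|[k [e [M [t [k0 e0 t0 ht]]]]]].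
      left; exists (Num.min t (nr z / 2)).
        by rewrite lt_min t0 divr_gt0// lt_neqAle eq_sym nr_eq0 z0 nr_ge0.
      move=> h; rewrite le_min => /andP[h1 h2].
      rewrite /psi (negbTE z0) ifN ?ht//.
      apply: contraTneq h2 => /eqP; rewrite addrC addr_eq0 => /eqP ->.
      rewrite nrN -ltNge ltr_pdivrMr// ltr_pMr ?ltr1n//.
      by rewrite lt_neqAle eq_sym nr_eq0 z0 nr_ge0.
    right; exists k, e, M, (Num.min t (nr z / 2)); split=> //.
      by rewrite lt_min t0 divr_gt0// lt_neqAle eq_sym nr_eq0 z0 nr_ge0.
    move=> h; rewrite le_min => /andP[h1 h2].
    rewrite /psi (negbTE z0) ifN ?ht//.
    apply: contraTneq h2 => /eqP; rewrite addrC addr_eq0 => /eqP ->.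
    rewrite nrN -ltNge ltr_pdivrMr// ltr_pMr ?ltr1n//.
    by rewrite lt_neqAle eq_sym nr_eq0 z0 nr_ge0.
  rewrite /psi ifN; last by rewrite -nr_eq0 hz oner_eq0.
  by rewrite nrM nrV nrX hz expr1n invr1 mulr1 hB.
move=> z hz; case: (eqVneq z 0) => [z0|z0].
  have [L [t [t0 /(_ 0)]]] := hL; rewrite z0 nr0 => /(_ (ltW t0)).
  case: n {hL hK psi hpsi} => [|n] /=.
    rewrite !expr0 !mulr1 => _.
    have := @maximum_principle R phi B _ hB 0; rewrite nr0; apply => //.
    move=> w hw; have aw := an _ hw.
    pose chi z := phi z + (- phi w)%:P.[z].
    have ac : ana1 chi w by apply: ana1D aw _; exact: ana1_poly.
    have cE x : chi x = phi x - phi w by rewrite /chi hornerC.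
    case: (ana1_lead ac); first by rewrite cE subrr.
      move=> [s1 s10 hs]; left; exists s1 => // h /hs; rewrite cE; exact: subr0_eq.
    move=> [k [e [M [s1 [k0 e0 s10 hs]]]]]; right; exists k, e, M, s1; split => //.
    by move=> h /hs; rewrite cE.
  by rewrite expr0n /= !mulr0.
have zn : 0 < nr z ^+ n by rewrite exprn_gt0// lt_neqAle eq_sym nr_eq0 z0 nr_ge0.
by have := hpsi _ hz; rewrite /psi (negbTE z0) nrM nrV nrX ler_pdivrMr.
Qed.

Lemma primitive_root_exists n : (0 < n)%N -> exists z : C, n.-primitive_root z.
Proof.
move=> n0; have [s sE] := closed_field_poly_normal ('X^n - 1 : {poly C}).
rewrite (monicP (monicXnsubC 1 n0)) scale1r in sE.
have us : uniq s.
  by rewrite -separable_prod_XsubC -sE separable_Xn_sub_1// pnatr_eq0 -lt0n.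
have ss : size s = n.
  by apply: succn_inj; rewrite -(size_prod_XsubC s id) -sE size_XnsubC.
have /hasP[z _ zP] : has n.-primitive_root s; last by exists z.
apply: has_prim_root => //; last by rewrite ss.
by apply/allP => z; rewrite -root_prod_XsubC -sE.
Qed.

Lemma nr_root n (z : C) : (0 < n)%N -> z ^+ n = 1 -> nr z = 1.
Proof.
move=> n0 /(congr1 (@nr R C)); rewrite nrX nr1 => /eqP.
by rewrite pexpr_eq1 ?nr_ge0// => /eqP.
Qed.

Lemma ana1_sum n (F : nat -> C -> C) a : (forall l, ana1 (F l) a) ->
  ana1 (fun z => \sum_(l < n) F l z) a.
Proof.
move=> h; elim: n => [|n ih].
  have -> : (fun z => \sum_(l < 0) F l z) = (fun z => (0 : {poly C}).[z]).
    by apply/funext => z; rewrite big_ord0 horner0.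
  exact: ana1_poly.
have -> : (fun z => \sum_(l < n.+1) F l z) = (fun z => \sum_(l < n) F l z + F n z).
  by apply/funext => z; rewrite big_ord_recr.
exact: ana1D.
Qed.

Lemma le_of_eps (x y K s : R) : 0 < s -> (forall t, 0 < t -> t <= s -> x <= y + K * t) -> x <= y.
Proof.
move=> s0 h; rewrite leNgt; apply/negP => yx.
pose t := Num.min s ((x - y) / (2 * (`|K| + 1))).
have K1 : 0 < 2 * (`|K| + 1) by have := normr_ge0 K; lra.
have t0 : 0 < t by rewrite lt_min s0 divr_gt0// subr_gt0.
have := h t t0; rewrite ge_min lexx => /(_ isT) h1.
have : t * (2 * (`|K| + 1)) <= x - y by rewrite -ler_pdivlMr// ge_min lexx orbT.
have : K * t <= `|K| * t by rewrite ler_wpM2r ?ler_norm// ltW.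
by have := normr_ge0 K; nra.
Qed.

(* The average of [w^l phi (w^l z)] over the [(n+1)]-st roots of unity [w^l]
   keeps only the coefficients [c_j] with [n+1 | j+1]; it has order [n], and
   [schwarz_ana] bounds its leading coefficient. *)
Lemma cauchy_coef (phi : C -> C) (B : R) c K s n :
  (forall z, nr z <= 1 -> ana1 phi z) ->
  (forall z, nr z = 1 -> nr (phi z) <= B) ->
  expansion phi 0 c K s -> nr (c n) <= B.
Proof.
move=> an hB e; have [s0 he] := e; have K0 := expansion_ge0 e.
have [w pw] := @primitive_root_exists n.+1 isT.
have w1 l : nr (w ^+ l) = 1.
  by rewrite nrX (@nr_root n.+1 w)// ?expr1n// (prim_expr_order pw).
pose Phi z := \sum_(l < n.+1) w ^+ l * phi (w ^+ l * z).
have anP z : nr z <= 1 -> ana1 Phi z.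
  move=> hz; apply: (@ana1_sum n.+1 (fun l z => w ^+ l * phi (w ^+ l * z))) => l.
  by apply: ana1_rot => //; apply: an; rewrite nrM w1 mul1r.
have BP z : nr z = 1 -> nr (Phi z) <= n.+1%:R * B.
  move=> hz; apply: le_trans (nr_sum _ _ _) _.
  rewrite mulr_natl -[X in _ *+ X]card_ord -sumr_const; apply: ler_sum => l _.
  by rewrite nrM w1 mul1r hB// nrM w1 mul1r.
have eP h : nr h <= s -> nr (Phi h - n.+1%:R * (c n * h ^+ n)) <=
    n.+1%:R * (K / s ^+ n.+1) * nr h ^+ n.+1.
  move=> hs.
  have -> : n.+1%:R * (c n * h ^+ n) =
      \sum_(l < n.+1) w ^+ l * \sum_(j < n.+1) c j * (w ^+ l * h) ^+ j.
    have E l j : w ^+ l * (c j * (w ^+ l * h) ^+ j) = c j * h ^+ j * (w ^+ j.+1) ^+ l.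
      by rewrite exprMn -exprM mulnC exprM exprS; ring.
    under [RHS]eq_bigr do (rewrite mulr_sumr; under eq_bigr do rewrite E).
    rewrite exchange_big /= big_ord_recr /= big1 ?add0r => [|j _].
      under eq_bigr do rewrite (prim_expr_order pw) expr1n mulr1.
      by rewrite sumr_const card_ord mulr_natl.
    rewrite -mulr_sumr; set S := \sum_(l < _) _.
    have S0 : (w ^+ j.+1 - 1) * S = 0.
      by rewrite -subrX1 -exprM mulnC exprM (prim_expr_order pw) expr1n subrr.
    have wj : w ^+ j.+1 - 1 != 0.
      rewrite subr_eq0 -(prim_order_dvd pw) /dvdn modn_small// ltnS; exact: ltn_ord.
    by move/eqP: S0; rewrite mulf_eq0 (negbTE wj) /= => /eqP ->; rewrite mulr0.
  rewrite /Phi -sumrB; apply: le_trans (nr_sum _ _ _) _.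
  rewrite -mulrA mulr_natl -[X in _ *+ X]card_ord -sumr_const; apply: ler_sum => l _.
  rewrite -mulrBr nrM w1 mul1r.
  have := expansion_bound n.+1 e; move=> /(_ (w ^+ l * h)).
  by rewrite nrM w1 mul1r add0r; exact.
have PhiO : exists L t : R, 0 < t /\ forall h, nr h <= t -> nr (Phi h) <= L * nr h ^+ n.
  exists (n.+1%:R * nr (c n) + n.+1%:R * (K / s ^+ n.+1) * s), s; split => // h hs.
  apply: le_trans (nr_leD _ (n.+1%:R * (c n * h ^+ n))) _.
  rewrite mulrDl lerD//; first by rewrite !nrM nrX nr_nat mulrA.
  apply: le_trans (eP _ hs) _; rewrite [nr h ^+ _]exprSr -[leRHS]mulrA.
  rewrite ler_wpM2l//; first by rewrite mulr_ge0 ?divr_ge0 ?exprn_ge0 ?ler0n ?(ltW s0).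
  by rewrite mulrC ler_wpM2r// exprn_ge0// nr_ge0.
have hS := schwarz_ana anP PhiO BP.
have m0 : 0 < Num.min 1 s by rewrite lt_min ltr01.
apply: (@le_of_eps _ _ (K / s ^+ n.+1) _ m0) => t t0; rewrite le_min => /andP[t1 ts].
have nt : nr (t%:C%C : C) = t by rewrite nrC gtr0_norm.
have := hS t%:C%C; have := eP t%:C%C; rewrite nt => /(_ ts) h1 /(_ t1) h2.
have := nr_leD (n.+1%:R * (c n * t%:C%C ^+ n)) (Phi t%:C%C); rewrite nrB !nrM nrX nt nr_nat.
have tn : 0 < t ^+ n by rewrite exprn_gt0.
move=> h3; have h4 := le_trans h3 (lerD h2 h1).
have n1 : (0 : R) < n.+1%:R by rewrite ltr0n.
rewrite -(ler_pM2r tn) -(ler_pM2l n1); apply: le_trans h4 _.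
by rewrite [t ^+ n.+1]exprSr le_eqVlt; apply/orP; left; apply/eqP; ring.
Qed.

Lemma taylor_ana (phi : C -> C) (B : R) c K s n :
  (forall z, nr z <= 1 -> ana1 phi z) ->
  (forall z, nr z = 1 -> nr (phi z) <= B) ->
  expansion phi 0 c K s ->
  forall z, nr z <= 1 -> nr (phi z - \sum_(j < n) c j * z ^+ j) <= n.+1%:R * B * nr z ^+ n.
Proof.
move=> an hB e z hz; have [s0 _] := e.
have cB j : nr (c j) <= B := cauchy_coef j an hB e.
pose chi z := phi z + (- \poly_(j < n) c j).[z].
have cE x : chi x = phi x - \sum_(j < n) c j * x ^+ j.
  by rewrite /chi hornerN horner_poly.
rewrite -cE; apply: schwarz_ana => // [x hx||x hx].
- by apply: ana1D (an _ hx) _; exact: ana1_poly.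
- exists (K / s ^+ n), s; split=> // h hs; rewrite cE.
  by have := expansion_bound n e hs; rewrite add0r.
rewrite cE; apply: le_trans (nrBle _ _) _.
rewrite -natr1 mulrDl mul1r addrC lerD ?hB//.
apply: le_trans (nr_sum _ _ _) _.
rewrite mulr_natl -[X in _ *+ X]card_ord -sumr_const; apply: ler_sum => l _.
by rewrite nrM nrX hx expr1n mulr1.
Qed.

Lemma cauchy_poly (P : {poly C}) (B T : R) j : 0 < T ->
  (forall z, nr z <= T -> nr P.[z] <= B) -> nr P`_j <= B / T ^+ j.
Proof.
move=> T0 hB; pose Q := P \Po (T%:C%C *: 'X).
have QE z : Q.[z] = P.[T%:C%C * z] by rewrite /Q horner_comp hornerZ hornerX.
have Qj : Q`_j = P`_j * T%:C%C ^+ j.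
  rewrite /Q comp_polyE coef_sum.
  under eq_bigr do rewrite exprZn !coefZ coefXn.
  case: (ltnP j (size P)) => hj.
    rewrite (bigD1 (Ordinal hj)) //= eqxx mulr1 big1 ?addr0// => i.
    by rewrite -val_eqE /= eq_sym => /negbTE ->; rewrite !mulr0.
  rewrite nth_default// mul0r big1// => i _.
  by rewrite gtn_eqF ?(leq_trans (ltn_ord i))// !mulr0.
have := @cauchy_coef (fun z => Q.[z]) B _ _ _ j _ _ (expansion_poly0 Q).
rewrite Qj nrM nrX nrC gtr0_norm// ler_pdivlMr ?exprn_gt0//; apply.
- by move=> z _; exact: ana1_poly.
- by move=> z hz; rewrite QE hB// nrM nrC gtr0_norm// hz mulr1.
Qed.

End LocallyAnalytic.

(** * Truncation of multivariate Taylor series *)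

Section TaylorTruncation.
Variables (R : realType) (d : nat).
Local Notation C := R[i].
Local Notation V := 'rV[C]_d.
Local Notation midx := {ffun 'I_d -> nat}.

Definition box_midx N (b : {ffun 'I_d -> 'I_N.+1}) : midx := [ffun i => nat_of_ord (b i)].

Lemma box_midx_inj N : injective (@box_midx N).
Proof.
move=> b c /ffunP h; apply/ffunP => i; apply: val_inj; have := h i.
by rewrite !ffunE.
Qed.

Definition homog_midx (j : nat) : seq midx :=
  [seq box_midx b | b <- enum {: {ffun 'I_d -> 'I_j.+1}} & mdegree (box_midx b) == j].

Lemma box_midxP N (al : midx) : (forall i, al i <= N)%N ->
  exists b : {ffun 'I_d -> 'I_N.+1}, al = box_midx b.
Proof.
move=> h; exists [ffun i => inord (al i)]; apply/ffunP => i.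
by rewrite !ffunE inordK// ltnS.
Qed.

Lemma mdegree_ge (al : midx) i : (al i <= mdegree al)%N.
Proof. by rewrite /mdegree (bigD1 i) //= leq_addr. Qed.

Lemma mem_homog_midx j al : (al \in homog_midx j) = (mdegree al == j).
Proof.
apply/mapP/idP => [[b]|/eqP hj].
  by rewrite mem_filter => /andP[h _] ->.
have [b hb] : exists b : {ffun 'I_d -> 'I_j.+1}, al = box_midx b.
  by apply: box_midxP => i; rewrite -hj mdegree_ge.
by exists b => //; rewrite mem_filter -hb hj eqxx mem_enum.
Qed.

Lemma homog_midx_uniq j : uniq (homog_midx j).
Proof.
rewrite map_inj_uniq; last exact: (@box_midx_inj j).
by rewrite filter_uniq// enum_uniq.
Qed.

Definition homog (c : midx -> V) (j : nat) (h : V) : V :=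
  \sum_(al <- homog_midx j) monomial h al *: c al.

Lemma nr_prod (I : finType) (F : I -> C) : nr (\prod_i F i) = \prod_i nr (F i).
Proof. by elim/big_rec2: _ => [|i y x _ h]; rewrite ?nr1// nrM h. Qed.

Lemma nr_monomial (h : V) al : nr (monomial h al) <= nr h ^+ mdegree al.
Proof.
rewrite /monomial nr_prod -prodrXr; apply: ler_prod => i _.
by rewrite nr_ge0 nrX lerXn2r ?nnegrE ?nr_ge0// nr_coord.
Qed.

Lemma monomialZ (h : V) al (z : C) : monomial (z *: h) al = z ^+ mdegree al * monomial h al.
Proof.
rewrite /monomial -prodrXr -big_split; apply: eq_bigr => i _.
by rewrite mxE exprMn.
Qed.

Lemma homogZ c j z h : homog c j (z *: h) = z ^+ j *: homog c j h.
Proof.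
rewrite /homog scaler_sumr big_seq [RHS]big_seq; apply: eq_bigr => al.
by rewrite mem_homog_midx => /eqP hj; rewrite monomialZ hj scalerA.
Qed.

Lemma geo_sum_le (x : R) N : 0 <= x -> x < 1 -> \sum_(k < N) x ^+ k <= (1 - x)^-1.
Proof.
move=> x0 x1; have h : 0 < 1 - x by rewrite subr_gt0.
rewrite -[leRHS]mul1r ler_pdivlMr// mulrC.
have -> : (1 - x) * \sum_(k < N) x ^+ k = 1 - x ^+ N.
  by rewrite -[1 - x]opprB mulNr -subrX1 opprB.
by rewrite gerBl exprn_ge0.
Qed.

Lemma sum_midx_le (s : seq midx) : uniq s ->
  \sum_(al <- s) (2^-1 : R) ^+ mdegree al <= 2 ^+ d.
Proof.
move=> us; pose N := \max_(al <- s) \max_(i < d) al i.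
have hN al i : al \in s -> (al i <= N)%N.
  move=> hs; rewrite /N; apply: leq_trans (leq_bigmax_seq _ hs _) => //.
  exact: (leq_bigmax_cond (F := fun i : 'I_d => al i)).
pose S := map (@box_midx N) (enum {: {ffun 'I_d -> 'I_N.+1}}).
have sS : {subset s <= S}.
  move=> al hs; have [|b hb] := @box_midxP N al; first by move=> i; exact: hN.
  by apply/mapP; exists b; rewrite ?mem_enum.
have uS : uniq S by rewrite map_inj_uniq ?enum_uniq//; exact: (@box_midx_inj N).
have le1 : \sum_(al <- s) (2^-1 : R) ^+ mdegree al <= \sum_(al <- S) (2^-1 : R) ^+ mdegree al.
  have pS : perm_eq s [seq al <- S | al \in s].
    apply: uniq_perm; rewrite ?filter_uniq// => al; rewrite mem_filter.
    by case: (boolP (al \in s)) => // /sS ->.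
  rewrite (perm_big _ pS) big_filter /= [leRHS](bigID (mem s)) /= lerDl.
  by apply: sumr_ge0 => al _; rewrite exprn_ge0// invr_ge0.
apply: le_trans le1 _; rewrite big_map big_enum /=.
have -> : \sum_(b : {ffun 'I_d -> 'I_N.+1}) (2^-1 : R) ^+ mdegree (box_midx b) =
   \sum_(b : {ffun 'I_d -> 'I_N.+1}) \prod_(i < d) (2^-1 : R) ^+ b i.
  apply: eq_bigr => b _; rewrite prodrXr; congr (_ ^+ _).
  by apply: eq_bigr => i _; rewrite ffunE.
rewrite -(bigA_distr_bigA (fun (i : 'I_d) (j : 'I_N.+1) => (2^-1 : R) ^+ j)) /=.
rewrite prodr_const card_ord; apply: lerXn2r; rewrite ?nnegrE//.
  by apply: sumr_ge0 => j _; rewrite exprn_ge0// invr_ge0.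
apply: le_trans (geo_sum_le _ _ _) _; rewrite ?invr_ge0 ?invf_lt1 ?ltr1n//.
have -> : 1 - 2^-1 = 2^-1 :> R by field.
by rewrite invrK lexx.
Qed.

Lemma totally_cvgP (x : midx -> V) (l : V) :
  partial_sum x @ totally --> l ->
  forall e : R, 0 < e -> exists A0 : {fset midx}, forall s : seq midx, uniq s ->
    {subset A0 <= s} -> nr (\sum_(al <- s) x al - l) <= e.
Proof.
move=> h e e0; have /cvgrPdist_le := h.
move=> /(_ _ e%:C%C); rewrite ltcR => /(_ (@totally_filter _) e0)[A0 _ hA0]; exists A0 => s us sA.
have := hA0 [fset al in s]%fset; rewrite /= /partial_sum.
rewrite (_ : \sum_(i : [fset al in s]%fset) x (val i) = \sum_(al <- s) x al).
  move=> hh; rewrite nr_le distrC; apply: hh.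
  by apply/fsubsetP => al /sA hal; rewrite in_fset.
rewrite -(big_seq_fsetE _ [fset al in s]%fset xpredT x) /=.
apply: perm_big; apply: uniq_perm; [exact: fset_uniq|by []|].
by move=> al; rewrite in_fset.
Qed.

Lemma taylor_trunc (F : V -> V) a c : taylor_expansion F a c ->
  exists K s : R, 0 < s /\ forall h, nr h <= s -> forall n,
    nr (F (a + h) - \sum_(j < n) homog c j h) <= K * (nr h / s) ^+ n.
Proof.
move=> /near_nr[s1 s10 ht].
pose h0 : V := const_mx (s1%:C%C).
have nh0 : nr h0 <= s1.
  apply/nr_row_le => [|i]; first exact: ltW.
  by rewrite mxE nrC gtr0_norm.
have m0 al : monomial h0 al = (s1%:C%C) ^+ mdegree al.
  by rewrite /monomial -prodrXr; apply: eq_bigr => i _; rewrite mxE.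
have [B [B0 hB]] : exists B : R, 0 <= B /\ forall al, nr (c al) * s1 ^+ mdegree al <= B.
  have := ht _ nh0; rewrite add0r => hh.
  have [A0 hA] := totally_cvgP hh ltr01.
  pose g al := nr (monomial h0 al *: c al).
  have gE al : g al = nr (c al) * s1 ^+ mdegree al.
    by rewrite /g nrZ m0 nrX nrC gtr0_norm// mulrC.
  exists (2 + \sum_(al <- A0) g al); split.
    by rewrite addr_ge0// sumr_ge0// => al _; exact: nr_ge0.
  move=> al; rewrite -gE; case: (boolP (al \in A0)) => hal.
    rewrite (big_fsetD1 al hal) /= addrCA lerDl addr_ge0//.
    by apply: sumr_ge0 => ? _; exact: nr_ge0.
  have u1 : uniq (al :: A0) by rewrite /= hal fset_uniq.
  have := hA _ u1; have := hA A0 (fset_uniq A0) (fun _ h => h).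
  rewrite big_cons /= => h1 /(_ (fun b hb => mem_behead (s := al :: A0) hb)) h2.
  have : g al <= 2.
    rewrite /g; set S := \sum_(_ <- _) _ in h1 h2.
    set T := _ *: _ in h2 *.
    have -> : T = (T + S - F (a + h0)) - (S - F (a + h0)).
      by rewrite opprB addrA subrK addrK.
    apply: le_trans (nrBle _ _) _; rewrite (_ : 2 = 1 + 1)// lerD//.
  move=> h3; apply: le_trans h3 _; rewrite lerDl sumr_ge0// => ? _; exact: nr_ge0.
exists (B * 2 ^+ d), (s1 / 2); split=> [|h hs n]; first by rewrite divr_gt0.
have hs1 : nr h <= s1 by apply: le_trans hs _; rewrite ler_pdivrMr// ler_peMr ?ler1n// ltW.
have := ht _ hs1; rewrite add0r => hh.
apply/ler_addgt0Pr => e e0; have [A0 hA] := totally_cvgP hh e0.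
pose s := undup (A0 ++ flatten [seq homog_midx j | j <- iota 0 n]).
have us : uniq s by rewrite undup_uniq.
have sA : {subset A0 <= s} by move=> al hal; rewrite mem_undup mem_cat hal.
have sS j : (j < n)%N -> {subset homog_midx j <= s}.
  move=> jn al hal; rewrite mem_undup mem_cat; apply/orP; right.
  by apply/flattenP; exists (homog_midx j) => //; apply: map_f; rewrite mem_iota.
pose x al := monomial h al *: c al.
have e1 : \sum_(al <- s) x al - \sum_(j < n) homog c j h =
          \sum_(al <- s | (n <= mdegree al)%N) x al.
  rewrite [X in X - _](bigID (fun al => (n <= mdegree al)%N)) /=.
  suff -> : \sum_(al <- s | ~~ (n <= mdegree al)%N) x al = \sum_(j < n) homog c j h by rewrite addrK.
  case: n s us sA sS => [|n] s us sA sS; first by rewrite big_ord0 big1.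
  rewrite (partition_big (fun al => inord (mdegree al) : 'I_n.+1) xpredT) //=.
  apply: eq_bigr => j _; rewrite /homog -big_filter.
  apply: perm_big; apply: uniq_perm; rewrite ?filter_uniq ?homog_midx_uniq//.
  move=> al; rewrite mem_filter mem_homog_midx -ltnNge.
  apply/andP/eqP => [[/andP[h1 /eqP <-] _]|h1]; first by rewrite inordK.
  split; last by apply: (sS j) => //; rewrite mem_homog_midx h1.
  by rewrite h1 ltn_ord/=; apply/eqP; apply: val_inj; rewrite /= inordK.
apply: le_trans (nrBD _ (\sum_(al <- s) x al) _) _; rewrite addrC e1 nrB lerD ?hA//.
apply: le_trans (nr_sum _ _ _) _.
have q0 : 0 <= nr h / (s1 / 2) by rewrite divr_ge0 ?nr_ge0// divr_ge0// ltW.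
have q1 : nr h / (s1 / 2) <= 1 by rewrite ler_pdivrMr ?divr_gt0// mul1r.
have s1n : s1 != 0 by rewrite gt_eqF.
apply: (@le_trans _ _ (\sum_(al <- s) (B * (nr h / (s1 / 2)) ^+ n * 2^-1 ^+ mdegree al))).
  rewrite big_mkcond; apply: ler_sum => al _; case: ifP => hn; last first.
    by rewrite mulr_ge0 ?mulr_ge0 ?exprn_ge0 ?invr_ge0.
  rewrite /x nrZ.
  apply: (@le_trans _ _ (B * (nr h / (s1 / 2)) ^+ mdegree al * 2^-1 ^+ mdegree al)).
    rewrite -mulrA -exprMn (_ : nr h / (s1 / 2) / 2 = nr h / s1); last by field.
    apply: (@le_trans _ _ (nr h ^+ mdegree al * nr (c al))).
      by rewrite ler_wpM2r ?nr_ge0// nr_monomial.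
    rewrite expr_div_n mulrA ler_pdivlMr ?exprn_gt0// -mulrA [leRHS]mulrC.
    by rewrite ler_wpM2l ?exprn_ge0 ?nr_ge0.
  by rewrite ler_wpM2r ?exprn_ge0 ?invr_ge0// ler_wpM2l// ler_wiXn2l.
rewrite -mulr_sumr [leRHS]mulrAC ler_wpM2l//.
  by rewrite mulr_ge0// exprn_ge0.
exact: sum_midx_le.
Qed.

End TaylorTruncation.

(** * Uniform approximation by polynomials *)

Section PolynomialApproximation.
Variables (R : realType).
Local Notation C := R[i].

Section Maps.
Variable d : nat.
Local Notation V := 'rV[C]_d.

Inductive polyfun : (V -> C) -> Prop :=
| polyfun_cst c : polyfun (fun _ => c)
| polyfun_coord i : polyfun (fun x => x ord0 i)
| polyfunD p q : polyfun p -> polyfun q -> polyfun (fun x => p x + q x)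
| polyfunM p q : polyfun p -> polyfun q -> polyfun (fun x => p x * q x).

Definition polymap (p : V -> V) := forall i, polyfun (fun x => p x ord0 i).

Lemma polyfun_lip p rho : polyfun p -> exists K : R, 0 <= K /\
  forall x y, nr x <= rho -> nr y <= rho -> nr (p x) <= K /\ nr (p x - p y) <= K * nr (x - y).
Proof.
elim=> [c|i|{}p q _ [K [K0 hK]] _ [L [L0 hL]]|{}p q _ [K [K0 hK]] _ [L [L0 hL]]].
- exists (nr c); split=> [|x y _ _]; first exact: nr_ge0.
  by rewrite subrr nr0 lexx mulr_ge0 ?nr_ge0.
- exists (`|rho| + 1); split=> [|x y hx hy]; first by rewrite addr_ge0.
  split.
    apply: le_trans (nr_coord x i) _; apply: le_trans hx _.
    by apply: le_trans (ler_norm _) _; rewrite lerDl.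
  have -> : x ord0 i - y ord0 i = (x - y) ord0 i by rewrite !mxE.
  apply: le_trans (nr_coord _ i) _; rewrite ler_peMl ?nr_ge0// lerDr//.
- exists (K + L); split=> [|x y hx hy]; first by rewrite addr_ge0.
  have [h1 h2] := hK _ _ hx hy; have [h3 h4] := hL _ _ hx hy.
  split; first by apply: le_trans (nrD _ _) _; rewrite lerD.
  by rewrite opprD addrACA mulrDl; apply: le_trans (nrD _ _) _; rewrite lerD.
exists (2 * (K * L) + K * L); split=> [|x y hx hy]; first by rewrite addr_ge0 ?mulr_ge0.
have [h1 h2] := hK _ _ hx hy; have [h3 h4] := hL _ _ hx hy.
have [h5 _] := hK _ _ hy hx.
have KL : 0 <= K * L by rewrite mulr_ge0.
split.
  rewrite nrM; apply: (@le_trans _ _ (K * L)); last by rewrite lerDr mulr_ge0.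
  by rewrite ler_pM ?nr_ge0.
have -> : p x * q x - p y * q y = (p x - p y) * q x + p y * (q x - q y) by ring.
apply: le_trans (nrD _ _) _; rewrite !nrM.
apply: (@le_trans _ _ (K * nr (x - y) * L + K * (L * nr (x - y)))).
  by rewrite lerD// ler_pM ?nr_ge0.
have := nr_ge0 (x - y); nra.
Qed.

Lemma polyfun_comp p q : polyfun p -> polymap q -> polyfun (fun x => p (q x)).
Proof.
move=> pp pq; elim: pp => [c|i|? ? _ h1 _ h2|? ? _ h1 _ h2].
- exact: polyfun_cst.
- exact: pq.
- exact: polyfunD.
- exact: polyfunM.
Qed.

Lemma polyfun_curve p (u : C -> V) : polyfun p ->
  (forall i, exists P : {poly C}, forall t, u t ord0 i = P.[t]) ->
  exists P : {poly C}, forall t, p (u t) = P.[t].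
Proof.
move=> pp hu; elim: pp => [c|i|? ? _ [P hP] _ [Q hQ]|? ? _ [P hP] _ [Q hQ]].
- by exists c%:P => t; rewrite hornerC.
- exact: hu.
- by exists (P + Q) => t; rewrite hornerD hP hQ.
- by exists (P * Q) => t; rewrite hornerM hP hQ.
Qed.

Lemma polyfunX p n : polyfun p -> polyfun (fun x => p x ^+ n).
Proof.
move=> pp; elim: n => [|n ih]; first exact: polyfun_cst.
have -> : (fun x => p x ^+ n.+1) = (fun x => p x * p x ^+ n) by apply/funext => x; rewrite exprS.
exact: polyfunM.
Qed.

Lemma polyfun_sum (I : Type) (s : seq I) (F : I -> V -> C) :
  (forall i, polyfun (F i)) -> polyfun (fun x => \sum_(i <- s) F i x).
Proof.
move=> h; elim: s => [|i s ih].
  have -> : (fun x => \sum_(i <- [::]) F i x) = (fun=> 0) by apply/funext => x; rewrite big_nil.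
  exact: polyfun_cst.
have -> : (fun x => \sum_(j <- i :: s) F j x) = (fun x => F i x + \sum_(j <- s) F j x).
  by apply/funext => x; rewrite big_cons.
exact: polyfunD.
Qed.

Lemma polyfun_prod (I : Type) (s : seq I) (F : I -> V -> C) :
  (forall i, polyfun (F i)) -> polyfun (fun x => \prod_(i <- s) F i x).
Proof.
move=> h; elim: s => [|i s ih].
  have -> : (fun x => \prod_(i <- [::]) F i x) = (fun=> 1) by apply/funext => x; rewrite big_nil.
  exact: polyfun_cst.
have -> : (fun x => \prod_(j <- i :: s) F j x) = (fun x => F i x * \prod_(j <- s) F j x).
  by apply/funext => x; rewrite big_cons.
exact: polyfunM.
Qed.

Lemma polymap_homog c j : polymap (homog c j).
Proof.
move=> i.
have -> : (fun x => homog c j x ord0 i) =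
   (fun x => \sum_(al <- homog_midx d j) monomial x al * c al ord0 i).
  by apply/funext => x; rewrite /homog summxE; apply: eq_bigr => al _; rewrite mxE.
apply: polyfun_sum => al; apply: polyfunM; last exact: polyfun_cst.
by apply: polyfun_prod => k; apply: polyfunX; exact: polyfun_coord.
Qed.

Definition papprox (rho : R) (F : V -> V) := forall e : R, 0 < e ->
  exists p, polymap p /\ forall x, nr x <= rho -> nr (F x - p x) <= e.

Lemma papprox_poly rho p : polymap p -> papprox rho p.
Proof. by move=> pp e e0; exists p; split => // x _; rewrite subrr nr0 ltW. Qed.

Lemma papprox_id rho : papprox rho id.
Proof. by apply: papprox_poly => i; exact: polyfun_coord. Qed.

Lemma papprox_le rho rho' F : rho' <= rho -> papprox rho F -> papprox rho' F.
Proof.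
move=> h hF e /hF[p [pp hp]]; exists p; split => // x hx.
by apply: hp; exact: le_trans h.
Qed.

Lemma papprox_lim rho F : (forall e : R, 0 < e -> exists G, papprox rho G /\
  forall x, nr x <= rho -> nr (F x - G x) <= e) -> papprox rho F.
Proof.
move=> h e e0; have e2 : 0 < e / 2 by rewrite divr_gt0.
have [G [hG hFG]] := h _ e2; have [p [pp hp]] := hG _ e2.
exists p; split=> // x hx; apply: le_trans (nrBD _ (G x) _) _.
by rewrite [leRHS]splitr lerD ?hFG ?hp.
Qed.

Lemma papprox_ext rho F G : (forall x, nr x <= rho -> F x = G x) -> papprox rho G -> papprox rho F.
Proof.
move=> h hG; apply: papprox_lim => e e0; exists G; split => // x hx.
by rewrite h// subrr nr0 ltW.
Qed.

Lemma papproxD rho F G : papprox rho F -> papprox rho G -> papprox rho (fun x => F x + G x).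
Proof.
move=> hF hG e e0; have e2 : 0 < e / 2 by rewrite divr_gt0.
have [p [pp hp]] := hF _ e2; have [q [pq hq]] := hG _ e2.
exists (fun x => p x + q x); split=> [i|x hx].
  have -> : (fun x => (p x + q x) ord0 i) = (fun x => p x ord0 i + q x ord0 i).
    by apply/funext => x; rewrite mxE.
  exact: polyfunD.
rewrite opprD addrACA; apply: le_trans (nrD _ _) _.
by rewrite [leRHS]splitr lerD ?hp ?hq.
Qed.

Lemma papproxZ rho (a : C) F : papprox rho F -> papprox rho (fun x => a *: F x).
Proof.
move=> hF e e0; have a1 : 0 < nr a + 1 by have := nr_ge0 a; lra.
have [|p [pp hp]] := hF (e / (nr a + 1)); first by rewrite divr_gt0.
exists (fun x => a *: p x); split=> [i|x hx].
  have -> : (fun x => (a *: p x) ord0 i) = (fun x => a * p x ord0 i).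
    by apply/funext => x; rewrite mxE.
  by apply: polyfunM => //; exact: polyfun_cst.
rewrite -scalerBr nrZ; have := hp _ hx; rewrite ler_pdivlMr// => h.
apply: le_trans h; rewrite mulrC ler_wpM2l ?nr_ge0// lerDl//.
Qed.

Lemma papproxB rho F G : papprox rho F -> papprox rho G -> papprox rho (fun x => F x - G x).
Proof.
move=> hF hG; apply: (@papprox_ext _ _ (fun x => F x + -1 *: G x)).
  by move=> x _; rewrite scaleN1r.
by apply: papproxD => //; exact: papproxZ.
Qed.

Lemma papprox_sum rho n (F : nat -> V -> V) : (forall i, (i < n)%N -> papprox rho (F i)) ->
  papprox rho (fun x => \sum_(i < n) F i x).
Proof.
elim: n => [_|n ih h].
  apply: (@papprox_ext _ _ (fun x => 0 *: id x)); first by move=> x _; rewrite big_ord0 scale0r.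
  by apply: papproxZ; exact: papprox_id.
apply: (@papprox_ext _ _ (fun x => \sum_(i < n) F i x + F n x)).
  by move=> x _; rewrite big_ord_recr.
by apply: papproxD; [apply: ih => i hi; apply: h; exact: ltnW|exact: h].
Qed.

Lemma polymap_lip p rho : polymap p -> exists K : R, 0 <= K /\
  forall x y, nr x <= rho -> nr y <= rho -> nr (p x - p y) <= K * nr (x - y).
Proof.
move=> pp; have /(_ _)/cid h := fun i => polyfun_lip rho (pp i).
pose K i := projT1 (h i).
have hK i : 0 <= K i /\ forall x y, nr x <= rho -> nr y <= rho ->
    nr (p x ord0 i - p y ord0 i) <= K i * nr (x - y).
  rewrite /K; case: (h i) => k /= [k0 hk]; split=> // x y hx hy.
  by have [] := hk _ _ hx hy.
exists (\sum_i K i); split=> [|x y hx hy].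
  by apply: sumr_ge0 => i _; have [] := hK i.
have S0 : 0 <= \sum_i K i by apply: sumr_ge0 => i _; have [] := hK i.
apply/nr_row_le => [|i]; first by rewrite mulr_ge0 ?nr_ge0.
rewrite !mxE; have [k0 hk] := hK i; apply: le_trans (hk _ _ hx hy) _.
rewrite ler_wpM2r ?nr_ge0// (bigD1 i) //= lerDl.
by apply: sumr_ge0 => j _; have [] := hK j.
Qed.

Lemma papprox_comp rho rho' F G : papprox rho' F -> papprox rho G ->
  (forall x, nr x <= rho -> nr (G x) <= rho') -> papprox rho (fun x => F (G x)).
Proof.
move=> hF hG hr e e0; have e2 : 0 < e / 2 by rewrite divr_gt0.
have [p [pp hp]] := hF _ e2.
have [K [K0 hK]] := polymap_lip (rho' + 1) pp.
have K1 : 0 < K + 1 by lra.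
have [|q [pq hq]] := hG (Num.min 1 (e / 2 / (K + 1))).
  by rewrite lt_min ltr01 divr_gt0.
exists (fun x => p (q x)); split=> [i|x hx].
  exact: (@polyfun_comp (fun x => p x ord0 i)).
apply: le_trans (nrBD _ (p (G x)) _) _; rewrite [leRHS]splitr lerD ?hp ?hr//.
have := hq _ hx; rewrite le_min => /andP[h1 h2].
have hG1 := hr _ hx.
apply: le_trans (hK _ _ _ _) _; first by lra.
  by have := nr_leD (q x) (G x); rewrite nrB; lra.
move: h2; rewrite ler_pdivlMr// => h2; apply: le_trans h2.
by rewrite mulrC ler_wpM2l ?nr_ge0// lerDl.
Qed.

End Maps.

Definition papprox1 (T : R) (phi : C -> C) := forall e : R, 0 < e ->
  exists P : {poly C}, forall z, nr z <= T -> nr (phi z - P.[z]) <= e.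

Lemma papprox_curve d (F : 'rV[C]_d -> 'rV[C]_d) rho T (u : C -> 'rV[C]_d) i : papprox rho F ->
  (forall i, exists P : {poly C}, forall t, u t ord0 i = P.[t]) ->
  (forall t, nr t <= T -> nr (u t) <= rho) -> papprox1 T (fun t => F (u t) ord0 i).
Proof.
move=> hF hu hr e e0; have [p [pp hp]] := hF _ e0.
have [P hP] := polyfun_curve (pp i) hu.
exists P => z hz; rewrite -hP.
have -> : F (u z) ord0 i - p (u z) ord0 i = (F (u z) - p (u z)) ord0 i by rewrite !mxE.
by apply: le_trans (nr_coord _ i) _; apply: hp; exact: hr.
Qed.

Lemma papprox1B T phi (P : {poly C}) : papprox1 T phi -> papprox1 T (fun t => phi t - P.[t]).
Proof.
move=> h e /h[Q hQ]; exists (Q - P) => z hz.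
by rewrite hornerD hornerN opprB addrA subrK hQ.
Qed.

Lemma poly_tail_bound (P : {poly C}) (M T : R) n t : 0 < T -> 0 <= M ->
  (forall j, nr P`_j <= M / T ^+ j) -> nr t < T ->
  nr (P.[t] - \sum_(j < n) P`_j * t ^+ j) <= M * (nr t / T) ^+ n / (1 - nr t / T).
Proof.
move=> T0 M0 hP tT; set q := nr t / T.
have q0 : 0 <= q by rewrite divr_ge0 ?nr_ge0// ltW.
have q1 : q < 1 by rewrite ltr_pdivrMr// mul1r.
have -> : P.[t] - \sum_(j < n) P`_j * t ^+ j = (drop_poly n P).[t] * t ^+ n.
  rewrite -{1}(poly_take_drop n P) hornerD /take_poly horner_poly addrAC subrr add0r.
  by rewrite hornerM hornerXn.
rewrite nrM nrX horner_coef.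
apply: (@le_trans _ _ ((M / T ^+ n / (1 - q)) * nr t ^+ n)).
  rewrite ler_wpM2r ?exprn_ge0 ?nr_ge0//.
  apply: le_trans (nr_sum _ _ _) _.
  apply: (@le_trans _ _ (\sum_(i < size (drop_poly n P)) (M / T ^+ n) * q ^+ i)).
    apply: ler_sum => i _; rewrite coef_drop_poly nrM nrX.
    apply: le_trans (ler_wpM2r _ (hP _)) _; first by rewrite exprn_ge0 ?nr_ge0.
    by rewrite exprD /q expr_div_n invfM; lra.
  by rewrite -mulr_sumr ler_wpM2l ?geo_sum_le// divr_ge0// exprn_ge0// ltW.
rewrite /q expr_div_n; have : 1 - q != 0 by rewrite subr_eq0 gt_eqF.
by rewrite -/q => h; rewrite le_eqVlt; apply/orP; left; apply/eqP; field; rewrite h expf_neq0// gt_eqF.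
Qed.

Lemma schwarz_papprox1 (phi : C -> C) (B : R) n z :
  papprox1 1 phi -> (forall z, nr z <= 1 -> nr (phi z) <= B) ->
  (exists L s : R, 0 < s /\ forall h, nr h <= s -> nr (phi h) <= L * nr h ^+ n) ->
  nr z < 1 -> nr (phi z) <= B * nr z ^+ n / (1 - nr z).
Proof.
move=> pa hB [L [s [s0 hL]]] z1; set q := nr z.
have q0 : 0 <= q by exact: nr_ge0.
have q1 : 0 < 1 - q by rewrite subr_gt0.
have B0 : 0 <= B by apply: le_trans (hB 0 _); rewrite ?nr_ge0// nr0.
have m0 : 0 < Num.min 1 s by rewrite lt_min ltr01.
apply: (@le_of_eps _ _ _ (n%:R * `|L|) _ m0) => t t0; rewrite le_min => /andP[t1 ts].
apply: (@le_of_eps _ _ _ (1 + n%:R * t ^- n + q ^+ n / (1 - q)) 1) => // e e0 e1.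
have [P hP] := pa _ e0.
have PB w : nr w <= 1 -> nr P.[w] <= B + e.
  move=> hw; apply: le_trans (nr_leD _ (phi w)) _.
  by rewrite lerD ?hB// nrB hP.
have cB j : nr P`_j <= (B + e) / 1 ^+ j by exact: cauchy_poly.
have Be : 0 <= B + e by rewrite addr_ge0// ltW.
have := @poly_tail_bound P (B + e) 1 n z ltr01 Be cB; rewrite divr1 => /(_ z1) h1.
have cl (j : 'I_n) : nr P`_j <= e * t ^- n + `|L| * t.
  have Pt w : nr w <= t -> nr P.[w] <= e + `|L| * t ^+ n.
    move=> hw; apply: le_trans (nr_leD _ (phi w)) _.
    rewrite addrC lerD//; first by rewrite nrB hP// (le_trans hw).
    apply: le_trans (hL _ (le_trans hw ts)) _.
    apply: le_trans (ler_wpM2r _ (ler_norm _)) _; first by rewrite exprn_ge0 ?nr_ge0.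
    by rewrite ler_wpM2l// lerXn2r ?nnegrE ?nr_ge0// ltW.
  apply: le_trans (cauchy_poly j t0 Pt) _; rewrite mulrDl lerD//.
    rewrite ler_wpM2l ?(ltW e0)// lef_pV2 ?posrE ?exprn_gt0//.
    by rewrite ler_wiXn2l ?(ltW t0)// ltnW.
  rewrite -mulrA ler_wpM2l// ler_pdivrMr ?exprn_gt0// -exprS ler_wiXn2l ?(ltW t0)//.
have h2 : nr (\sum_(j < n) P`_j * z ^+ j) <= n%:R * (e * t ^- n + `|L| * t).
  apply: le_trans (nr_sum _ _ _) _.
  rewrite mulr_natl -[X in _ *+ X]card_ord -sumr_const; apply: ler_sum => j _.
  rewrite nrM nrX; apply: le_trans (cl j); rewrite ler_piMr ?nr_ge0// exprn_ile1 ?nr_ge0// ltW//.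
apply: le_trans (nr_leD _ P.[z]) _.
apply: le_trans (lerD (nr_leD _ (\sum_(j < n) P`_j * z ^+ j)) (hP _ (ltW z1))) _.
apply: le_trans (lerD (lerD h2 h1) (lexx e)) _.
by rewrite -/q; lra.
Qed.

Lemma node_values_bound n (tau : R) : exists L : R, 0 <= L /\
  forall (Q : {poly C}) (M : R), (size Q <= n)%N ->
  (forall k, (k < n)%N -> nr Q.[k%:R] <= M) -> 0 <= M ->
  forall t, nr t <= tau -> nr Q.[t] <= L * M.
Proof.
elim: n => [|n [L [L0 ih]]].
  exists 0; split=> // Q M; rewrite leqn0 size_poly_eq0 => /eqP -> _ M0 t _.
  by rewrite horner0 nr0 mul0r.
exists (1 + (`|tau| + n%:R) * (L * 2)); split.
  by rewrite addr_ge0// mulr_ge0 ?mulr_ge0// addr_ge0.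
move=> Q M sQ hQ M0 t ht.
have [Q1 hQ1] : exists Q1, Q - Q.[n%:R]%:P = Q1 * ('X - n%:R%:P).
  by apply/factor_theorem; rewrite rootE !hornerE subrr.
have QE x : Q.[x] = Q.[n%:R] + Q1.[x] * (x - n%:R).
  by have := congr1 (fun p => p.[x]) hQ1; rewrite !hornerE => /eqP; rewrite subr_eq addrC => /eqP.
have sQ1 : (size Q1 <= n)%N.
  case: (eqVneq Q1 0) => [->|Q10]; first by rewrite size_poly0.
  have : (size (Q1 * ('X - n%:R%:P))%R <= n.+1)%N.
    rewrite -hQ1; apply: leq_trans (size_polyD _ _) _; rewrite geq_max sQ size_polyN.
    by apply: leq_trans (size_polyC_leq1 _) _.
  by rewrite size_Mmonic ?monicXsubC// size_XsubC addn2.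
have h1 : nr Q1.[t] <= L * (2 * M).
  apply: ih => // [k kn|]; last by rewrite mulr_ge0.
  have kn0 : 0 < nr (k%:R - n%:R : C) by rewrite lt_neqAle eq_sym nr_eq0 nr_ge0 subr_eq0 eqr_nat ltn_eqF.
  have kn1 : 1 <= nr (k%:R - n%:R : C).
    by rewrite nrB -natrB ?(ltnW kn)// nr_nat ler1n subn_gt0.
  have : nr (Q1.[k%:R] * (k%:R - n%:R)) <= 2 * M.
    have -> : Q1.[k%:R] * (k%:R - n%:R) = Q.[k%:R] - Q.[n%:R] by rewrite [in RHS]QE addrAC subrr add0r.
    apply: le_trans (nrBle _ _) _; have := hQ k (ltnW kn); have := hQ n (leqnn _); lra.
  by apply: le_trans; rewrite nrM ler_peMr ?nr_ge0.
rewrite QE; apply: le_trans (nrD _ _) _; rewrite mulrDl mul1r lerD ?hQ//.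
rewrite nrM mulrC -!mulrA; apply: ler_pM; rewrite ?nr_ge0//.
apply: le_trans (nrBle _ _) _; rewrite nr_nat lerD2r; apply: le_trans ht _; exact: ler_norm.
Qed.

(* A function that is bounded by [B] on a disc of large radius [T] and vanishes
   at [0, ..., n-1] is close to its Taylor polynomial of degree [< n], which is
   controlled by its values at the nodes. *)
Lemma zeros_at_nodes n (tau : R) : n%:R <= tau -> exists A : R, 0 <= A /\
  forall (phi : C -> C) (T B : R), 2 * tau <= T -> 0 < T -> papprox1 T phi ->
  (forall t, nr t <= T -> nr (phi t) <= B) ->
  (forall k, (k < n)%N -> phi k%:R = 0) ->
  forall t, nr t <= tau -> nr (phi t) <= A * B / T ^+ n.
Proof.
move=> ntau; have [L [L0 hL]] := node_values_bound n tau.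
have tau0 : 0 <= tau by apply: le_trans ntau.
exists (2 * (1 + L) * tau ^+ n); split; first by rewrite !mulr_ge0 ?exprn_ge0// addr_ge0.
move=> phi T B tT T0 pa hB hz t ht.
have B0 : 0 <= B by apply: le_trans (hB 0 _); rewrite ?nr_ge0// nr0 ltW.
set D := (tau / T) ^+ n.
have D0 : 0 <= D by rewrite exprn_ge0// divr_ge0// ltW.
apply: (@le_of_eps _ _ _ (1 + 2 * D + L * (1 + 2 * D)) 1) => // e e0 e1.
have [P hP] := pa _ e0.
have PB w : nr w <= T -> nr P.[w] <= B + e.
  move=> hw; apply: le_trans (nr_leD _ (phi w)) _.
  by rewrite lerD ?hB// nrB hP.
have cB j : nr P`_j <= (B + e) / T ^+ j by exact: cauchy_poly.
have Be : 0 <= B + e by rewrite addr_ge0// ltW.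
have tl w : nr w <= tau -> nr (P.[w] - (take_poly n P).[w]) <= 2 * ((B + e) * D).
  move=> hw; rewrite /take_poly horner_poly.
  have q0 : 0 <= nr w / T by rewrite divr_ge0 ?nr_ge0// ltW.
  have q2 : nr w / T <= 2^-1 by rewrite ler_pdivrMr// ler_pdivlMl//; lra.
  have wT : nr w < T by move: q2; rewrite ler_pdivrMr//; lra.
  apply: le_trans (poly_tail_bound n T0 Be cB wT) _.
  have q3 : 0 < 1 - nr w / T by lra.
  rewrite ler_pdivrMr//; apply: (@le_trans _ _ ((B + e) * D)).
    rewrite ler_wpM2l// /D lerXn2r ?nnegrE//; first by rewrite divr_ge0// ltW.
    by rewrite ler_wpM2r// invr_ge0 ltW.
  have := mulr_ge0 Be D0; nra.
have wT w : nr w <= tau -> nr w <= T by move=> hw; lra.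
have h1 : nr (take_poly n P).[t] <= L * (e + 2 * ((B + e) * D)).
  apply: hL => //; first exact: size_take_poly.
    move=> k kn; have ktau : nr (k%:R : C) <= tau.
      by rewrite nr_nat; apply: le_trans ntau; rewrite ler_nat ltnW.
    apply: le_trans (nr_leD _ P.[k%:R]) _; rewrite lerD//.
      by have := hP _ (wT _ _ ktau); rewrite hz// sub0r nrN.
    by rewrite nrB tl.
  by rewrite addr_ge0 ?(ltW e0)// mulr_ge0// mulr_ge0.
apply: le_trans (nr_leD _ P.[t]) _.
apply: le_trans (lerD (nr_leD _ (take_poly n P).[t]) (hP _ (wT _ _ ht))) _.
apply: le_trans (lerD (lerD h1 (tl _ ht)) (lexx e)) _.
have -> : 2 * (1 + L) * tau ^+ n * B / T ^+ n = 2 * (1 + L) * B * D.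
  by rewrite /D expr_div_n; field; rewrite expf_neq0// gt_eqF.
by lra.
Qed.

End PolynomialApproximation.

(** * Schwarz lemma and Lipschitz bounds for maps *)

Section AnalyticMaps.
Variables (R : realType) (d : nat).
Local Notation C := R[i].
Local Notation V := 'rV[C]_d.

Lemma line_poly (x v : V) (i : 'I_d) :
  exists P : {poly C}, forall t, (x + t *: v) ord0 i = P.[t].
Proof.
exists ((x ord0 i)%:P + (v ord0 i)%:P * 'X) => t.
by rewrite !hornerE !mxE mulrC.
Qed.

Definition order_ge (n : nat) (F : V -> V) : Prop :=
  exists L s : R, 0 < s /\ forall h, nr h <= s -> nr (F h) <= L * nr h ^+ n.

Lemma schwarz_map (F : V -> V) (rho B q : R) n x : 0 < q -> q < 1 ->
  papprox rho F -> (forall x, nr x <= rho -> nr (F x) <= B) -> order_ge n F ->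
  nr x <= q * rho -> nr (F x) <= B * q ^+ n / (1 - q).
Proof.
move=> q0 q1 pa hB [L [s [s0 hL]]] hx.
pose y : V := (q^-1)%:C%C *: x.
have ny : nr y <= rho by rewrite nrZ nrC gtr0_norm ?invr_gt0// ler_pdivrMl.
have xy : x = q%:C%C *: y.
  by rewrite scalerA -rmorphM divff ?gt_eqF// rmorph1 scale1r.
have rho0 : 0 <= rho by apply: le_trans ny; exact: nr_ge0.
have B0 : 0 <= B by apply: le_trans (hB 0 _); rewrite ?nr_ge0// nr0.
have q10 : 0 < 1 - q by rewrite subr_gt0.
apply/nr_row_le => [|i]; first by rewrite divr_ge0 ?(ltW q10)// mulr_ge0// exprn_ge0// ltW.
have hr (t : C) : nr t <= 1 -> nr (t *: y) <= rho.
  by move=> ht; rewrite nrZ; apply: le_trans ny; rewrite ler_piMl ?nr_ge0.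
have := @schwarz_papprox1 R (fun t => F (t *: y) ord0 i) B n (q%:C%C).
rewrite -xy nrC gtr0_norm//; apply => //.
- apply: (@papprox_curve R d F rho 1 (fun t => t *: y) i pa) => // j.
  have [P hP] := line_poly 0 y j; exists P => t.
  by rewrite -hP add0r.
- by move=> t ht; apply: le_trans (nr_coord _ i) _; apply: hB; exact: hr.
exists (`|L| * nr y ^+ n), (s / (nr y + 1)); have ny1 : 0 < nr y + 1 by have := nr_ge0 y; lra.
split=> [|h]; first by rewrite divr_gt0.
rewrite ler_pdivlMr// => hh; apply: le_trans (nr_coord _ i) _.
apply: le_trans (hL _ _) _.
  rewrite nrZ; apply: le_trans hh; rewrite ler_wpM2l ?nr_ge0// lerDl//.
rewrite nrZ exprMn (_ : `|L| * _ * _ = `|L| * (nr h ^+ n * nr y ^+ n)); last by ring.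
by rewrite ler_wpM2r ?ler_norm// mulr_ge0 ?exprn_ge0 ?nr_ge0.
Qed.

Lemma lipschitz_map (F : V -> V) (rho B : R) x y : 0 < rho ->
  papprox (2 * rho) F -> (forall x, nr x <= 2 * rho -> nr (F x) <= B) ->
  nr x <= rho -> nr y <= rho -> nr (F x - F y) <= 4 * B / rho * nr (x - y).
Proof.
move=> rho0 pa hB hx hy.
have hx2 : nr x <= 2 * rho by lra.
have hy2 : nr y <= 2 * rho by lra.
have B0 : 0 <= B by apply: le_trans (hB x hx2); rewrite nr_ge0.
case: (eqVneq x y) => [->|xy]; first by rewrite !subrr nr0 mulr0.
have nv : 0 < nr (x - y) by rewrite lt_neqAle eq_sym nr_eq0 nr_ge0 subr_eq0 xy.
pose T := rho / nr (x - y).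
have T0 : 0 < T by rewrite divr_gt0.
have -> : 4 * B / rho * nr (x - y) = 4 * B / T.
  by rewrite /T; field; rewrite !gt_eqF.
case: (ltrP T 2) => T2.
  apply: le_trans (nrBle _ _) _; apply: le_trans (lerD (hB _ hx2) (hB _ hy2)) _.
  by rewrite ler_pdivlMr//; nra.
apply/nr_row_le => [|i]; first by rewrite divr_ge0 ?(ltW T0)// mulr_ge0.
have hr (t : C) : nr t <= T -> nr (y + t *: (x - y)) <= 2 * rho.
  rewrite /T ler_pdivlMr// => ht; apply: le_trans (nrD _ _) _; rewrite nrZ; lra.
apply: (@le_of_eps _ _ _ (2 + 2 / T) 1) => // e e0 e1.
have [P hP] := papprox_curve i pa (line_poly y (x - y)) hr e0.
have PB w : nr w <= T -> nr P.[w] <= B + e.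
  move=> hw; apply: le_trans (nr_leD _ (F (y + w *: (x - y)) ord0 i)) _.
  rewrite lerD//; last by rewrite nrB hP.
  by apply: le_trans (nr_coord _ i) _; apply: hB; exact: hr.
have cB j : nr P`_j <= (B + e) / T ^+ j by exact: cauchy_poly.
have Be : 0 <= B + e by rewrite addr_ge0// ltW.
have T1 : nr (1 : C) < T by rewrite nr1; lra.
have := poly_tail_bound 1 T0 Be cB T1.
rewrite big_ord1 expr0 mulr1 nr1 div1r expr1 => h1.
have h2 : (B + e) / T / (1 - T^-1) <= 2 * (B + e) / T.
  have TI : T^-1 <= 2^-1 by rewrite lef_pV2 ?posrE.
  rewrite ler_pdivrMr; last by lra.
  have : 0 <= (B + e) / T by rewrite divr_ge0// ltW.
  by rewrite -[2 * _ / _]mulrA; nra.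
have n1T : nr (1 : C) <= T by exact: ltW.
have n0T : nr (0 : C) <= T by rewrite nr0 ltW.
have := hP _ n1T; have := hP _ n0T; rewrite scale0r addr0 scale1r subrKC.
rewrite horner_coef0 => h3 h4.
have -> : (F x - F y) ord0 i = (F x ord0 i - P.[1]) + (P.[1] - P`_0) - (F y ord0 i - P`_0).
  by rewrite !mxE; ring.
apply: le_trans (nrBle _ _) _; apply: le_trans (lerD (nrD _ _) (lexx _)) _.
apply: le_trans (lerD (lerD h4 (le_trans h1 h2)) h3) _.
have : e / T <= e by rewrite ler_pdivrMr// ler_peMr ?(ltW e0)//; lra.
have : 0 <= B / T by rewrite divr_ge0// ltW.
have -> : 2 * (B + e) / T = 2 * (B / T) + 2 * (e / T) by rewrite mulrDr mulrDl !mulrA.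
have -> : 4 * B / T = 4 * (B / T) by rewrite mulrA.
have -> : (2 + 2 / T) * e = 2 * e + 2 * (e / T) by rewrite mulrDl; congr (_ + _); rewrite mulrAC mulrA.
by lra.
Qed.

Lemma expansion_ray (F : V -> V) (y : V) (z : C) c i :
  taylor_expansion F (z *: y) c ->
  exists K s, expansion (fun l => F (l *: y) ord0 i) z (fun j => homog c j y ord0 i) K s.
Proof.
move=> /taylor_trunc[K [s [s0 h]]].
have ny1 : 0 < nr y + 1 by have := nr_ge0 y; lra.
have K0 : 0 <= K.
  have := h 0; rewrite nr0 => /(_ (ltW s0) 0%N); rewrite expr0 mulr1.
  by apply: le_trans; rewrite nr_ge0.
exists K, (s / (nr y + 1)); split=> [|e]; first by rewrite divr_gt0.
rewrite ler_pdivlMr// => he n.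
have hle : nr (e *: y) <= nr e * (nr y + 1) by rewrite nrZ ler_wpM2l ?nr_ge0// lerDl.
have := h _ (le_trans hle he) n; rewrite -scalerDl.
have -> : F ((z + e) *: y) ord0 i - \sum_(j < n) homog c j y ord0 i * e ^+ j =
   (F ((z + e) *: y) - \sum_(j < n) homog c j (e *: y)) ord0 i.
  rewrite !mxE summxE; congr (_ - _); apply: eq_bigr => j _.
  by rewrite homogZ mxE mulrC.
move=> h1; apply: le_trans (nr_coord _ i) _; apply: le_trans h1 _.
rewrite ler_wpM2l// lerXn2r ?nnegrE ?divr_ge0 ?nr_ge0// ?(ltW s0)// ?(ltW ny1)//.
by rewrite invf_div mulrA ler_wpM2r// invr_ge0 ltW.
Qed.

Lemma analytic_ray (F : V -> V) (y : V) (z : C) i :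
  analytic_at F (z *: y) -> ana1 (fun l => F (l *: y) ord0 i) z.
Proof. by move=> [c /(expansion_ray i)[K [s h]]]; do 3 eexists; exact: h. Qed.

Lemma geo_lin_small (B q e : R) : 0 <= B -> 0 <= q -> q < 1 -> 0 < e ->
  exists n, n.+1%:R * B * q ^+ n <= e.
Proof.
move=> B0 q0 q1 e0; pose p := (1 + q) / 2.
have p1 : p < 1 by rewrite /p; lra.
have p0 : 0 < p by rewrite /p; lra.
have qp : q < p by rewrite /p; lra.
have lin n : n%:R * (1 - p) * p ^+ n <= 1.
  have : \sum_(k < n) p ^+ n <= \sum_(k < n) p ^+ k.
    by apply: ler_sum => k _; rewrite ler_wiXn2l ?(ltW p0) ?(ltW p1)// ltnW.
  rewrite sumr_const card_ord => h.
  by rewrite mulrAC -ler_pdivlMr ?subr_gt0// div1r mulr_natl (le_trans h (geo_sum_le n (ltW p0) p1)).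
pose K := B * ((1 - p)^-1 + 1).
have K0 : 0 <= K by rewrite mulr_ge0// addr_ge0// invr_ge0; lra.
have r0 : 0 <= q / p by rewrite divr_ge0// ltW.
have r1 : q / p < 1 by rewrite ltr_pdivrMr// mul1r.
have : (fun n => K * (q / p) ^+ n) @ \oo --> K * 0.
  by apply: cvgMr; apply: cvg_expr; rewrite ger0_norm.
rewrite mulr0 => /cvgrPdist_lt /(_ _ e0)[N _ /(_ N (leqnn N))] /=.
rewrite sub0r normrN => hh; exists N.
apply: le_trans (ltW (le_lt_trans (ler_norm _) hh)).
have -> : q ^+ N = (q / p) ^+ N * p ^+ N by rewrite -exprMn divfK// gt_eqF.
rewrite mulrA mulrAC; apply: ler_wpM2r; first by rewrite exprn_ge0.
rewrite mulrAC [leLHS]mulrC ler_wpM2l// -natr1 mulrDl mul1r lerD//.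
  by have := lin N; rewrite mulrAC -ler_pdivlMr ?subr_gt0// mul1r.
by rewrite exprn_ile1// ltW.
Qed.

Lemma analytic_papprox (F : V -> V) (r0 B rho : R) : 0 < rho -> rho < r0 ->
  (forall x, nr x <= r0 -> analytic_at F x) ->
  (forall x, nr x <= r0 -> nr (F x) <= B) -> papprox rho F.
Proof.
move=> rho0 rhor an hB; have r00 : 0 < r0 by lra.
have B0 : 0 <= B by apply: le_trans (hB 0 _); rewrite ?nr_ge0// nr0 ltW.
pose q := rho / r0.
have q0 : 0 < q by rewrite divr_gt0.
have q1 : q < 1 by rewrite ltr_pdivrMr// mul1r.
have [c hc] : analytic_at F 0 by apply: an; rewrite nr0 ltW.
move=> e e0; have [n hn] := geo_lin_small B0 (ltW q0) q1 e0.
exists (fun x => \sum_(j < n) homog c j x); split=> [i|x hx].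
  have -> : (fun x => (\sum_(j < n) homog c j x) ord0 i) =
    (fun x => \sum_(j <- index_enum 'I_n) homog c j x ord0 i).
    by apply/funext => x; rewrite summxE.
  by apply: polyfun_sum => j; exact: polymap_homog.
apply: le_trans hn; pose y : V := (q^-1)%:C%C *: x.
have ny : nr y <= r0.
  by rewrite nrZ nrC gtr0_norm ?invr_gt0// ler_pdivrMl// /q divfK// gt_eqF.
have xy : x = q%:C%C *: y.
  by rewrite scalerA -rmorphM divff ?gt_eqF// rmorph1 scale1r.
apply/nr_row_le => [|i]; first by rewrite mulr_ge0 ?mulr_ge0 ?exprn_ge0// ltW.
have hr (t : C) : nr t <= 1 -> nr (t *: y) <= r0.
  by move=> ht; rewrite nrZ; apply: le_trans ny; rewrite ler_piMl ?nr_ge0.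
have hc0 : taylor_expansion F (0 *: y) c by rewrite scale0r.
have [K [s ex]] := expansion_ray i hc0.
have := @taylor_ana R (fun l => F (l *: y) ord0 i) B _ _ _ n _ _ ex (q%:C%C).
rewrite nrC gtr0_norm// (ltW q1) -xy => h.
have -> : (F x - \sum_(j < n) homog c j x) ord0 i =
    F x ord0 i - \sum_(j < n) homog c j y ord0 i * (q%:C%C) ^+ j.
  rewrite !mxE summxE; congr (_ - _); apply: eq_bigr => j _.
  by rewrite xy homogZ mxE mulrC.
apply: h => // z hz; first by apply: analytic_ray; apply: an; exact: hr.
by apply: le_trans (nr_coord _ i) _; apply: hB; apply: hr; rewrite hz.
Qed.

(* Analyticity is assumed of [F + id] since [F] will be [f - id]. *)
Lemma order_bound (F : V -> V) (r0 B : R) n : 0 < r0 -> (0 < n)%N ->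
  (forall x, nr x <= r0 -> analytic_at (fun y => F y + y) x) ->
  (forall x, nr x <= r0 -> nr (F x) <= B) -> order_ge n F ->
  forall x, nr x <= r0 -> nr (F x) <= B * (nr x / r0) ^+ n.
Proof.
move=> r00 n0 an hB [L [s [s0 hL]]] x hx.
have B0 : 0 <= B by apply: le_trans (hB 0 _); rewrite ?nr_ge0// nr0 ltW.
case: (eqVneq x 0) => [->|x0].
  have := hL 0; rewrite nr0 => /(_ (ltW s0)).
  by rewrite mul0r !expr0n gtn_eqF// !mulr0.
have nx : 0 < nr x by rewrite lt_neqAle eq_sym nr_eq0 nr_ge0 x0.
pose q := nr x / r0.
have q0 : 0 < q by rewrite divr_gt0.
have q1 : q <= 1 by rewrite ler_pdivrMr// mul1r.
pose y : V := (q^-1)%:C%C *: x.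
have ny : nr y = r0.
  by rewrite nrZ nrC gtr0_norm ?invr_gt0// /q; field; rewrite !gt_eqF.
have xy : x = q%:C%C *: y.
  by rewrite scalerA -rmorphM divff ?gt_eqF// rmorph1 scale1r.
apply/nr_row_le => [|i]; first by rewrite mulr_ge0 ?exprn_ge0// ltW.
have hr (t : C) : nr t <= 1 -> nr (t *: y) <= r0.
  by move=> ht; rewrite nrZ ny ler_piMl// ltW.
have := @schwarz_ana R (fun l => F (l *: y) ord0 i) n B _ _ _ (q%:C%C).
rewrite nrC gtr0_norm// -xy; apply=> // [z hz||z hz].
- have := analytic_ray i (an _ (hr _ hz)) => a1.
  have -> : (fun l => F (l *: y) ord0 i) =
     (fun l => (F (l *: y) + l *: y) ord0 i + ((- y ord0 i)%:P * 'X).[l]).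
    by apply/funext => l; rewrite !hornerE mxE [(l *: y) _ _]mxE mulNr [l * _]mulrC addrK.
  by apply: ana1D => //; exact: ana1_poly.
- exists (L * r0 ^+ n), (s / r0); split=> [|h]; first by rewrite divr_gt0.
  rewrite ler_pdivlMr// => hh; apply: le_trans (nr_coord _ i) _.
  by apply: le_trans (hL _ _) _; rewrite nrZ ny// exprMn [nr h ^+ n * _]mulrC mulrA.
by apply: le_trans (nr_coord _ i) _; apply: hB; apply: hr; rewrite hz.
Qed.

Lemma order_ge_taylor (F : V -> V) c n : taylor_expansion F 0 c ->
  (forall al, (mdegree al < n)%N -> c al = 0) -> order_ge n F.
Proof.
move=> /taylor_trunc[K [s [s0 h]]] hc; exists (K / s ^+ n), s; split=> // x hx.
have := h _ hx n; rewrite add0r big1 ?subr0.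
  by rewrite expr_div_n mulrA mulrAC.
move=> j _; rewrite /homog big_seq big1// => al; rewrite mem_homog_midx => /eqP hal.
by rewrite hc ?scaler0// hal.
Qed.

Lemma order_ge_analytic1 (F : V -> V) : analytic_at F 0 -> F 0 = 0 -> order_ge 1 F.
Proof.
move=> [c /taylor_trunc[K [s [s0 h]]]] F0; exists (2 * K / s), s; split=> // x hx.
have := h _ hx 1%N; rewrite add0r big_ord1 => h1.
have := h 0; rewrite nr0 => /(_ (ltW s0) 1%N); rewrite addr0 F0 big_ord1 mul0r expr1 mulr0.
rewrite sub0r nrN => h2.
have e0 : homog c 0 0 = 0 by apply/eqP; rewrite -nr_eq0 eq_le h2 nr_ge0.
have e1 : homog c 0 x = 0.
  by have := homogZ c 0 0 x; rewrite scale0r e0 expr0 scale1r.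
have K0 : 0 <= K.
  have := h 0; rewrite nr0 => /(_ (ltW s0) 0%N); rewrite expr0 mulr1.
  by apply: le_trans; rewrite nr_ge0.
move: h1; rewrite e1 subr0 expr1 => h1; apply: le_trans h1 _.
have -> : 2 * K / s * nr x ^+ 1 = 2 * (K * (nr x / s)) by rewrite expr1; ring.
have : 0 <= K * (nr x / s) by rewrite mulr_ge0// divr_ge0 ?nr_ge0// ltW.
lra.
Qed.

End AnalyticMaps.

(** * Elements of B(r0, eps0, n0) *)

Section ClassB.
Variables (R : realType) (d : nat).
Local Notation C := R[i].
Local Notation V := 'rV[C]_d.

Lemma supnorm_le (r c : R) (F : V -> V) : (supnorm r F <= c%:E)%E ->
  forall x, nr x <= r -> nr (F x) <= c.
Proof.
move=> h x hx; rewrite -lee_fin; apply: le_trans h; apply: ereal_sup_ubound.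
by exists x => //; apply/cballE.
Qed.

Lemma supnorm_ge (r c : R) (F : V -> V) :
  (forall x, nr x <= r -> nr (F x) <= c) -> (supnorm r F <= c%:E)%E.
Proof.
move=> h; apply: ge_ereal_sup => _ [x /cballE hx <-].
by rewrite lee_fin; exact: h.
Qed.

Variables (r0 eps0 : R) (n0 : nat) (f finv : V -> V).
Hypotheses (r00 : 0 < r0) (e0 : 0 < eps0) (e0r0 : eps0 <= r0) (n00 : (0 < n0)%N).
Hypothesis fB : in_B r0 eps0 n0 f finv.

Lemma B_close_f x : nr x <= r0 -> nr (f x - x) <= eps0.
Proof.
by have := B_close fB; rewrite ge_max => /andP[h _]; exact: (supnorm_le h).
Qed.

Lemma B_close_finv x : nr x <= r0 -> nr (finv x - x) <= eps0.
Proof.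
by have := B_close fB; rewrite ge_max => /andP[_ h]; exact: (supnorm_le h).
Qed.

Lemma B_finv0 : finv 0 = 0.
Proof. by have := nbhs_singleton (B_fK fB); rewrite (B_f0 fB). Qed.

Lemma order_ge_f : order_ge n0 (fun x => f x - x).
Proof. by have [c hc hz] := B_order fB; exact: order_ge_taylor hc hz. Qed.

Lemma order_ge_finv : order_ge n0 (fun x => finv x - x).
Proof.
have [L [s [s0 hL]]] := order_ge_f.
have [L1 [s1 [s10 hL1]]] : order_ge 1 finv.
  apply: order_ge_analytic1 B_finv0; apply: (B_finv_analytic fB).
  by apply/cballE; rewrite nr0 ltW.
have [s2 s20 h2] := (near_nr _ _).1 (B_finvK fB).
have L10 : 0 < `|L1| + 1 by have := normr_ge0 L1; lra.
exists (`|L| * (`|L1| + 1) ^+ n0), (Num.min (Num.min s1 s2) (s / (`|L1| + 1))).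
split; first by rewrite !lt_min s10 s20 divr_gt0.
move=> x; rewrite !le_min => /andP[/andP[x1 x2]]; rewrite ler_pdivlMr// => x3.
have hw : nr (finv x) <= (`|L1| + 1) * nr x.
  apply: le_trans (hL1 _ x1) _; rewrite expr1 ler_wpM2r ?nr_ge0//.
  by have := ler_norm L1; lra.
have fx : f (finv x) = x by have := h2 _ x2; rewrite add0r.
rewrite -{2}fx nrB; apply: le_trans (hL _ _) _; first by rewrite (le_trans hw)// mulrC.
rewrite -mulrA -exprMn; apply: (@le_trans _ _ (`|L| * nr (finv x) ^+ n0)).
  by rewrite ler_wpM2r ?ler_norm// exprn_ge0 ?nr_ge0.
by rewrite ler_wpM2l// lerXn2r ?nnegrE ?mulr_ge0 ?nr_ge0// ltW.
Qed.

Lemma B_bound_f x : nr x <= r0 -> nr (f x - x) <= eps0 * (nr x / r0) ^+ n0.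
Proof.
apply: (@order_bound R d (fun x => f x - x)) => // [y hy|y hy|].
- have -> : (fun y => f y - y + y) = f by apply/funext => z; rewrite subrK.
  by apply: (B_f_analytic fB); apply/cballE.
- exact: B_close_f.
- exact: order_ge_f.
Qed.

Lemma B_bound_finv x : nr x <= r0 -> nr (finv x - x) <= eps0 * (nr x / r0) ^+ n0.
Proof.
apply: (@order_bound R d (fun x => finv x - x)) => // [y hy|y hy|].
- have -> : (fun y => finv y - y + y) = finv by apply/funext => z; rewrite subrK.
  by apply: (B_finv_analytic fB); apply/cballE.
- exact: B_close_finv.
- exact: order_ge_finv.
Qed.

Lemma B_papprox_f rho : 0 < rho -> rho < r0 -> papprox rho f.
Proof.
move=> h1 h2; apply: (@analytic_papprox R d f r0 (r0 + eps0)) => // x hx.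
  by apply: (B_f_analytic fB); apply/cballE.
by apply: le_trans (nr_leD _ x) _; rewrite lerD// B_close_f.
Qed.

Lemma B_papprox_finv rho : 0 < rho -> rho < r0 -> papprox rho finv.
Proof.
move=> h1 h2; apply: (@analytic_papprox R d finv r0 (r0 + eps0)) => // x hx.
  by apply: (B_finv_analytic fB); apply/cballE.
by apply: le_trans (nr_leD _ x) _; rewrite lerD// B_close_finv.
Qed.

Lemma half_small (g : V -> V) x :
  (forall x, nr x <= r0 -> nr (g x - x) <= eps0 * (nr x / r0) ^+ n0) ->
  nr x <= r0 -> nr (g x) <= 2 * nr x.
Proof.
move=> h hx; apply: le_trans (nr_leD _ x) _.
suff : nr (g x - x) <= nr x by lra.
apply: le_trans (h _ hx) _.
have q0 : 0 <= nr x / r0 by rewrite divr_ge0 ?nr_ge0// ltW.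
have q1 : nr x / r0 <= 1 by rewrite ler_pdivrMr// mul1r.
apply: (@le_trans _ _ (r0 * (nr x / r0))).
  by apply: ler_pM; rewrite ?exprn_ge0 ?(ltW e0)// -{2}[_ / _]expr1 ler_wiXn2l.
by rewrite mulrC divfK// gt_eqF.
Qed.

(* Near the origin [g \o h = id], so [g \o h - id] has every order there. *)
Lemma B_cancel (g h : V -> V) :
  (forall x, nr x <= r0 -> nr (g x - x) <= eps0 * (nr x / r0) ^+ n0) ->
  (forall x, nr x <= r0 -> nr (h x - x) <= eps0 * (nr x / r0) ^+ n0) ->
  (forall rho : R, 0 < rho -> rho < r0 -> papprox rho g) ->
  (forall rho : R, 0 < rho -> rho < r0 -> papprox rho h) ->
  (\forall x \near (0 : V), g (h x) = x) ->
  forall x, nr x <= r0 / 8 -> g (h x) = x.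
Proof.
move=> hg hh pg ph near0 x hx; have r0p := r00.
have b1 y : nr y <= r0 -> nr (h y) <= 2 * nr y by exact: half_small.
have b2 y : nr y <= r0 -> nr (g y) <= 2 * nr y by exact: half_small.
pose F y := g (h y) - y.
have pF : papprox (r0 / 4) F.
  apply: papproxB; last exact: papprox_id.
  apply: (@papprox_comp R d (r0 / 4) (r0 / 2) g h); [apply: pg; lra|apply: ph; lra|].
  move=> y hy; have hy0 : nr y <= r0 by lra.
  by have := b1 _ hy0; lra.
have BF y : nr y <= r0 / 4 -> nr (F y) <= 2 * r0.
  move=> hy; apply: le_trans (nrBle _ _) _.
  have hy0 : nr y <= r0 by lra.
  have h1 := b1 _ hy0; have h2 : nr (h y) <= r0 by lra.
  by have := b2 _ h2; lra.
have [s s0 hs] := (near_nr _ _).1 near0.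
have oF n : order_ge n F.
  exists 0, s; split=> // y hy; rewrite mul0r /F.
  by have := hs _ hy; rewrite add0r => ->; rewrite subrr nr0.
apply/eqP; rewrite -subr_eq0 -nr_eq0 eq_le nr_ge0 andbT.
apply/ler_addgt0Pr => e ep; rewrite add0r.
have r40 : 0 <= 4 * r0 by lra.
have h20 : 0 < 2^-1 :> R by rewrite invr_gt0.
have h21 : 2^-1 < 1 :> R by rewrite invf_lt1 ?ltr1n.
have [n hn] := geo_lin_small r40 (ltW h20) h21 ep.
have hx2 : nr x <= 2^-1 * (r0 / 4) by lra.
have := schwarz_map h20 h21 pF BF (oF n) hx2.
move=> h3; apply: le_trans h3 _; apply: le_trans hn.
have -> : 1 - 2^-1 = 2^-1 :> R by field.
rewrite invrK mulrAC ler_wpM2r ?exprn_ge0 ?(ltW h20)//.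
rewrite -natr1 mulrDl mul1r; have : 0 <= n%:R * (4 * r0) by rewrite mulr_ge0.
lra.
Qed.

Lemma B_cancel_ffinv x : nr x <= r0 / 8 -> f (finv x) = x.
Proof.
exact: (B_cancel B_bound_f B_bound_finv B_papprox_f B_papprox_finv (B_finvK fB)).
Qed.

Lemma B_cancel_finvf x : nr x <= r0 / 8 -> finv (f x) = x.
Proof.
exact: (B_cancel B_bound_finv B_bound_f B_papprox_finv B_papprox_f (B_fK fB)).
Qed.

End ClassB.

(** * The Stirling differentiation formula *)

Section StirlingScheme.
Variable (R : realType).
Local Notation C := R[i].

Lemma natr2MD (k c : nat) : (2 * k + c)%:R = 2 * k%:R + c%:R :> R.
Proof. by rewrite natrD natrM. Qed.

Fixpoint idif (V : zmodType) (u : int -> V) (j : nat) (k : int) : V :=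
  if j is j'.+1 then idif u j' (k + 1) - idif u j' k else u k.

Lemma idifB (V : zmodType) (u v : int -> V) j k :
  idif (fun k => u k - v k) j k = idif u j k - idif v j k.
Proof. by elim: j k => //= j ih k; rewrite !ih opprD addrACA -opprD. Qed.

Lemma idifSr (V : zmodType) (u : int -> V) j k :
  idif u j.+1 k = idif (fun k => u (k + 1) - u k) j k.
Proof. by elim: j k => // j ih k; rewrite [LHS]/= -!/(idif u j.+1 _) !ih. Qed.

Lemma idif_bound (V : normedModType C) (u : int -> V) j k (e : R) :
  (forall i, (i <= j)%N -> nr (u (k + i%:Z)) <= e) -> nr (idif u j k) <= 2 ^+ j * e.
Proof.
elim: j k => [|j ih] k h; first by rewrite expr0 mul1r; have := h 0%N isT; rewrite addr0.
apply: le_trans (nrBle _ _) _; rewrite exprS -mulrA mulrDl mul1r lerD//; apply: ih => i hi.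
  by have := h i.+1 hi; rewrite -addn1 PoszD [_ + 1]addrC addrA.
by apply: h; exact: leqW.
Qed.

Definition stirling_coef (k : nat) : C := (-1) ^+ k * (k`! ^ 2)%:R / ((2 * k + 1)`!)%:R.

Definition stirling (V : lmodType C) (m : nat) (u : int -> V) : V :=
  \sum_(k < m) stirling_coef k *:
    (2^-1 *: (idif u (2 * k + 1) (- k.+1%:Z) + idif u (2 * k + 1) (- k%:Z))).

Definition stirling_weight (k : nat) : R := 4 ^+ k * ((k`! ^ 2)%:R / ((2 * k + 1)`!)%:R).

Definition stirling_norm (m : nat) : R := \sum_(k < m) stirling_weight k.

Lemma stirling_weight_ge0 k : 0 <= stirling_weight k.
Proof. by rewrite /stirling_weight mulr_ge0 ?exprn_ge0 ?divr_ge0. Qed.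

Lemma stirling_norm_ge0 m : 0 <= stirling_norm m.
Proof. by apply: sumr_ge0 => k _; exact: stirling_weight_ge0. Qed.

Lemma nr_stirling_coef k : nr (stirling_coef k) = (k`! ^ 2)%:R / ((2 * k + 1)`!)%:R.
Proof. by rewrite /stirling_coef !nrM nrX nrN nr1 expr1n mul1r nrV !nr_nat. Qed.

Lemma stirling_weightS k :
  (2 * k + 3)%:R * stirling_weight k.+1 = (2 * k + 2)%:R * stirling_weight k.
Proof.
rewrite /stirling_weight (_ : 2 * k.+1 + 1 = (2 * k + 1).+2)%N; last by lia.
rewrite !factS exprS !natrX !natrM.
have h1 : ((2 * k + 1)`!)%:R != 0 :> R by rewrite pnatr_eq0 -lt0n fact_gt0.
have -> : (2 * k + 1).+2%:R = 2 * k%:R + 3 :> R by rewrite -!natr1 natrD natrM; ring.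
have -> : (2 * k + 1).+1%:R = 2 * k%:R + 2 :> R by rewrite -!natr1 natrD natrM; ring.
rewrite natrD natrM [(2 * k + 2)%:R]natrD [(2 * k)%:R]natrM -natr1.
have k0 : (0 : R) <= k%:R by [].
by field; rewrite h1 /= !gt_eqF //; lra.
Qed.

Lemma stirling_normE m : stirling_norm m = (2 * m + 1)%:R * stirling_weight m - 1.
Proof.
elim: m => [|m ih].
  by rewrite /stirling_norm big_ord0 /stirling_weight !fact0 expr0 divr1 !mul1r subrr.
rewrite /stirling_norm big_ord_recr /= -/(stirling_norm m) ih.
have -> : (2 * m.+1 + 1 = 2 * m + 3)%N by lia.
by rewrite stirling_weightS !natr2MD; ring.
Qed.

Lemma stirling_weight_sqr k : k.+1%:R * stirling_weight k ^+ 2 <= 1.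
Proof.
elim: k => [|k ih]; first by rewrite /stirling_weight !fact0 expr0 divr1 !mulr1 expr1n.
have k0 : (0 : R) <= k%:R by [].
have d0 : (0 : R) < (2 * k + 3)%:R by rewrite ltr0n addn3.
have -> : stirling_weight k.+1 = (2 * k + 2)%:R / (2 * k + 3)%:R * stirling_weight k.
  have dn : (2 * k + 3)%:R != 0 :> R by rewrite gt_eqF.
  by rewrite -[LHS](mulKf dn) stirling_weightS; ring.
rewrite exprMn mulrA; apply: le_trans ih; rewrite ler_wpM2r ?sqr_ge0//.
by rewrite expr_div_n mulrA ler_pdivrMr ?exprn_gt0// -!natr1 !natr2MD; nra.
Qed.

Lemma stirling_norm_sqr m : stirling_norm m ^+ 2 <= 4 * m.+1%:R.
Proof.
have h : stirling_norm m <= (2 * m + 1)%:R * stirling_weight m by rewrite stirling_normE; lra.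
have m0 : (0 : R) <= m%:R by [].
apply: (@le_trans _ _ (((2 * m + 1)%:R * stirling_weight m) ^+ 2)).
  by rewrite lerXn2r// nnegrE ?stirling_norm_ge0// mulr_ge0// stirling_weight_ge0.
have m1 : (0 : R) < m.+1%:R by [].
rewrite exprMn -(ler_pM2r m1) -mulrA [_ ^+ 2 * m.+1%:R]mulrC.
apply: (@le_trans _ _ ((2 * m + 1)%:R ^+ 2 * 1)).
  by rewrite ler_wpM2l ?sqr_ge0// stirling_weight_sqr.
by rewrite natr2MD -natr1; nra.
Qed.

Lemma stirling_bound_diff (V : normedModType C) (u : int -> V) m (a : R) :
  (forall k : int, - m%:Z <= k < m%:Z -> nr (u (k + 1) - u k) <= a) ->
  nr (stirling m u) <= stirling_norm m * a.
Proof.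
move=> h; apply: le_trans (nr_sum _ _ _) _; rewrite mulr_suml; apply: ler_sum => k _.
rewrite nrZ nr_stirling_coef nrZ nrV nr_nat.
have hk := ltn_ord k.
have b (k0 : int) : - k.+1%:Z <= k0 <= - k%:Z -> nr (idif u (2 * k + 1) k0) <= 4 ^+ k * a.
  move=> hk0; rewrite addn1 idifSr (_ : 4 = 2 ^+ 2 :> R); last by rewrite expr2 -natrM.
  rewrite -exprM; apply: idif_bound => i hi; apply: h; lia.
have h1 := b (- k.+1%:Z); have h2 := b (- k%:Z).
have h3 : nr (idif u (2 * k + 1) (- k.+1%:Z)) <= 4 ^+ k * a by apply: h1; lia.
have h4 : nr (idif u (2 * k + 1) (- k%:Z)) <= 4 ^+ k * a by apply: h2; lia.
have g0 : 0 <= (k`! ^ 2)%:R / ((2 * k + 1)`!)%:R :> R by rewrite divr_ge0.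
rewrite /stirling_weight [4 ^+ k * _]mulrC -[leRHS]mulrA ler_wpM2l// ler_pdivrMl//.
by apply: le_trans (nrD _ _) _; lra.
Qed.

Lemma stirling_bound (V : normedModType C) (u : int -> V) m (e : R) :
  (forall k : int, - m%:Z <= k <= m%:Z -> nr (u k) <= e) ->
  nr (stirling m u) <= stirling_norm m * (2 * e).
Proof.
move=> h; apply: stirling_bound_diff => k hk; apply: le_trans (nrBle _ _) _.
have h1 : nr (u (k + 1)) <= e by apply: h; lia.
have h2 : nr (u k) <= e by apply: h; lia.
by rewrite mulrDl mul1r lerD.
Qed.

Lemma stirlingB (V : lmodType C) (u v : int -> V) m :
  stirling m (fun k => u k - v k) = stirling m u - stirling m v.
Proof.
rewrite /stirling -sumrB; apply: eq_bigr => k _.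
by rewrite -!scalerBr !idifB opprD addrACA.
Qed.

Lemma stirling_coord d (u : int -> 'rV[C]_d) m i :
  stirling m u ord0 i = stirling m (fun k => u k ord0 i : C).
Proof.
have e j k : idif u j k ord0 i = idif (fun k => u k ord0 i : C) j k.
  by elim: j k => //= j ih k; rewrite !mxE !ih.
by rewrite /stirling summxE; apply: eq_bigr => k _; rewrite !mxE !e.
Qed.

Definition falling (n : nat) (y : C) : C := \prod_(l < n) (y - l%:R).

Lemma fallingS_diff n y : falling n.+1 (y + 1) - falling n.+1 y = n.+1%:R * falling n y.
Proof.
rewrite /falling big_ord_recl [X in _ - X]big_ord_recr /= subr0.
have -> : \prod_(i < n) (y + 1 - (bump 0 i)%:R) = \prod_(i < n) (y - i%:R).
  by apply: eq_bigr => i _; rewrite /bump leq0n add1n -natr1 opprD addrACA subrr addr0.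
by rewrite -natr1; ring.
Qed.

Lemma idif_falling n j (a : C) k :
  idif (fun k => falling n (k%:~R + a)) j k = (n ^_ j)%:R * falling (n - j) (k%:~R + a).
Proof.
elim: j n k => [|j ih] n k; first by rewrite ffactn0 mul1r subn0.
rewrite idifSr; case: n => [|n].
  rewrite ffact0n mul0r.
  have -> : (fun k : int => falling 0 ((k + 1)%:~R + a) - falling 0 (k%:~R + a)) = (fun=> 0).
    by apply/funext => x; rewrite /falling !big_ord0 subrr.
  by elim: j {ih} k => //= j ih k; rewrite !ih subrr.
have -> : (fun k : int => falling n.+1 ((k + 1)%:~R + a) - falling n.+1 (k%:~R + a)) =
  (fun k => n.+1%:R * falling n (k%:~R + a)).
  by apply/funext => x; rewrite -fallingS_diff rmorphD addrAC.
have sc (c : C) u x : idif (fun k : int => c * u k) j x = c * idif u j x.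
  by elim: j {ih} x => //= j' ih' x; rewrite !ih' mulrBr.
by rewrite sc ih ffactSS natrM mulrA subSS.
Qed.

Definition odd_basis i : {poly C} := 'X * \prod_(l < i) ('X ^+ 2 - (l.+1%:R ^+ 2)%:P).

Lemma odd_basisE i (y : C) : (odd_basis i).[y] = falling (2 * i + 1) (y + i%:R).
Proof.
rewrite /odd_basis hornerM hornerX horner_prod.
elim: i => [|i ih]; first by rewrite big_ord0 /falling big_ord1 addr0 subr0 mulr1.
have -> : (2 * i.+1 + 1 = (2 * i + 1).+2)%N by lia.
rewrite big_ord_recr /= mulrA ih {2}/falling big_ord_recr /= big_ord_recl /=.
have -> : \prod_(l < 2 * i + 1) (y + i.+1%:R - (bump 0 l)%:R) = falling (2 * i + 1) (y + i%:R).
  by apply: eq_bigr => l _; rewrite /bump leq0n add1n -!natr1; ring.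
have -> : (2 * i + 1).+1%:R = 2 * i%:R + 2 :> C by rewrite -!natr1 natrD natrM; ring.
rewrite hornerD hornerN hornerXn hornerC.
have -> : i.+1%:R = i%:R + 1 :> C by rewrite natr1.
by set F := falling _ _; ring.
Qed.

Lemma falling0 n (a : nat) : (a < n)%N -> falling n a%:R = 0.
Proof. by move=> h; rewrite /falling (bigD1 (Ordinal h)) //= subrr mul0r. Qed.

Lemma stirling_odd_basis m i : (i < m)%N ->
  stirling m (fun k => (odd_basis i).[k%:~R]) = (odd_basis i)^`().[0].
Proof.
move=> im.
have -> : (fun k : int => (odd_basis i).[k%:~R]) = (fun k => falling (2 * i + 1) (k%:~R + i%:R)).
  by apply/funext => k; rewrite odd_basisE.
have -> : (odd_basis i)^`().[0] = (-1) ^+ i * (i`! ^ 2)%:R.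
  rewrite /odd_basis derivM derivX mul1r hornerD hornerM hornerX mul0r addr0 horner_prod.
  elim: i {im} => [|i ih]; first by rewrite big_ord0 expr0 mul1r fact0.
  rewrite big_ord_recr /= ih factS hornerD hornerN hornerXn hornerC expr0n add0r [(-1) ^+ i.+1]exprS !natrX natrM.
  by ring.
rewrite /stirling (bigD1 (Ordinal im)) //= big1 ?addr0 => [|k].
  rewrite !idif_falling ffactnn subnn /falling !big_ord0 !mulr1.
  have half (A : C) : 2^-1 * (A + A) = A by field.
  rewrite /stirling_coef /GRing.scale /= half.
  by rewrite divfK// pnatr_eq0 -lt0n fact_gt0.
rewrite -val_eqE /= => ki.
rewrite !idif_falling; case: (ltnP i k) => hik.
  by rewrite ffact_small ?mul0r ?addr0 ?scaler0//; lia.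
have kin : (k < i)%N by rewrite ltn_neqAle ki.
have -> : (- k.+1%:Z)%:~R + i%:R = (i - k.+1)%:R :> C.
  by rewrite mulrNz addrC natrB.
have -> : (- k%:Z)%:~R + i%:R = (i - k)%:R :> C.
  by rewrite mulrNz addrC natrB// ltnW.
by rewrite !falling0 ?mulr0 ?addr0 ?scaler0//; lia.
Qed.

Lemma stirling_even m (q : {poly C}) : (forall y, q.[- y] = q.[y]) ->
  stirling m (fun k => q.[k%:~R]) = q^`().[0].
Proof.
move=> ev.
have refl j (k : int) : idif (fun k => q.[k%:~R]) j k =
    (-1) ^+ j * idif (fun k => q.[k%:~R]) j (- k - j%:Z).
  elim: j k => [|j ih] k; first by rewrite /= expr0 mul1r subr0 mulrNz ev.
  rewrite /= (ih (k + 1)) (ih k).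
  have -> : - (k + 1) - j%:Z = - k - j.+1%:Z by lia.
  have -> : - k - j.+1%:Z + 1 = - k - j%:Z by lia.
  by rewrite exprS; ring.
have -> : q^`().[0] = 0.
  have qe : q \Po (- 'X) = q.
    apply/polyP => j; have /polyP -> // : q \Po (- 'X) = q.
    apply/eqP; rewrite -subr_eq0; apply/eqP.
    apply: (@roots_geq_poly_eq0 _ _ [seq (l%:R : C) | l <- iota 0 (size (q \Po (- 'X) - q))]).
    - by apply/allP => y _; rewrite rootE hornerD hornerN horner_comp hornerN hornerX ev subrr.
    - rewrite map_inj_uniq ?iota_uniq// => a b /eqP; rewrite eqr_nat => /eqP //.
    - by rewrite size_map size_iota.
  have := congr1 (fun p => p^`().[0]) qe.
  rewrite deriv_comp derivN derivX hornerM horner_comp !hornerN hornerX oppr0 hornerC mulrN1.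
  move=> /eqP; rewrite eq_sym -subr_eq0 opprK -mulr2n mulrn_eq0 /= => /eqP //.
rewrite /stirling big1// => k _.
rewrite (refl _ (- k%:Z)).
have -> : - - k%:Z - (2 * k + 1)%:Z = - k.+1%:Z by lia.
have -> : (-1) ^+ (2 * k + 1) = -1 :> C by rewrite exprD exprM sqrrN !expr1n expr1 mul1r.
by rewrite mulN1r subrr !scaler0.
Qed.

(* By parity it suffices to treat [odd_basis i], on which only the [i]-th term
   of the formula survives, and even polynomials. *)
Lemma stirling_exact m (q : {poly C}) : (size q <= 2 * m + 1)%N ->
  stirling m (fun k => q.[k%:~R]) = q^`().[0].
Proof.
have D (p1 p2 : {poly C}) (c : C) :
  stirling m (fun k => p1.[k%:~R]) = p1^`().[0] ->
  stirling m (fun k => p2.[k%:~R]) = p2^`().[0] ->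
  stirling m (fun k => (p1 - c *: p2).[k%:~R]) = (p1 - c *: p2)^`().[0].
  have sc u : stirling m (fun k : int => c * u k) = c * stirling m u.
    have scd j x : idif (fun k : int => c * u k) j x = c * idif u j x.
      by elim: j x => //= j' ih' x; rewrite !ih' mulrBr.
    rewrite /stirling mulr_sumr; apply: eq_bigr => k _.
    by rewrite !scd -mulrDr /GRing.scale /=; ring.
  move=> h1 h2; rewrite derivB derivZ !hornerE -h1 -h2 -sc -stirlingB.
  by congr stirling; apply/funext => k; rewrite !hornerE.
have P i : size (\prod_(l < i) ('X ^+ 2 - (l.+1%:R ^+ 2)%:P) : {poly C}) = (2 * i).+1
  /\ \prod_(l < i) ('X ^+ 2 - (l.+1%:R ^+ 2)%:P) \is @monic C.
  have mon (l : nat) : 'X ^+ 2 - (l.+1%:R ^+ 2)%:P \is @monic C by exact: monicXnsubC.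
  elim: i => [|i [s1 m1]]; first by rewrite big_ord0 size_poly1 monic1.
  rewrite big_ord_recr /= monicMl// size_Mmonic ?monic_neq0// s1 size_XnsubC//; split => //.
  by rewrite mulnS; lia.
suff basis n : (n <= 2 * m)%N -> exists B : {poly C}, [/\ B \is monic, size B = n.+1 &
    stirling m (fun k => B.[k%:~R]) = B^`().[0]].
  move: {2}(size q) (leqnn (size q)) => n; elim: n q => [|n ih] q.
    rewrite leqn0 size_poly_eq0 => /eqP -> _; rewrite deriv0 horner0.
    by have := @stirling_even m 0; rewrite deriv0 horner0; apply=> y; rewrite !horner0.
  move=> sq qm; case: (leqP (size q) n) => sqn; first exact: ih.
  have {}sq : size q = n.+1 by apply/eqP; rewrite eqn_leq sq sqn.
  have [|B [Bm sB hB]] := basis n; first by lia.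
  have h : stirling m (fun k => (q - lead_coef q *: B).[k%:~R]) = (q - lead_coef q *: B)^`().[0].
    apply: ih; last first.
      apply: leq_trans qm; apply: leq_trans (size_polyD _ _) _.
      by rewrite geq_max leqnn size_polyN (leq_trans (size_scale_leq _ _))// sB sq.
    apply/leq_sizeP => j hj; rewrite coefB coefZ.
    move: hj; rewrite leq_eqVlt => /predU1P[<-|hj].
      have -> : B`_n = 1 by move/monicP: Bm; rewrite lead_coefE sB.
      by rewrite mulr1 lead_coefE sq subrr.
    by rewrite !nth_default ?mulr0 ?subr0// ?sB ?sq.
  have := D _ _ (- lead_coef q) h hB; rewrite scaleNr opprK subrK.
  by apply.
case: n => [|n] hn.
  exists 1; split; [exact: monic1|by rewrite size_poly1|].
  by apply: stirling_even => y; rewrite !hornerC.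
have hX i : odd_basis i \is monic /\ size (odd_basis i) = (2 * i).+2.
  have [s1 m1] := P i; rewrite /odd_basis; split; first by rewrite monicMl ?monicX.
  by rewrite size_Mmonic ?polyX_eq0// s1 size_polyX.
have [i [|]] : exists i, n = (2 * i)%N \/ n = (2 * i + 1)%N.
  by exists (n./2); have := odd_double_half n; lia.
  move=> ni; exists (odd_basis i); have [m1 s1] := hX i; split => //; first by rewrite s1 ni.
  by apply: stirling_odd_basis; lia.
move=> ni; exists ('X * odd_basis i); have [m1 s1] := hX i; split.
- by rewrite monicMl ?monicX.
- by rewrite size_Mmonic ?polyX_eq0// s1 size_polyX ni; lia.
apply: stirling_even => y; rewrite /odd_basis !hornerM !hornerX !horner_prod.
rewrite !mulNr mulrN opprK; congr (_ * (_ * _)); apply: eq_bigr => l _.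
by rewrite !hornerE /= sqrrN.
Qed.

Lemma stirling_exact_at m (q : {poly C}) (t : C) : (size q <= 2 * m + 1)%N ->
  stirling m (fun k => q.[t + k%:~R]) = q^`().[t].
Proof.
move=> sq; have := @stirling_exact m (q \Po ('X + t%:P)).
rewrite size_comp_poly2 ?size_XaddC// => /(_ sq).
rewrite deriv_comp derivD derivX derivC addr0 mulr1 horner_comp !hornerE.
move=> <-; congr stirling; apply/funext => k.
by rewrite horner_comp !hornerE addrC.
Qed.

End StirlingScheme.

(** * Orbits and the interpolating field *)

Section Orbits.
Variables (R : realType) (d : nat).
Local Notation C := R[i].
Local Notation V := 'rV[C]_d.

Lemma bernoulli_inv (w : R) nu : 0 <= w -> (1 + w) ^+ nu * (1 - nu%:R * w) <= 1.
Proof.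
move=> w0; elim: nu => [|nu ih]; first by rewrite expr0 mul0r subr0 mulr1.
apply: le_trans ih; rewrite exprSr -mulrA ler_wpM2l ?exprn_ge0 ?addr_ge0//.
have n0 : (0 : R) <= nu%:R by [].
rewrite -natr1; nra.
Qed.

(* One step of [y' <= y + eps0 (y / r0)^(nu+1)] lowers [y^-nu] by at most
   [b = nu eps0 / r0^(nu+1)]; written without inverses. *)
Lemma growth_step (r0 eps0 W u u' : R) nu k :
  0 < r0 -> 0 <= eps0 -> 0 <= u -> 0 <= u' -> 0 <= W ->
  let b := nu%:R * eps0 / r0 ^+ nu.+1 in
  k.+1%:R * b * W < 1 ->
  u' <= u + eps0 * (u / r0) ^+ nu.+1 ->
  u ^+ nu * (1 - k%:R * b * W) <= W ->
  u' ^+ nu * (1 - k.+1%:R * b * W) <= W.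
Proof.
move=> r00 e0 u0 u'0 W0 b kW hu' hu.
have b0 : 0 <= b by rewrite divr_ge0 ?mulr_ge0 ?exprn_ge0 ?(ltW r00).
pose w := eps0 * u ^+ nu / r0 ^+ nu.+1.
have w0 : 0 <= w by rewrite divr_ge0 ?mulr_ge0 ?exprn_ge0 ?(ltW r00).
have bw : nu%:R * w = b * u ^+ nu by rewrite /b /w; ring.
have {}hu' : u' <= u * (1 + w).
  apply: le_trans hu' _; rewrite mulrDr mulr1 lerD2l /w expr_div_n exprS.
  by rewrite le_eqVlt; apply/orP; left; apply/eqP; ring.
have h1 : u' ^+ nu * (1 - b * u ^+ nu) <= u ^+ nu.
  rewrite -bw; case: (lerP 0 (1 - nu%:R * w)) => h.
    apply: (@le_trans _ _ ((u * (1 + w)) ^+ nu * (1 - nu%:R * w))).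
      by rewrite ler_wpM2r// lerXn2r ?nnegrE// mulr_ge0// addr_ge0.
    by rewrite exprMn -mulrA ler_piMr ?exprn_ge0// bernoulli_inv.
  by apply: (@le_trans _ _ 0); rewrite ?exprn_ge0// mulr_ge0_le0 ?exprn_ge0// ltW.
have kb : k%:R * b * W + b * W = k.+1%:R * b * W by rewrite -natr1; ring.
set A := u ^+ nu in hu h1; set A' := u' ^+ nu in h1 *.
have A0 : 0 <= A by rewrite exprn_ge0.
have A'0 : 0 <= A' by rewrite exprn_ge0.
have bW : 0 <= b * W by rewrite mulr_ge0.
set K := k%:R * b * W in hu kb.
have K0 : 0 <= K by rewrite mulr_ge0// mulr_ge0.
rewrite -kb in kW *.
have D0 : 0 < 1 - K by lra.
have bA : b * A * (1 - K) <= b * W by rewrite -mulrA ler_wpM2l.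
have h2 : A' * (1 - K - b * W) <= A' * ((1 - K) * (1 - b * A)).
  by rewrite ler_wpM2l//; lra.
have h3 : A' * ((1 - K) * (1 - b * A)) <= (1 - K) * A.
  by rewrite mulrCA ler_wpM2l// ltW.
have -> : 1 - (K + b * W) = 1 - K - b * W by ring.
lra.
Qed.

Lemma orbit_growth (g : V -> V) (r0 eps0 W rho : R) nu m :
  0 < r0 -> 0 <= eps0 -> 0 <= W -> (0 < nu)%N -> 0 <= rho -> rho <= r0 ->
  (forall x, nr x <= r0 -> nr (g x - x) <= eps0 * (nr x / r0) ^+ nu.+1) ->
  m%:R * (nu%:R * eps0 / r0 ^+ nu.+1) * W <= 3 / 4 -> 4 * W <= rho ^+ nu ->
  forall x, nr x ^+ nu <= W -> forall k, (k <= m)%N -> nr (iter k g x) <= rho.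
Proof.
move=> r00 e0 W0 nu0 rho0 rhor hg hm hW x hx k.
set b := nu%:R * eps0 / r0 ^+ nu.+1 in hm.
have b0 : 0 <= b by rewrite divr_ge0 ?mulr_ge0 ?exprn_ge0 ?(ltW r00).
have bW : 0 <= b * W by rewrite mulr_ge0.
have hk j : (j <= m)%N -> j%:R * b * W <= 3 / 4.
  move=> jm; apply: le_trans hm; rewrite -[j%:R * b * W]mulrA -[m%:R * b * W]mulrA; apply: ler_wpM2r; first exact: bW.
  by rewrite ler_nat.
have toR j u : (j <= m)%N -> 0 <= u -> u ^+ nu * (1 - j%:R * b * W) <= W -> u <= rho.
  move=> jm u0 h; rewrite -(ler_pXn2r nu0) ?nnegrE//.
  have uu : 0 <= u ^+ nu by rewrite exprn_ge0.
  by have := hk _ jm; nra.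
move=> km.
suff [] : nr (iter k g x) ^+ nu * (1 - k%:R * b * W) <= W /\ nr (iter k g x) <= rho by [].
elim: k km => [|k ih] km.
  have h0 : nr (iter 0 g x) ^+ nu * (1 - 0%:R * b * W) <= W by rewrite !mul0r subr0 mulr1.
  by split => //; apply: toR h0; rewrite ?nr_ge0.
have [h1 h2] := ih (ltnW km).
have h3 : nr (iter k.+1 g x) ^+ nu * (1 - k.+1%:R * b * W) <= W.
  apply: (growth_step r00 e0 _ _ _ _ _ h1); rewrite ?nr_ge0//.
    by apply: le_lt_trans (hk _ km) _; lra.
  apply: le_trans (nr_leD _ (iter k g x)) _; rewrite lerD2l; apply: hg.
  exact: le_trans rhor.
by split => //; apply: toR h3; rewrite ?nr_ge0.
Qed.

Record good_pair (f finv : V -> V) (m : nat) (R1 rho a l : R) : Prop := GoodPair {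
  good_papprox_f : papprox rho f;
  good_papprox_finv : papprox rho finv;
  good_bound_f : forall x, nr x <= rho -> nr (f x - x) <= a;
  good_bound_finv : forall x, nr x <= rho -> nr (finv x - x) <= a;
  good_lip_f : forall x y, nr x <= rho -> nr y <= rho -> nr ((f x - x) - (f y - y)) <= l * nr (x - y);
  good_lip_finv : forall x y, nr x <= rho -> nr y <= rho ->
    nr ((finv x - x) - (finv y - y)) <= l * nr (x - y);
  good_cancel : forall x, nr x <= rho -> f (finv x) = x;
  good_iter_f : forall x k, nr x <= R1 -> (k <= m)%N -> nr (iter k f x) <= rho;
  good_iter_finv : forall x k, nr x <= R1 -> (k <= m)%N -> nr (iter k finv x) <= rho;
  good_l : 0 <= l }.

Section Good.
Variables (f finv : V -> V) (m : nat) (R1 rho a l : R).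
Hypothesis G : good_pair f finv m R1 rho a l.
Local Notation orb := (orbit_pt f finv).

Lemma orbit_in x (k : int) : nr x <= R1 -> - m%:Z <= k <= m%:Z -> nr (orb x k) <= rho.
Proof.
move=> hx; case: k => n hk /=.
  by apply: (good_iter_f G) => //; lia.
by have := @good_iter_finv _ _ _ _ _ _ _ G x n.+1 hx; apply; lia.
Qed.

Lemma orbit_succ x (k : int) : nr x <= R1 -> - m%:Z <= k -> f (orb x k) = orb x (k + 1).
Proof.
move=> hx; case: k => n hk /=; first by rewrite addn1.
have -> : Negz n + 1 = - n%:Z by lia.
have -> : orb x (- n%:Z) = iter n finv x by case: n {hk}.
apply: (good_cancel G); apply: (good_iter_finv G) => //; lia.
Qed.

Lemma fdiff_idif x j (k : int) : nr x <= R1 -> - m%:Z <= k ->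
  fdiff f j (orb x k) = idif (orb x) j k.
Proof.
move=> hx; elim: j k => [//|j ih] k hk /=.
by rewrite orbit_succ// !ih//; lia.
Qed.

Lemma interp_fieldE x : nr x <= R1 -> interp_field f finv m x = stirling m (orb x).
Proof.
move=> hx; apply: eq_bigr => k _; congr (_ *: (_ *: (_ + _))).
  by apply: fdiff_idif => //; have := ltn_ord k; lia.
by apply: fdiff_idif => //; have := ltn_ord k; lia.
Qed.

Lemma interp_dom_ball r0 x : rho <= r0 -> nr x <= R1 -> interp_dom r0 f finv m x.
Proof.
move=> h hx; split=> k hk.
  by apply/cballE; apply: le_trans h; exact: orbit_in.
by apply: orbit_succ => //; lia.
Qed.

Lemma interp_field_bound x : nr x <= R1 ->
  nr (interp_field f finv m x) <= stirling_norm R m * a.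
Proof.
move=> hx; rewrite interp_fieldE//; apply: stirling_bound_diff => k hk.
rewrite -orbit_succ//; last by lia.
by apply: (good_bound_f G); apply: orbit_in => //; lia.
Qed.

Lemma step_lip (g : V -> V) x y :
  nr ((g x - x) - (g y - y)) <= l * nr (x - y) -> nr (g x - g y) <= (1 + l) * nr (x - y).
Proof.
move=> h; rewrite mulrDl mul1r.
have -> : g x - g y = (x - y) + ((g x - x) - (g y - y)).
  by apply/rowP => i; rewrite !mxE; ring.
by apply: le_trans (nrD _ _) _; rewrite lerD2l.
Qed.

Lemma nr_iter_lip (g : V -> V) x y k :
  (forall x y, nr x <= rho -> nr y <= rho -> nr ((g x - x) - (g y - y)) <= l * nr (x - y)) ->
  (forall j, (j < k)%N -> nr (iter j g x) <= rho) ->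
  (forall j, (j < k)%N -> nr (iter j g y) <= rho) ->
  nr (iter k g x - iter k g y) <= (1 + l) ^+ k * nr (x - y).
Proof.
move=> hl; elim: k => [|k ih] hx hy; first by rewrite expr0 mul1r.
have l0 := good_l G.
have h := hl _ _ (hx k (ltnSn k)) (hy k (ltnSn k)).
apply: le_trans (step_lip h) _; rewrite exprS -mulrA ler_wpM2l ?addr_ge0//.
by apply: ih => j jk; [apply: hx|apply: hy]; exact: ltnW.
Qed.

Lemma orbit_lip x y (k : int) : nr x <= R1 -> nr y <= R1 -> - m%:Z <= k <= m%:Z ->
  nr (orb x k - orb y k) <= (1 + l) ^+ m * nr (x - y).
Proof.
move=> hx hy hk; have l0 := good_l G.
have w n : (n <= m)%N -> (1 + l) ^+ n * nr (x - y) <= (1 + l) ^+ m * nr (x - y).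
  by move=> nm; rewrite ler_wpM2r ?nr_ge0// ler_weXn2l// lerDl.
case: k hk => n hk.
  have nm : (n <= m)%N by lia.
  apply: le_trans (w _ nm); apply: nr_iter_lip; first exact: (good_lip_f G).
    by move=> j jn; apply: (good_iter_f G) => //; rewrite (leq_trans (ltnW jn)).
  by move=> j jn; apply: (good_iter_f G) => //; rewrite (leq_trans (ltnW jn)).
have nm : (n.+1 <= m)%N by lia.
apply: le_trans (w _ nm); apply: nr_iter_lip; first exact: (good_lip_finv G).
  by move=> j jn; apply: (good_iter_finv G) => //; rewrite (leq_trans (ltnW jn)).
by move=> j jn; apply: (good_iter_finv G) => //; rewrite (leq_trans (ltnW jn)).
Qed.

Lemma interp_field_lip x y : nr x <= R1 -> nr y <= R1 ->
  nr (interp_field f finv m x - interp_field f finv m y) <=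
  stirling_norm R m * (l * (1 + l) ^+ m) * nr (x - y).
Proof.
move=> hx hy; rewrite !interp_fieldE// -stirlingB -mulrA; apply: stirling_bound_diff => k hk.
rewrite -!orbit_succ//; [|lia|lia].
have hkm : - m%:Z <= k <= m%:Z by lia.
have h := good_lip_f G (orbit_in hx hkm) (orbit_in hy hkm).
have -> : f (orb x k) - f (orb y k) - (orb x k - orb y k) =
   (f (orb x k) - orb x k) - (f (orb y k) - orb y k).
  by apply/rowP => i; rewrite !mxE; ring.
apply: le_trans h _; rewrite -mulrA ler_wpM2l ?(good_l G)//.
exact: orbit_lip.
Qed.

Lemma papprox_iter (g : V -> V) k : 0 <= R1 -> papprox rho g ->
  (forall j x, nr x <= R1 -> (j < k)%N -> nr (iter j g x) <= rho) -> papprox R1 (iter k g).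
Proof.
move=> R10 hg; elim: k => [|k ih] h; first exact: papprox_id.
apply: (@papprox_comp R d R1 rho g (iter k g)) => //.
  by apply: ih => j x hx jk; apply: h => //; exact: ltnW.
by move=> x hx; apply: h.
Qed.

Lemma orbit_papprox (k : int) : 0 <= R1 -> - m%:Z <= k <= m%:Z -> papprox R1 (fun x => orb x k).
Proof.
move=> R10; case: k => n hk.
  apply: papprox_iter => //; first exact: (good_papprox_f G).
  by move=> j x hx jn; apply: (good_iter_f G) => //; lia.
apply: (@papprox_iter finv n.+1) => //; first exact: (good_papprox_finv G).
by move=> j x hx jn; apply: (good_iter_finv G) => //; lia.
Qed.

Lemma interp_field_papprox : 0 <= R1 -> papprox R1 (interp_field f finv m).
Proof.
move=> R10; apply: (papprox_ext (G := fun x => stirling m (orb x))) => [x hx|]; first exact: interp_fieldE.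
have di j (k : int) : - m%:Z <= k -> k + j%:Z <= m%:Z -> papprox R1 (fun x => idif (orb x) j k).
  elim: j k => [|j ih] k h1 h2; first by apply: orbit_papprox => //; lia.
  by apply: papproxB; apply: ih; lia.
apply: (@papprox_sum R d R1 m (fun k x => stirling_coef R k *:
  (2^-1 *: (idif (orb x) (2 * k + 1) (- k.+1%:Z) + idif (orb x) (2 * k + 1) (- k%:Z))))) => k km.
apply: papproxZ; apply: papproxZ.
by apply: papproxD; apply: di; lia.
Qed.

End Good.

End Orbits.

(** * Curves depending on a real time *)

Section RealCurves.
Variables (R : realType) (d : nat).
Local Notation C := R[i].
Local Notation V := 'rV[C]_d.

Lemma antiderivative (h : R -> R) : continuous h ->
  exists H : R -> R, H 0 = 0 /\ forall t : R, 0 <= t <= 1 -> is_derive t 1 H (h t).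
Proof.
move=> ch.
pose F (x : R) := (\int[@lebesgue_measure R]_(t in [set` `[-1, x]]) (h t))%R.
exists (fun x => F x - F 0); split=> [|t /andP[t0 t1]]; first by rewrite subrr.
have fi : (@lebesgue_measure R).-integrable `[-1, 2] (EFin \o h).
  apply: continuous_compact_integrable; first exact: segment_compact.
  exact: continuous_subspaceT.
have t2 : t < 2 by lra.
have t10 : -1 < t by lra.
have [dF FE] := continuous_FTC1_closed t2 fi t10 (ch t).
have h1 : is_derive t 1 F (h t).
  by rewrite -FE derive1E; apply/derivableP.
rewrite -[h t]subr0; apply: is_deriveB.
Qed.

Definition vderiv (g : R -> V) (t : R) (v : V) : Prop :=
  forall i : 'I_d,
    is_derive t 1 (fun s => complex.Re (g s ord0 i)) (complex.Re (v ord0 i)) /\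
    is_derive t 1 (fun s => complex.Im (g s ord0 i)) (complex.Im (v ord0 i)).

Lemma Re_sub (x y : C) : complex.Re (x - y) = complex.Re x - complex.Re y.
Proof. by case: x y => a b [c e]. Qed.

Lemma Im_sub (x y : C) : complex.Im (x - y) = complex.Im x - complex.Im y.
Proof. by case: x y => a b [c e]. Qed.

Lemma Re_scale (s : R) (z : C) : complex.Re (s%:C%C * z) = complex.Re z * s.
Proof. by case: z => a b /=; rewrite mul0r subr0 mulrC. Qed.

Lemma Im_scale (s : R) (z : C) : complex.Im (s%:C%C * z) = complex.Im z * s.
Proof. by case: z => a b /=; rewrite mul0r addr0 mulrC. Qed.

Lemma vderivB g k t v w : vderiv g t v -> vderiv k t w -> vderiv (fun s => g s - k s) t (v - w).
Proof.
move=> hg hk i; have [g1 g2] := hg i; have [k1 k2] := hk i; rewrite !mxE; split.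
  rewrite Re_sub.
  have -> : (fun s => complex.Re ((g s - k s) ord0 i)) =
    (fun s => complex.Re (g s ord0 i)) - (fun s => complex.Re (k s ord0 i)).
    by apply/funext => s; rewrite !mxE Re_sub.
  exact: is_deriveB.
rewrite Im_sub.
have -> : (fun s => complex.Im ((g s - k s) ord0 i)) =
  (fun s => complex.Im (g s ord0 i)) - (fun s => complex.Im (k s ord0 i)).
  by apply/funext => s; rewrite !mxE Im_sub.
exact: is_deriveB.
Qed.

Lemma vderiv_cst v t : vderiv (fun=> v) t 0.
Proof. by move=> i; rewrite mxE /=; split; exact: is_derive_cst. Qed.

Lemma vderiv_lin (v : V) t : vderiv (fun s => s%:C%C *: v) t v.
Proof.
move=> i; set z := v ord0 i.
have e1 : (fun s : R => complex.Re ((s%:C%C *: v) ord0 i)) = complex.Re z \*: id.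
  by apply/funext => s; rewrite mxE -/z Re_scale.
have e2 : (fun s : R => complex.Im ((s%:C%C *: v) ord0 i)) = complex.Im z \*: id.
  by apply/funext => s; rewrite mxE -/z Im_scale.
rewrite e1 e2; split.
  by have := is_deriveZ (complex.Re z) (is_derive_id t (1 : R)); rewrite /GRing.scale /= mulr1.
by have := is_deriveZ (complex.Im z) (is_derive_id t (1 : R)); rewrite /GRing.scale /= mulr1.
Qed.

Lemma mean_value_bound (g dg : R -> R) (a b c : R) : a <= b ->
  (forall t, a <= t <= b -> is_derive t 1 g (dg t) /\ `|dg t| <= c) ->
  `|g b - g a| <= c * (b - a).
Proof.
move=> ab h.
have [||t tab ->] := @MVT_segment R g dg a b ab.
- move=> t; rewrite in_itv /= => /andP[/ltW at' /ltW tb].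
  by have [|] := h t; rewrite ?at' ?tb.
- apply: derivable_within_continuous => t; rewrite in_itv /= => tab.
  by have [[]] := h t tab.
rewrite normrM (ger0_norm (x := b - a)) ?subr_ge0// ler_wpM2r ?subr_ge0//.
by have [] := h t; rewrite // -in_itv.
Qed.

Lemma vderiv_mean_value (g v : R -> V) (a b c : R) : a <= b ->
  (forall t, a <= t <= b -> vderiv g t (v t) /\ nr (v t) <= c) ->
  nr (g b - g a) <= 2 * c * (b - a).
Proof.
move=> ab h.
have c0 : 0 <= c by have [|_] := h a; rewrite ?lexx//; apply: le_trans; exact: nr_ge0.
have ba : 0 <= b - a by rewrite subr_ge0.
apply/nr_row_le => [|i]; first by rewrite !mulr_ge0.
apply: le_trans (nr_ReIm _) _; rewrite !mxE Re_sub Im_sub -mulrA mulr2n mulrDl !mul1r.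
apply: lerD.
  apply: (@mean_value_bound (fun s => complex.Re (g s ord0 i)) (fun s => complex.Re (v s ord0 i))) => //.
  move=> t tab; have [h1 h2] := h t tab; have [h3 _] := h1 i; split => //.
  by apply: le_trans (nr_ge_Re _) _; apply: le_trans (nr_coord _ _) h2.
apply: (@mean_value_bound (fun s => complex.Im (g s ord0 i)) (fun s => complex.Im (v s ord0 i))) => //.
move=> t tab; have [h1 h2] := h t tab; have [_ h3] := h1 i; split => //.
by apply: le_trans (nr_ge_Im _) _; apply: le_trans (nr_coord _ _) h2.
Qed.

Lemma lipschitz_continuous (h : R -> R) (L : R) :
  (forall s t, `|h s - h t| <= L * `|s - t|) -> continuous h.
Proof.
move=> hL t; apply/cvgrPdist_le => e e0.
have L1 : 0 < `|L| + 1 by have := normr_ge0 L; lra.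
near=> s; apply: le_trans (hL _ _) _.
have : `|t - s| <= e / (`|L| + 1).
  by near: s; apply: (@cvgr_dist_le _ _ _ _ _ id t) => //; rewrite divr_gt0.
rewrite ler_pdivlMr// => h1; apply: le_trans h1; rewrite mulrC ler_wpM2l//.
by have := ler_norm L; lra.
Unshelve. all: by end_near. Qed.

Lemma vector_antiderivative (k : R -> V) (L : R) (x0 : V) :
  (forall s t, nr (k s - k t) <= L * `|s - t|) ->
  exists G : R -> V, G 0 = x0 /\ forall t, 0 <= t <= 1 -> vderiv G t (k t).
Proof.
move=> hk.
have A i : exists H : R -> R, H 0 = 0 /\
    forall t : R, 0 <= t <= 1 -> is_derive t 1 H (complex.Re (k t ord0 i)).
  apply: (@antiderivative (fun t => complex.Re (k t ord0 i))).
  apply: (@lipschitz_continuous _ L) => s t; rewrite -Re_sub.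
  apply: le_trans (nr_ge_Re _) _; apply: le_trans (hk s t).
  by have := nr_coord (k s - k t) i; rewrite !mxE.
have B i : exists H : R -> R, H 0 = 0 /\
    forall t : R, 0 <= t <= 1 -> is_derive t 1 H (complex.Im (k t ord0 i)).
  apply: (@antiderivative (fun t => complex.Im (k t ord0 i))).
  apply: (@lipschitz_continuous _ L) => s t; rewrite -Im_sub.
  apply: le_trans (nr_ge_Im _) _; apply: le_trans (hk s t).
  by have := nr_coord (k s - k t) i; rewrite !mxE.
have [P hP] := choice A; have [Q hQ] := choice B.
exists (fun t => \row_i Complex (complex.Re (x0 ord0 i) + P i t) (complex.Im (x0 ord0 i) + Q i t)).
split.
  apply/rowP => i; rewrite mxE; have [-> _] := hP i; have [-> _] := hQ i.
  by rewrite !addr0; case: (x0 _ _).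
move=> t ht i; have [_ h1] := hP i; have [_ h2] := hQ i.
have e1 : (fun s => complex.Re ((\row_j Complex (complex.Re (x0 ord0 j) + P j s)
   (complex.Im (x0 ord0 j) + Q j s) : V) ord0 i)) = cst (complex.Re (x0 ord0 i)) + P i.
  by apply/funext => s; rewrite mxE.
have e2 : (fun s => complex.Im ((\row_j Complex (complex.Re (x0 ord0 j) + P j s)
   (complex.Im (x0 ord0 j) + Q j s) : V) ord0 i)) = cst (complex.Im (x0 ord0 i)) + Q i.
  by apply/funext => s; rewrite mxE.
rewrite e1 e2; split.
  by rewrite -[X in is_derive _ _ _ X]add0r; apply: is_deriveD; exact: h1.
by rewrite -[X in is_derive _ _ _ X]add0r; apply: is_deriveD; exact: h2.
Qed.

Lemma geometric_limit (a : nat -> R) (K : R) : 0 <= K ->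
  (forall n, `|a n.+1 - a n| <= K * 2^-1 ^+ n) ->
  exists l, forall n, `|a n - l| <= 2 * K * 2^-1 ^+ n.
Proof.
move=> K0 h; pose e n := 2 * K * 2^-1 ^+ n.
have eS n : e n.+1 = e n - K * 2^-1 ^+ n by rewrite /e exprS; field.
have e0 n : 0 <= e n by rewrite !mulr_ge0// exprn_ge0// invr_ge0.
have bS n : a n - e n <= a n.+1 - e n.+1.
  by rewrite eS; have := h n; rewrite ler_norml; lra.
have cS n : a n.+1 + e n.+1 <= a n + e n.
  by rewrite eS; have := h n; rewrite ler_norml; lra.
have bm m n : (m <= n)%N -> a m - e m <= a n - e n.
  by apply: (@homo_leq _ (fun n => a n - e n) <=%R); [exact: lexx|exact: le_trans|exact: bS].
have cm m n : (m <= n)%N -> a n + e n <= a m + e m.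
  move=> mn; rewrite -lerN2.
  by apply: (@homo_leq _ (fun n => - (a n + e n)) <=%R); [exact: lexx|exact: le_trans|move=> j; rewrite lerN2; exact: cS|].
have bc m n : a m - e m <= a n + e n.
  have h1 := bm _ _ (leq_maxl m n); have h2 := cm _ _ (leq_maxr m n).
  by have := e0 (maxn m n); lra.
pose S := [set a n - e n | n in setT].
have sS : has_sup S.
  split; first by exists (a 0%N - e 0%N); exists 0%N.
  by exists (a 0%N + e 0%N) => _ [n _ <-].
exists (sup S) => n; rewrite -/(e n) ler_norml.
have h1 : a n - e n <= sup S by apply: sup_upper_bound => //; exists n.
have h2 : sup S <= a n + e n by apply: ge_sup; [case: sS|move=> _ [m _ <-]].
by lra.
Qed.

Lemma vector_geometric_limit (a : nat -> V) (K : R) : 0 <= K ->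
  (forall n, nr (a n.+1 - a n) <= K * 2^-1 ^+ n) ->
  exists l, forall n, nr (a n - l) <= 4 * K * 2^-1 ^+ n.
Proof.
move=> K0 h.
have A i : exists l, forall n, `|complex.Re (a n ord0 i) - l| <= 2 * K * 2^-1 ^+ n.
  apply: (@geometric_limit (fun n => complex.Re (a n ord0 i))) => // n; rewrite -Re_sub.
  apply: le_trans (nr_ge_Re _) _; apply: le_trans (h n).
  by have := nr_coord (a n.+1 - a n) i; rewrite !mxE.
have B i : exists l, forall n, `|complex.Im (a n ord0 i) - l| <= 2 * K * 2^-1 ^+ n.
  apply: (@geometric_limit (fun n => complex.Im (a n ord0 i))) => // n; rewrite -Im_sub.
  apply: le_trans (nr_ge_Im _) _; apply: le_trans (h n).
  by have := nr_coord (a n.+1 - a n) i; rewrite !mxE.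
have [P hP] := choice A; have [Q hQ] := choice B.
exists (\row_i Complex (P i) (Q i)) => n.
apply/nr_row_le => [|i]; first by rewrite !mulr_ge0// exprn_ge0// invr_ge0.
apply: le_trans (nr_ReIm _) _; rewrite !mxE Re_sub Im_sub /=.
by have := hP i n; have := hQ i n; lra.
Qed.

End RealCurves.

(** * Flow of a Lipschitz field *)

Section LipschitzFlow.
Variables (R : realType) (d : nat).
Local Notation C := R[i].
Local Notation V := 'rV[C]_d.

Record lip_field (X : V -> V) (R1 b L : R) : Prop := LipField {
  lf_b : 0 <= b;
  lf_L0 : 0 <= L;
  lf_L : L <= 1 / 4;
  lf_bound : forall x, nr x <= R1 -> nr (X x) <= b;
  lf_lip : forall x y, nr x <= R1 -> nr y <= R1 -> nr (X x - X y) <= L * nr (x - y) }.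

Definition clamp (s : R) : R := Num.min 1 (Num.max 0 s).

Lemma clamp_in s : 0 <= clamp s <= 1.
Proof. by rewrite /clamp le_min ler01 le_max lexx ge_min lexx. Qed.

Lemma clamp_id s : 0 <= s <= 1 -> clamp s = s.
Proof. by move=> /andP[s0 s1]; rewrite /clamp max_r// min_r. Qed.

Lemma clamp_lip s t : `|clamp s - clamp t| <= `|s - t|.
Proof.
rewrite /clamp /Num.min /Num.max; do 4 case: ifP => /=; move=> *; rewrite ler_norml;
 by have := ler_norm (s - t); have := ler_norm (t - s); rewrite (distrC t s); lra.
Qed.

Definition admissible (R1 b : R) (g : R -> V) : Prop :=
  (forall t, 0 <= t <= 1 -> nr (g t) <= R1) /\
  (forall s t, 0 <= s <= 1 -> 0 <= t <= 1 -> nr (g s - g t) <= 2 * b * `|s - t|).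

Lemma vderiv_lip (g v : R -> V) (c : R) s t :
  (forall t, 0 <= t <= 1 -> vderiv g t (v t) /\ nr (v t) <= c) ->
  0 <= s <= 1 -> 0 <= t <= 1 -> nr (g s - g t) <= 2 * c * `|s - t|.
Proof.
move=> h; wlog st : s t / t <= s => [hw|] hs ht.
  case/orP: (le_total t s) => st; first exact: hw.
  by rewrite nrB distrC; apply: hw.
rewrite ger0_norm ?subr_ge0//; apply: vderiv_mean_value st _ => r hr; apply: h; lra.
Qed.

Lemma picard_step (X : V -> V) (R0 R1 b L : R) x0 g : lip_field X R1 b L ->
  nr x0 <= R0 -> R0 + 2 * b <= R1 -> admissible R1 b g ->
  exists g', [/\ g' 0 = x0, admissible R1 b g' & forall t, 0 <= t <= 1 -> vderiv g' t (X (g t))].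
Proof.
move=> LF hx hR [gR gL]; have b0 := lf_b LF; have L0 := lf_L0 LF.
have [s t|G [G0 hG]] := @vector_antiderivative R d (fun s => X (g (clamp s))) (L * (2 * b)) x0.
  apply: le_trans (lf_lip LF (gR _ (clamp_in _)) (gR _ (clamp_in _))) _.
  rewrite -mulrA ler_wpM2l//; apply: le_trans (gL _ _ (clamp_in _) (clamp_in _)) _.
  by rewrite ler_wpM2l ?mulr_ge0// clamp_lip.
have hG' t : 0 <= t <= 1 -> vderiv G t (X (g t)) by move=> ht; have := hG t ht; rewrite clamp_id.
have GL s t : 0 <= s <= 1 -> 0 <= t <= 1 -> nr (G s - G t) <= 2 * b * `|s - t|.
  apply: vderiv_lip (fun t => X (g t)) _ _ _ _ => r hr.
  by split; [exact: hG'|apply: (lf_bound LF); exact: gR].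
exists G; split => //; split => // t ht; apply: le_trans (nr_leD _ x0) _.
have z : 0 <= (0 : R) <= 1 by rewrite lexx ler01.
have := GL t 0 ht z; rewrite G0 subr0 ger0_norm; last by case/andP: ht.
have : 2 * b * t <= 2 * b by rewrite ler_piMr ?mulr_ge0//; case/andP: ht.
lra.
Qed.

Lemma picard_exists (X : V -> V) (R0 R1 b L : R) x0 : lip_field X R1 b L ->
  nr x0 <= R0 -> R0 + 2 * b <= R1 ->
  exists g, [/\ g 0 = x0, forall t, 0 <= t <= 1 -> nr (g t) <= R1 &
    forall t, 0 <= t <= 1 -> vderiv g t (X (g t))].
Proof.
move=> LF hx hR; have b0 := lf_b LF; have L0 := lf_L0 LF; have L4 := lf_L LF.
have x0R1 : nr x0 <= R1 by lra.
have R10 : 0 <= R1 by apply: le_trans x0R1; exact: nr_ge0.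
pose A := {g : R -> V | admissible R1 b g}.
have a0 : admissible R1 b (fun=> x0).
  by split => // s t _ _; rewrite subrr nr0 !mulr_ge0.
have st (g : A) : exists g' : A, sval g' 0 = x0 /\ forall t, 0 <= t <= 1 -> vderiv (sval g') t (X (sval g t)).
  have [g' [h1 h2 h3]] := picard_step LF hx hR (svalP g).
  by exists (exist _ g' h2).
have [S hS] := choice st.
pose G n := sval (iter n S (exist _ (fun=> x0) a0)).
have Gin n t : 0 <= t <= 1 -> nr (G n t) <= R1 by move=> ht; have [h _] := svalP (iter n S (exist _ _ a0)); exact: h.
have G0 n : G n.+1 0 = x0 by have [] := hS (iter n S (exist _ _ a0)).
have Gd n t : 0 <= t <= 1 -> vderiv (G n.+1) t (X (G n t)) by have [_] := hS (iter n S (exist _ _ a0)); exact.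
have contr (g h g' h' : R -> V) (D : R) :
  (forall t, 0 <= t <= 1 -> nr (g t) <= R1) -> (forall t, 0 <= t <= 1 -> nr (h t) <= R1) ->
  g' 0 = x0 -> h' 0 = x0 ->
  (forall t, 0 <= t <= 1 -> vderiv g' t (X (g t))) ->
  (forall t, 0 <= t <= 1 -> vderiv h' t (X (h t))) ->
  (forall t, 0 <= t <= 1 -> nr (g t - h t) <= D) ->
  forall t, 0 <= t <= 1 -> nr (g' t - h' t) <= 2^-1 * D.
  move=> gR hR' g0 h0 dg dh hD t ht.
  have z : 0 <= (0 : R) <= 1 by rewrite lexx ler01.
  have D0 : 0 <= D by apply: le_trans (hD _ z); exact: nr_ge0.
  have := @vderiv_lip (fun t => g' t - h' t) (fun t => X (g t) - X (h t)) (L * D) t 0 _ ht z.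
  rewrite g0 h0 subrr !subr0 ger0_norm; last by case/andP: ht.
  move=> hh; apply: le_trans (hh _) _.
    move=> r hr; split; first by apply: vderivB; [exact: dg|exact: dh].
    apply: le_trans (lf_lip LF (gR _ hr) (hR' _ hr)) _.
    by rewrite ler_wpM2l// hD.
  have t1 : t <= 1 by case/andP: ht.
  have LD : 0 <= L * D by rewrite mulr_ge0.
  by apply: (@le_trans _ _ (2 * (L * D))); [rewrite ler_piMr// mulr_ge0|nra].
have GS n t : 0 <= t <= 1 -> nr (G n.+1 t - G n t) <= (2 * R1) * 2^-1 ^+ n.
  elim: n t => [|n ih] t ht.
    rewrite expr0 mulr1; apply: le_trans (nrBle _ _) _.
    by have := Gin 0%N _ ht; have := Gin 1%N _ ht; lra.
  rewrite exprS mulrCA.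
  exact: (contr _ _ _ _ _ (@Gin n.+1) (@Gin n) (G0 _) (G0 _) (Gd _) (Gd _) ih).
have lim t : exists l, 0 <= t <= 1 -> forall n, nr (G n t - l) <= 4 * (2 * R1) * 2^-1 ^+ n.
  have [ht|nt] := pselect (0 <= t <= 1); last by exists 0 => /nt.
  have [|l hl] := @vector_geometric_limit R d (fun n => G n t) (2 * R1) _ (fun n => GS n t ht).
    by rewrite mulr_ge0.
  by exists l.
have [g hg] := choice lim.
have small (c y : R) : 0 <= c -> (forall n, y <= c * 2^-1 ^+ n) -> y <= 0.
  move=> c0 h; apply/ler_addgt0Pr => e e0; rewrite add0r.
  have h20 : 0 <= 2^-1 :> R by rewrite invr_ge0.
  have h21 : 2^-1 < 1 :> R by rewrite invf_lt1 ?ltr1n.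
  have [n hn] := geo_lin_small c0 h20 h21 e0.
  apply: le_trans (h n) _; apply: le_trans hn.
  by rewrite ler_wpM2r ?exprn_ge0// ler_peMl// ler1n.
have K0 : 0 <= 4 * (2 * R1) by rewrite !mulr_ge0.
have ga : admissible R1 b g.
  split=> [t ht|s t hs ht].
    rewrite -subr_le0; apply: (small _ _ K0) => n.
    have := nr_leD (g t) (G n t); have := Gin n _ ht; have := hg t ht n; rewrite nrB; lra.
  rewrite -subr_le0; apply: (small (4 * (2 * R1) + 4 * (2 * R1))) => [|n]; first by rewrite addr_ge0.
  have [_ GL] := svalP (iter n S (exist _ _ a0)).
  have := GL s t hs ht; rewrite -/(G n) => h1.
  have -> : g s - g t = (G n s - G n t) - ((G n s - g s) - (G n t - g t)).
    by apply/rowP => i; rewrite !mxE; ring.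
  have := nrBle (G n s - G n t) ((G n s - g s) - (G n t - g t)).
  have := nrBle (G n s - g s) (G n t - g t).
  have := hg s hs n; have := hg t ht n; lra.
have [gs [gs0 [gsR _] gsd]] := picard_step LF hx hR ga.
have [gR _] := ga.
have gE t : 0 <= t <= 1 -> gs t = g t.
  move=> ht; apply/eqP; rewrite -subr_eq0 -nr_eq0 eq_le nr_ge0 andbT.
  apply: (small _ _ K0) => n.
  have h1 : nr (gs t - G n.+1 t) <= 2^-1 * (4 * (2 * R1) * 2^-1 ^+ n).
    have hD r : 0 <= r <= 1 -> nr (g r - G n r) <= 4 * (2 * R1) * 2^-1 ^+ n.
      by move=> hr; rewrite nrB; exact: hg.
    exact: (contr g (G n) gs (G n.+1) _ gR (@Gin n) gs0 (G0 n) gsd (Gd n) hD).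
  apply: le_trans (nrBD _ (G n.+1 t) _) _.
  have := hg t ht n.+1; rewrite exprS.
  by have : 0 <= 4 * (2 * R1) * 2^-1 ^+ n by [rewrite mulr_ge0// exprn_ge0// invr_ge0]; lra.
exists gs; split => // t ht; rewrite gE//; exact: gsd.
Qed.

Definition euler_iter (X : V -> V) (N : nat) (k : nat) : V -> V :=
  iter k (fun w => w + (N%:R^-1 : R)%:C%C *: X w).

Lemma euler_in (X : V -> V) (R0 R1 b L : R) N k x : lip_field X R1 b L ->
  nr x <= R0 -> R0 + b <= R1 -> (0 < N)%N -> (k <= N)%N ->
  nr (euler_iter X N k x) <= R0 + k%:R / N%:R * b.
Proof.
move=> LF hx hR N0; have b0 := lf_b LF; elim: k => [|k ih] kN.
  by rewrite mul0r mul0r addr0.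
have n0 : (0 : R) < N%:R by rewrite ltr0n.
have h := ih (ltnW kN).
have hin : nr (euler_iter X N k x) <= R1.
  apply: le_trans h _; apply: le_trans hR; rewrite lerD2l ler_piMl//.
  by rewrite ler_pdivrMr// mul1r ler_nat ltnW.
apply: le_trans (nrD _ _) _; rewrite nrZ nrC ger0_norm ?invr_ge0// -natr1 !mulrDl mul1r addrA.
by rewrite lerD// ler_wpM2l ?invr_ge0// (lf_bound LF).
Qed.

Lemma euler_error (X : V -> V) (R0 R1 b L dl c : R) (g : R -> V) N : lip_field X R1 b L ->
  nr (g 0) <= R0 -> R0 + b <= R1 -> 0 <= dl -> 0 <= c ->
  (forall t, 0 <= t <= 1 -> nr (g t) <= R1) ->
  (forall s h : R, 0 <= s -> 0 <= h -> s + h <= 1 ->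
     nr (g (s + h) - g s - h%:C%C *: X (g s)) <= h * (dl + c * h)) ->
  (0 < N)%N -> nr (euler_iter X N N (g 0) - g 1) <= 2 * (dl + c / N%:R).
Proof.
move=> LF hx hR d0 c0 gR hg N0.
have b0 := lf_b LF; have L0 := lf_L0 LF; have L4 := lf_L LF.
have n0 : (0 : R) < N%:R by rewrite ltr0n.
set eta := dl + c / N%:R.
have eta0 : 0 <= eta by rewrite addr_ge0// divr_ge0// ltW.
suff h k : (k <= N)%N -> nr (euler_iter X N k (g 0) - g (k%:R / N%:R)) <= k%:R / N%:R * (2 * eta).
  by have := h N (leqnn _); rewrite divff ?gt_eqF// mul1r.
elim: k => [|k ih] kN; first by rewrite !mul0r subrr nr0.
have {}ih := ih (ltnW kN).
set w := euler_iter X N k (g 0) in ih *; set s := k%:R / N%:R in ih *.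
have s0 : 0 <= s by rewrite divr_ge0// ltW.
have sk : k.+1%:R / N%:R = s + N%:R^-1 by rewrite -natr1 mulrDl mul1r.
have s1 : s + N%:R^-1 <= 1 by rewrite -sk ler_pdivrMr// mul1r ler_nat.
have n1 : (0 : R) < N%:R^-1 by rewrite invr_gt0.
have sin : 0 <= s <= 1 by rewrite s0; lra.
have win : nr w <= R1.
  apply: le_trans (euler_in LF hx hR N0 (ltnW kN)) _; apply: le_trans hR.
  by rewrite lerD2l ler_piMl//; case/andP: sin.
have hs := hg s N%:R^-1 s0 (ltW n1) s1.
rewrite sk; set h : R := N%:R^-1 in hs s1 n1 sk *.
have -> : euler_iter X N k.+1 (g 0) - g (s + h) =
  (w - g s) + (h%:C%C *: (X w - X (g s))) - (g (s + h) - g s - h%:C%C *: X (g s)).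
  by apply/rowP => i; rewrite /= -/w !mxE; ring.
apply: le_trans (nrBle _ _) _; apply: le_trans (lerD (nrD _ _) hs) _.
have h1 : nr (h%:C%C *: (X w - X (g s))) <= h * (L * nr (w - g s)).
  by rewrite nrZ nrC gtr0_norm// ler_wpM2l ?(ltW n1)// (lf_lip LF)// gR.
have h2 : nr (w - g s) <= 2 * eta.
  apply: le_trans ih _; rewrite ler_piMl//; first by rewrite mulr_ge0.
  by case/andP: sin.
have h3 : L * nr (w - g s) <= 1 / 4 * (2 * eta) by apply: ler_pM; rewrite ?nr_ge0.
have h4 : h * (L * nr (w - g s)) <= h * (1 / 4 * (2 * eta)) by rewrite ler_wpM2l// ltW.
have h5 : h * (dl + c * h) = h * eta by [].
have h6 : 0 <= h * eta by rewrite mulr_ge0// ltW.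
rewrite mulrDl h5; lra.
Qed.

Lemma solution_step (X : V -> V) (R1 b L : R) (g : R -> V) : lip_field X R1 b L ->
  (forall t, 0 <= t <= 1 -> nr (g t) <= R1) ->
  (forall t, 0 <= t <= 1 -> vderiv g t (X (g t))) ->
  forall s h : R, 0 <= s -> 0 <= h -> s + h <= 1 ->
     nr (g (s + h) - g s - h%:C%C *: X (g s)) <= h * (0 + (4 * L * b) * h).
Proof.
move=> LF gR gd s h s0 h0 sh; have b0 := lf_b LF; have L0 := lf_L0 LF.
have gl r t : 0 <= r <= 1 -> 0 <= t <= 1 -> nr (g r - g t) <= 2 * b * `|r - t|.
  apply: vderiv_lip (fun t => X (g t)) _ _ _ _ => u hu.
  by split; [exact: gd|apply: (lf_bound LF); exact: gR].
have sin : 0 <= s <= 1 by rewrite s0; lra.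
have ssh : s <= s + h by lra.
have := @vderiv_mean_value R d (fun t => g t - t%:C%C *: X (g s)) (fun t => X (g t) - X (g s))
  s (s + h) (L * (2 * b * h)) ssh.
have -> : g (s + h) - (s + h)%:C%C *: X (g s) - (g s - s%:C%C *: X (g s)) =
   g (s + h) - g s - h%:C%C *: X (g s).
  by rewrite rmorphD; apply/rowP => i; rewrite !mxE; ring.
move=> hh; apply: le_trans (hh _) _.
  move=> t /andP[st ts]; have tin : 0 <= t <= 1 by apply/andP; split; lra.
  split; first by apply: vderivB; [exact: gd|exact: vderiv_lin].
  apply: le_trans (lf_lip LF (gR _ tin) (gR _ sin)) _; rewrite ler_wpM2l//.
  apply: le_trans (gl _ _ tin sin) _; rewrite ler_wpM2l ?mulr_ge0// ger0_norm; lra.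
by rewrite le_eqVlt; apply/orP; left; apply/eqP; ring.
Qed.

Lemma vderiv_continuous (g : R -> V) t v : vderiv g t v -> forall e : R, 0 < e ->
  exists2 dl : R, 0 < dl & forall s, `|s - t| < dl -> nr (g s - g t) <= e.
Proof.
move=> hg e e0; have e2 : 0 < e / 2 by rewrite divr_gt0.
have c (k : R -> R) (dk : R) : is_derive t 1 k dk -> \forall s \near t, `|k t - k s| <= e / 2.
  move=> [dk1 _]; have /differentiable_continuous ck : differentiable k t by apply/derivable1_diffP.
  by move/cvgrPdist_le : ck; apply.
have h : \forall s \near t, forall i : 'I_d,
   `|complex.Re (g t ord0 i) - complex.Re (g s ord0 i)| <= e / 2 /\
   `|complex.Im (g t ord0 i) - complex.Im (g s ord0 i)| <= e / 2.
  apply: (@filter_forall R 'I_d (fun i s =>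
    `|complex.Re (g t ord0 i) - complex.Re (g s ord0 i)| <= e / 2 /\
    `|complex.Im (g t ord0 i) - complex.Im (g s ord0 i)| <= e / 2) (nbhs t) _) => i; have [h1 h2] := hg i.
  by apply: filterS2 (c _ _ h1) (c _ _ h2) => s.
have /nbhs_ballP[dl /= dl0 hdl] := h.
exists dl => // s hs; apply/nr_row_le => [|i]; first exact: ltW.
have [h1 h2] : `|complex.Re (g t ord0 i) - complex.Re (g s ord0 i)| <= e / 2 /\
   `|complex.Im (g t ord0 i) - complex.Im (g s ord0 i)| <= e / 2.
  by apply: hdl; rewrite -ball_normE /= distrC.
apply: le_trans (nr_ReIm _) _; rewrite !mxE Re_sub Im_sub (distrC (complex.Re _)) (distrC (complex.Im _)).
lra.
Qed.

(* Exit-time argument: as long as the curve stays in the ball of radius [R1]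
   its speed is at most [2 b], hence it cannot reach the boundary. *)
Lemma solution_in_ball (X : V -> V) (R0 R1 b L : R) (g : R -> V) : lip_field X R1 b L ->
  nr (g 0) <= R0 -> R0 + 2 * b < R1 ->
  (forall t, 0 <= t <= 1 -> vderiv g t (X (g t))) ->
  forall t, 0 <= t <= 1 -> nr (g t) <= R1.
Proof.
move=> LF hx hR gd; have b0 := lf_b LF.
pose S := [set t : R | 0 <= t <= 1 /\ forall s, 0 <= s <= t -> nr (g s) <= R1].
have S0 : S 0.
  split; first by rewrite lexx ler01.
  by move=> s; rewrite -eq_le => /eqP <-; lra.
have sS : has_sup S.
  by split; [exists 0|exists 1 => t [/andP[]]].
set T := sup S.
have T0 : 0 <= T by apply: sup_upper_bound.
have T1 : T <= 1 by apply: ge_sup; [exists 0|move=> t [/andP[]]].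
have Tin : 0 <= T <= 1 by rewrite T0.
have below s : 0 <= s -> s < T -> nr (g s) <= R0 + 2 * b.
  move=> s0 sT; have [t St ts] : exists2 t, S t & s < t by exact: (sup_gt (ex_intro _ 0 S0) sT).
  have [/andP[t0 t1] ht] := St.
  have h : nr (g s - g 0) <= 2 * b * (s - 0).
    apply: (@vderiv_mean_value R d g (fun t => X (g t))) => // r /andP[r0 rs].
    split; first by apply: gd; apply/andP; split; lra.
    by apply: (lf_bound LF); apply: ht; apply/andP; split; lra.
  have : 2 * b * (s - 0) <= 2 * b by rewrite subr0 ler_piMr ?mulr_ge0//; lra.
  by have := nr_leD (g s) (g 0); lra.
have atT : nr (g T) <= R0 + 2 * b.
  apply/ler_addgt0Pr => e e0; have [dl dl0 hdl] := vderiv_continuous (gd _ Tin) e0.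
  case: (eqVneq T 0) => [->|Tn0]; first by lra.
  have TP : 0 < T by rewrite lt_neqAle eq_sym Tn0.
  pose s := Num.max 0 (T - dl / 2).
  have s0 : 0 <= s by rewrite le_max lexx.
  have sT : s < T by rewrite gt_max TP /=; lra.
  have sd : T - dl / 2 <= s by rewrite le_max lexx orbT.
  have := hdl s; rewrite ltr0_norm ?subr_lt0// => hh.
  have h1 : nr (g s - g T) <= e by apply: hh; lra.
  by have := nr_leD (g T) (g s); rewrite nrB; have := below _ s0 sT; lra.
have e0 : 0 < R1 - (R0 + 2 * b) by lra.
have [dl dl0 hdl] := vderiv_continuous (gd _ Tin) e0.
have inside s : 0 <= s -> s < T + dl -> nr (g s) <= R1.
  move=> s0 sT; case: (ltrP s T) => hs; first by have := below _ s0 hs; lra.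
  have h1 : nr (g s - g T) <= R1 - (R0 + 2 * b) by apply: hdl; rewrite ger0_norm; lra.
  by have := nr_leD (g s) (g T); lra.
move=> t /andP[t0 t1]; refine (inside _ t0 _).
rewrite ltNge; apply/negP => Tt.
have ST : S (T + dl / 2).
  split; first by apply/andP; split; lra.
  move=> s /andP[s0 hs]; have hs2 : s < T + dl by apply: le_lt_trans hs _; lra.
  exact: (inside _ s0 hs2).
by have := sup_upper_bound sS ST; rewrite -/T; lra.
Qed.

(* The time-one map is the uniform limit of the Euler polygons. *)
Lemma flow_exists (X : V -> V) (R0 R1 b L : R) : lip_field X R1 b L ->
  0 <= R0 -> R0 + 2 * b < R1 -> papprox R1 X -> exists Phi : V -> V,
  [/\ papprox R0 Phi,
   forall x, nr x <= R0 -> exists g, [/\ g 0 = x, g 1 = Phi x,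
      forall t, 0 <= t <= 1 -> nr (g t) <= R1 &
      forall t, 0 <= t <= 1 -> vderiv g t (X (g t))],
   forall g, nr (g 0) <= R0 -> (forall t, 0 <= t <= 1 -> vderiv g t (X (g t))) -> g 1 = Phi (g 0) &
   forall (g : R -> V) (dl c : R), nr (g 0) <= R0 -> 0 <= dl -> 0 <= c ->
    (forall t, 0 <= t <= 1 -> nr (g t) <= R1) ->
    (forall s h : R, 0 <= s -> 0 <= h -> s + h <= 1 ->
     nr (g (s + h) - g s - h%:C%C *: X (g s)) <= h * (dl + c * h)) ->
    nr (g 1 - Phi (g 0)) <= 2 * dl].
Proof.
move=> LF R00 hR pX; have b0 := lf_b LF; have L0 := lf_L0 LF.
have hR2 : R0 + 2 * b <= R1 by lra.
have hR1 : R0 + b <= R1 by lra.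
have ex x : exists y, nr x <= R0 -> exists g, [/\ g 0 = x, g 1 = y,
      forall t, 0 <= t <= 1 -> nr (g t) <= R1 &
      forall t, 0 <= t <= 1 -> vderiv g t (X (g t))].
  have [hx|nx] := pselect (nr x <= R0); last by exists 0 => /nx.
  have [g [g0 gR gd]] := picard_exists LF hx hR2.
  by exists (g 1) => _; exists g.
have [Phi hPhi] := choice ex.
have c0 : 0 <= 4 * L * b by rewrite !mulr_ge0.
have eul x N : nr x <= R0 -> (0 < N)%N -> nr (euler_iter X N N x - Phi x) <= 2 * (0 + 4 * L * b / N%:R).
  move=> hx N0; have [g [g0 <- gR gd]] := hPhi x hx; rewrite -g0 in hx *.
  exact: (euler_error LF hx hR1 (lexx 0) c0 gR (solution_step LF gR gd) N0).
have lim x y (c e : R) : 0 <= c -> nr x <= R0 ->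
    (forall N, (0 < N)%N -> nr (euler_iter X N N x - y) <= 2 * (e + c / N%:R)) ->
    nr (y - Phi x) <= 2 * e.
  move=> cc hx hN; apply/ler_addgt0Pr => e' e0'.
  pose K := 2 * c + 2 * (4 * L * b).
  have K0 : 0 <= K by rewrite addr_ge0// mulr_ge0.
  have [N0 hNe] : exists N, K / N.+1%:R <= e'.
    have [N hN1] : exists N : nat, K / e' < N%:R.
      by exists (Num.bound (K / e')); apply: archi_boundP; rewrite divr_ge0// ltW.
    exists N; rewrite ler_pdivrMr// -ler_pdivrMl//.
    rewrite mulrC; apply: le_trans (ltW hN1) _; by rewrite ler_nat.
  have h1 := hN N0.+1 isT; have h2 := eul x N0.+1 hx isT.
  apply: le_trans (nrBD _ (euler_iter X N0.+1 N0.+1 x) _) _; rewrite nrB.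
  apply: le_trans (lerD h1 h2) _.
  have e1 : K / N0.+1%:R = 2 * (c / N0.+1%:R) + 2 * (4 * L * b / N0.+1%:R) by rewrite /K; ring.
  rewrite e1 in hNe; move: hNe; set A := c / _; set B := 4 * L * b / _; lra.
exists Phi; split => //.
- apply: papprox_lim => e e0.
  pose K := 2 * (4 * L * b).
  have [N hNe] : exists N, K / N.+1%:R <= e.
    have [N hN1] : exists N : nat, K / e < N%:R.
      by exists (Num.bound (K / e)); apply: archi_boundP; rewrite divr_ge0 ?mulr_ge0// ltW.
    exists N; rewrite ler_pdivrMr// -ler_pdivrMl//.
    rewrite mulrC; apply: le_trans (ltW hN1) _; by rewrite ler_nat.
  exists (euler_iter X N.+1 N.+1); split=> [|x hx].
    suff : forall k, (k <= N.+1)%N -> papprox R0 (euler_iter X N.+1 k) by apply.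
    elim=> [_|k ih kN]; first exact: papprox_id.
    apply: (@papprox_comp R d R0 R1 (fun w => w + (N.+1%:R^-1 : R)%:C%C *: X w) (euler_iter X N.+1 k)).
    - by apply: papproxD; [exact: papprox_id|exact: papproxZ].
    - by apply: ih; exact: ltnW.
    move=> x hx; apply: le_trans (euler_in LF hx hR1 _ (ltnW kN)) _ => //.
    apply: le_trans hR1; rewrite lerD2l ler_piMl// ler_pdivrMr// mul1r ler_nat ltnW//.
  rewrite nrB; apply: le_trans (eul x N.+1 hx isT) _.
  by rewrite add0r mulrA; exact: hNe.
- move=> g hx gd; have gR := solution_in_ball LF hx hR gd.
  apply/eqP; rewrite -subr_eq0 -nr_eq0 eq_le nr_ge0 andbT.
  have := lim _ (g 1) _ 0 c0 hx; rewrite mulr0; apply=> N N0.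
  exact: (euler_error LF hx hR1 (lexx 0) c0 gR (solution_step LF gR gd) N0).
move=> g dl c hx dl0 cc gR hg; apply: (lim _ _ _ _ cc hx) => N N0.
exact: (euler_error LF hx hR1).
Qed.

End LipschitzFlow.

(** * The Newton interpolation curve of an orbit *)

Section NewtonCurve.
Variables (R : realType) (d : nat).
Local Notation C := R[i].
Local Notation V := 'rV[C]_d.

Definition binpoly (j : nat) : {poly C} :=
  (j`!%:R)^-1 *: \prod_(l < j) ('X - (l%:R)%:P).

Lemma binpolyE j t : (binpoly j).[t] = (j`!%:R)^-1 * falling j t.
Proof.
rewrite /binpoly hornerZ horner_prod; congr (_ * _); apply: eq_bigr => l _.
by rewrite !hornerE.
Qed.

Lemma size_binpoly j : (size (binpoly j) <= j.+1)%N.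
Proof.
apply: leq_trans (size_scale_leq _ _) _.
by rewrite size_prod_XsubC -[index_enum _]enumT -cardE card_ord.
Qed.

Lemma binpoly0 t : (binpoly 0).[t] = 1.
Proof. by rewrite binpolyE fact0 invr1 mul1r /falling big_ord0. Qed.

Lemma binpoly_at0 j : (binpoly j.+1).[0] = 0.
Proof. by rewrite binpolyE (@falling0 R j.+1 0)// mulr0. Qed.

Lemma binpolyS_shift j t : (binpoly j.+1).[t + 1] = (binpoly j.+1).[t] + (binpoly j).[t].
Proof.
have h : falling j.+1 (t + 1) = falling j.+1 t + j.+1%:R * falling j t.
  by rewrite -fallingS_diff subrKC.
rewrite !binpolyE h mulrDr; congr (_ + _).
by rewrite factS natrM invfM mulrACA mulVf ?pnatr_eq0// mul1r.
Qed.

Lemma nr_binpoly j (t : C) (T : R) : j%:R <= T -> nr t <= T -> nr (binpoly j).[t] <= (2 * T) ^+ j.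
Proof.
move=> jT tT; rewrite binpolyE nrM nrV nr_nat.
have f1 : (1 : R) <= j`!%:R by rewrite ler1n fact_gt0.
apply: (@le_trans _ _ (nr (falling j t))).
  by rewrite ler_piMl ?nr_ge0// invf_le1// (lt_le_trans ltr01).
rewrite /falling nr_prod -[j in leRHS]card_ord -prodr_const; apply: ler_prod => l _.
rewrite nr_ge0 /=; apply: le_trans (nrBle _ _) _; rewrite nr_nat.
have : l%:R <= j%:R :> R by rewrite ler_nat ltnW.
lra.
Qed.

Definition newton_curve (f : V -> V) (n : nat) (x : V) (t : C) : V :=
  \sum_(j < n.+1) (binpoly j).[t] *: fdiff f j x.

Definition newton_poly (f : V -> V) (n : nat) (x : V) (i : 'I_d) : {poly C} :=
  \sum_(j < n.+1) fdiff f j x ord0 i *: binpoly j.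

Lemma newton_curve_coord f n x t i : newton_curve f n x t ord0 i = (newton_poly f n x i).[t].
Proof.
rewrite /newton_curve /newton_poly summxE horner_sum; apply: eq_bigr => j _.
by rewrite mxE [RHS]hornerZ mulrC.
Qed.

Lemma size_newton_poly f n x i : (size (newton_poly f n x i) <= n.+1)%N.
Proof.
apply: leq_trans (size_sum _ _ _) _; apply/bigmax_leqP => j _.
apply: leq_trans (size_scale_leq _ _) _; apply: leq_trans (size_binpoly _) _.
exact: ltn_ord.
Qed.

Lemma newton_curve_shift f n x t :
  newton_curve f n x (t + 1) - newton_curve f n x t =
  \sum_(j < n) (binpoly j).[t] *: fdiff f j.+1 x.
Proof.
rewrite /newton_curve 2!big_ord_recl /= !binpoly0 opprD addrACA subrr add0r -sumrB.
by apply: eq_bigr => j _; rewrite -scalerBl binpolyS_shift [_ + (binpoly j).[t]]addrC addrK.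
Qed.

Lemma newton_curve0 f n x : newton_curve f n x 0 = x.
Proof.
rewrite /newton_curve big_ord_recl /= binpoly0 scale1r big1 ?addr0// => j _.
by rewrite binpoly_at0 scale0r.
Qed.

Lemma newton_sum (f : V -> V) (x : V) k i N : (k <= N)%N ->
  \sum_(j < N.+1) (binpoly j).[k%:R] *: fdiff f (j + i) x = fdiff f i (iter k f x).
Proof.
elim: k i N => [|k ih] i N kN.
  rewrite big_ord_recl /= binpoly0 scale1r big1 ?addr0// => j _.
  by rewrite binpoly_at0 scale0r.
case: N kN => [//|N] kN.
rewrite big_ord_recl /= !binpoly0.
under eq_bigr do rewrite /bump leq0n add1n -natr1 binpolyS_shift scalerDl.
rewrite big_split /= addrA.
have -> : 1 *: fdiff f (0 + i) x + \sum_(j < N.+1) (binpoly j.+1).[k%:R] *: fdiff f (j.+1 + i) x =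
  \sum_(j < N.+2) (binpoly j).[k%:R] *: fdiff f (j + i) x.
  by rewrite [RHS]big_ord_recl /= binpoly0.
rewrite ih; last by rewrite ltnW.
have -> : \sum_(j < N.+1) (binpoly j).[k%:R] *: fdiff f (j.+1 + i) x =
   \sum_(j < N.+1) (binpoly j).[k%:R] *: fdiff f (j + i.+1) x.
  by apply: eq_bigr => j _; rewrite addnS addSn.
by rewrite ih //= addrC subrK.
Qed.

Lemma newton_curve_nat f n x k : (k <= n)%N -> newton_curve f n x k%:R = iter k f x.
Proof.
move=> kn; have := newton_sum f x 0 kn; rewrite /= => <-.
by apply: eq_bigr => j _; rewrite addn0.
Qed.

Lemma poly_bounded (P : {poly C}) : exists M : R, 0 <= M /\ forall z, nr z <= 1 -> nr P.[z] <= M.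
Proof.
exists (\sum_(j < size P) nr P`_j); split=> [|z hz].
  by apply: sumr_ge0 => j _; exact: nr_ge0.
rewrite horner_coef; apply: le_trans (nr_sum _ _ _) _; apply: ler_sum => j _.
by rewrite nrM nrX ler_piMr ?nr_ge0// exprn_ile1 ?nr_ge0.
Qed.

Lemma poly_taylor1 (P : {poly C}) : exists c : R, 0 <= c /\ forall s h, nr s <= 1 -> nr h <= 1 ->
  nr (P.[s + h] - P.[s] - h * P^`().[s]) <= c * nr h ^+ 2.
Proof.
elim/poly_ind: P => [|Q a [c [c0 hc]]].
  by exists 0; split => // s h _ _; rewrite deriv0 !horner0 mulr0 !subr0 nr0 mul0r.
have [M [M0 hM]] := poly_bounded Q^`().
exists (c * 2 + M); split=> [|s h hs hh]; first by rewrite addr_ge0// mulr_ge0.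
have -> : (Q * 'X + a%:P).[s + h] - (Q * 'X + a%:P).[s] - h * (Q * 'X + a%:P)^`().[s] =
   (Q.[s + h] - Q.[s] - h * Q^`().[s]) * (s + h) + h ^+ 2 * Q^`().[s].
  by rewrite derivD derivC derivM derivX addr0 mulr1 !hornerE; ring.
apply: le_trans (nrD _ _) _; rewrite [leRHS]mulrDl lerD//.
  rewrite nrM mulrAC; apply: ler_pM; rewrite ?nr_ge0 ?hc//.
  by apply: le_trans (nrD _ _) _; lra.
by rewrite nrM nrX mulrC ler_wpM2r ?exprn_ge0 ?nr_ge0// hM.
Qed.

Lemma newton_curve_taylor1 f n x : exists c : R, 0 <= c /\ forall s h : C, nr s <= 1 -> nr h <= 1 ->
  nr (newton_curve f n x (s + h) - newton_curve f n x s -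
      h *: \row_i (newton_poly f n x i)^`().[s]) <= c * nr h ^+ 2.
Proof.
have [c hc] := choice (fun i => poly_taylor1 (newton_poly f n x i)).
have c0 i : 0 <= c i by have [] := hc i.
have S0 : 0 <= \sum_i c i by exact: sumr_ge0.
exists (\sum_i c i); split=> // s h hs hh.
apply/nr_row_le => [|i]; first by rewrite mulr_ge0 ?exprn_ge0 ?nr_ge0.
have [_ hi] := hc i.
rewrite !mxE !newton_curve_coord; apply: le_trans (hi _ _ hs hh) _.
rewrite ler_wpM2r ?exprn_ge0 ?nr_ge0// (bigD1 i) //= lerDl.
by apply: sumr_ge0 => j _.
Qed.

Lemma stirling_newton_curve f m x t :
  stirling m (fun k => newton_curve f (2 * m) x (t + k%:~R)) =
  \row_i (newton_poly f (2 * m) x i)^`().[t].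
Proof.
apply/rowP => i; rewrite stirling_coord mxE.
rewrite -(stirling_exact_at (m := m)); last by rewrite addn1 size_newton_poly.
by congr stirling; apply/funext => k; rewrite newton_curve_coord.
Qed.

Section SmallPoints.
Variables (f finv : V -> V) (nu m : nat) (rho K : R).
Hypotheses (nu0 : (0 < nu)%N) (m0 : (0 < m)%N) (rho0 : 0 < rho) (K0 : 0 <= K).
Hypothesis pf : papprox rho f.
Hypothesis hf : forall x, nr x <= rho -> nr (f x - x) <= K * nr x ^+ nu.+1.
Hypothesis f2 : forall x, nr x <= rho -> nr (f x) <= 2 * nr x.
Hypothesis finv2 : forall x, nr x <= rho -> nr (finv x) <= 2 * nr x.
Hypothesis fL : forall x y, nr x <= rho -> nr y <= rho -> nr (f x - f y) <= 2 * nr (x - y).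
Hypothesis finvL : forall x y, nr x <= rho -> nr y <= rho -> nr (finv x - finv y) <= 2 * nr (x - y).
Hypothesis finvK : forall x, nr x <= rho -> finv (f x) = x.

(* [fdiff f j.+1 x] is the increment of [fdiff f j] along [f x - x], so each
   difference gains [nu] orders. *)
Lemma fdiff_order1 j : exists dl L : R, [/\ 0 < dl, 0 <= L, papprox dl (fdiff f j) &
  forall x, nr x <= dl -> nr (fdiff f j x) <= L * nr x ^+ (1 + nu * j)].
Proof.
elim: j => [|j [dl [L [dl0 L0 pj hj]]]].
  exists rho, 1; split => //; first exact: papprox_id.
  by move=> x _ /=; rewrite muln0 addn0 expr1 mul1r.
have rho0' := rho0.
pose dl' := Num.min rho dl / 4.
have mn : 0 < Num.min rho dl by rewrite lt_min rho0'.
have m1 : Num.min rho dl <= rho by rewrite ge_min lexx.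
have m2 : Num.min rho dl <= dl by rewrite ge_min lexx orbT.
have dl'0 : 0 < dl' by rewrite divr_gt0.
exists dl', (4 * (L * 4 ^+ (1 + nu * j)) / 2 * K); split => //.
- by rewrite mulr_ge0// divr_ge0// mulr_ge0// mulr_ge0// exprn_ge0.
- apply: papproxB; last by apply: papprox_le pj; rewrite /dl'; lra.
  apply: (@papprox_comp R d dl' dl (fdiff f j) f) => //.
    by apply: papprox_le pf; rewrite /dl'; lra.
  move=> x hx; have hx2 : nr x <= rho by rewrite /dl' in hx; lra.
  by have := f2 hx2; rewrite /dl' in hx; lra.
move=> x hx; rewrite /dl' in hx.
have hx2 : nr x <= rho by lra.
case: (eqVneq x 0) => [x0|x0].
  rewrite x0 in hx hx2 *.
  have f0 : f 0 = 0.
    apply/eqP; rewrite -subr_eq0 -nr_eq0 eq_le nr_ge0 andbT.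
    by have := hf hx2; rewrite nr0 exprS mul0r mulr0.
  by rewrite /= f0 subrr nr0 mulr_ge0 ?exprn_ge0 ?nr_ge0// mulr_ge0// divr_ge0// mulr_ge0// mulr_ge0// exprn_ge0.
have nx : 0 < nr x by rewrite lt_neqAle eq_sym nr_eq0 x0 nr_ge0.
have B y : nr y <= 2 * (2 * nr x) -> nr (fdiff f j y) <= L * (4 * nr x) ^+ (1 + nu * j).
  move=> hy; apply: le_trans (hj _ _) _; first by lra.
  rewrite ler_wpM2l// lerXn2r ?nnegrE ?nr_ge0//; lra.
have p2 : papprox (2 * (2 * nr x)) (fdiff f j) by apply: papprox_le pj; lra.
have x20 : 0 < 2 * nr x by lra.
have hxx : nr x <= 2 * nr x by lra.
have := lipschitz_map x20 p2 B (f2 hx2) hxx => h.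
apply: le_trans h _; apply: le_trans (ler_wpM2l _ (hf hx2)) _.
  by rewrite divr_ge0 ?(ltW x20)// mulr_ge0// mulr_ge0// exprn_ge0// mulr_ge0// ltW.
rewrite le_eqVlt; apply/orP; left; apply/eqP.
rewrite mulnS addnA [(1 + nu)%N]addnC -addnA [X in _ = _ * X]exprD [nr x ^+ nu.+1]exprSr.
rewrite exprMn [nr x ^+ (1 + _)]exprS; field; exact: lt0r_neq0.
Qed.

Lemma fdiff_order J : exists dl L : R, [/\ 0 < dl, 0 <= L &
  forall j, (j <= J)%N -> forall x, nr x <= dl -> nr (fdiff f j x) <= L * nr x ^+ (1 + nu * j)].
Proof.
elim: J => [|J [dl [L [dl0 L0 h]]]].
  have [dl [L [h1 h2 _ h3]]] := fdiff_order1 0.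
  by exists dl, L; split => // j; rewrite leqn0 => /eqP ->.
have [dl' [L' [dl'0 L'0 _ h']]] := fdiff_order1 J.+1.
exists (Num.min dl dl'), (L + L'); split; rewrite ?lt_min ?dl0 ?addr_ge0// => j.
rewrite leq_eqVlt => /predU1P[-> x|hj x]; rewrite le_min => /andP[x1 x2].
  by apply: le_trans (h' _ x2) _; rewrite ler_wpM2r ?exprn_ge0 ?nr_ge0// lerDr.
by apply: le_trans (h _ hj _ x1) _; rewrite ler_wpM2r ?exprn_ge0 ?nr_ge0// lerDl.
Qed.

Let n := (2 * m)%N.
Let U := newton_curve f n.

(* The defect [f (U x t) - U x (t + 1)] vanishes at [t = 0, ..., n-1] and is
   [O(|x|^(nu+1))] for [|t| <= T = eta |x|^-nu]; apply [zeros_at_nodes]. *)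
Lemma newton_defect : exists dl D : R, [/\ 0 < dl, dl <= rho, 0 <= D &
  forall x, 0 < nr x -> nr x <= dl -> forall t, nr t <= n.+1%:R ->
    nr (U x t) <= 2 * nr x /\
    nr (f (U x t) - U x (t + 1)) <= D * nr x ^+ (1 + nu * n.+1)].
Proof.
have rho0' := rho0.
have [dl0 [L [dl00 L0 hL]]] := fdiff_order n.
have n0 : (0 : R) <= n%:R by [].
pose eta : R := (4 * (n%:R * L + 1))^-1.
have den0 : 0 < 4 * (n%:R * L + 1) by rewrite mulr_gt0// ltr_wpDl// mulr_ge0.
have eta0 : 0 < eta by rewrite invr_gt0.
have eta2 : 2 * eta <= 1.
  rewrite /eta ler_pdivrMr// mul1r; have := mulr_ge0 n0 L0; lra.
have etaL : n%:R * L * (2 * eta) <= 1.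
  have : eta * (4 * (n%:R * L + 1)) = 1 by rewrite /eta mulVf// gt_eqF.
  have := mulr_ge0 n0 L0; nra.
have tau1 : n%:R <= n.+1%:R :> R by rewrite ler_nat.
have [A [A0 hA]] := zeros_at_nodes tau1.
pose B0 := K * 2 ^+ nu.+1 + n%:R * L.
have B00 : 0 <= B0 by rewrite addr_ge0 ?mulr_ge0 ?exprn_ge0.
have n1 : (1 : R) <= n.+1%:R by rewrite ler1n.
exists (Num.min (Num.min 1 dl0) (Num.min (rho / 2) (eta / (2 * n.+1%:R)))), (A * B0 / eta ^+ n).
split.
- by rewrite !lt_min ltr01 dl00 !divr_gt0//; lra.
- have : Num.min (Num.min 1 dl0) (Num.min (rho / 2) (eta / (2 * n.+1%:R))) <= rho / 2.
    by rewrite !ge_min lexx !orbT.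
  lra.
- by rewrite divr_ge0 ?exprn_ge0 ?(ltW eta0)// mulr_ge0.
move=> x x0; rewrite !le_min => /andP[/andP[x1 xd] /andP[xr xe]].
set s := nr x in x0 x1 xd xr xe *.
have s0 : 0 <= s by exact: ltW.
have snu0 : 0 < s ^+ nu by rewrite exprn_gt0.
pose T := eta / s ^+ nu.
have T0 : 0 < T by rewrite divr_gt0.
have tT : 2 * n.+1%:R <= T.
  rewrite /T ler_pdivlMr// mulrC -ler_pdivlMr; last by lra.
  apply: le_trans xe; case: (nu) nu0 => // k _.
  by rewrite exprS ler_piMr// exprn_ile1.
have nT : n%:R <= T by lra.
have Tp j : (2 * T) ^+ j * s ^+ (nu * j) = (2 * eta) ^+ j.
  rewrite exprM -exprMn; congr (_ ^+ _); rewrite /T -mulrA divfK// gt_eqF//.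
have term j (t : C) : (j < n)%N -> nr t <= T ->
    nr ((binpoly j).[t] *: fdiff f j.+1 x) <= L * s ^+ nu.+1.
  move=> jn ht; rewrite nrZ.
  have jT : j%:R <= T by apply: le_trans nT; rewrite ler_nat ltnW.
  have hj : nr (fdiff f j.+1 x) <= L * s ^+ (1 + nu * j.+1) := hL _ jn _ xd.
  apply: (@le_trans _ _ ((2 * T) ^+ j * (L * s ^+ (1 + nu * j.+1)))).
    by apply: ler_pM; rewrite ?nr_ge0// ?nr_binpoly.
  have -> : (2 * T) ^+ j * (L * s ^+ (1 + nu * j.+1)) = L * s ^+ nu.+1 * ((2 * T) ^+ j * s ^+ (nu * j)).
    by rewrite mulnS addnA add1n exprD; ring.
  rewrite Tp ler_piMr ?mulr_ge0 ?exprn_ge0// exprn_ile1// mulr_ge0// ltW//.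
have shiftB (t : C) : nr t <= T -> nr (U x (t + 1) - U x t) <= n%:R * L * s ^+ nu.+1.
  move=> ht; rewrite newton_curve_shift; apply: le_trans (nr_sum _ _ _) _.
  rewrite -mulrA mulr_natl -[X in _ *+ X]card_ord -sumr_const; apply: ler_sum => j _.
  exact: term.
have curveB (t : C) : nr t <= T -> nr (U x t) <= 2 * s.
  move=> ht; rewrite /U /newton_curve big_ord_recl /= binpoly0 scale1r.
  apply: le_trans (nrD _ _) _; rewrite mulr2n mulrDl mul1r lerD2l.
  apply: le_trans (nr_sum _ _ _) _.
  apply: (@le_trans _ _ (\sum_(j < n) L * (2 * eta) * s)).
    apply: ler_sum => j _; rewrite /bump leq0n add1n nrZ.
    have jT : j.+1%:R <= T by apply: le_trans nT; rewrite ler_nat.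
    have hj : nr (fdiff f j.+1 x) <= L * s ^+ (1 + nu * j.+1) := hL _ (ltn_ord j) _ xd.
    apply: (@le_trans _ _ ((2 * T) ^+ j.+1 * (L * s ^+ (1 + nu * j.+1)))).
      by apply: ler_pM; rewrite ?nr_ge0// ?nr_binpoly.
    have -> : (2 * T) ^+ j.+1 * (L * s ^+ (1 + nu * j.+1)) = L * s * ((2 * T) ^+ j.+1 * s ^+ (nu * j.+1)).
      by rewrite exprD expr1; ring.
    rewrite Tp mulrAC ler_wpM2r// ler_wpM2l// exprS ler_piMr ?mulr_ge0 ?(ltW eta0)//.
    by rewrite exprn_ile1// mulr_ge0// ltW.
  rewrite sumr_const card_ord.
  have -> : L * (2 * eta) * s *+ n = n%:R * L * (2 * eta) * s by rewrite -[LHS]mulr_natl; ring.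
  exact: ler_piMl.
have curveR (t : C) : nr t <= T -> nr (U x t) <= rho by move=> ht; have := curveB t ht; lra.
have defB (t : C) : nr t <= T -> nr (f (U x t) - U x (t + 1)) <= B0 * s ^+ nu.+1.
  move=> ht; have -> : f (U x t) - U x (t + 1) = (f (U x t) - U x t) - (U x (t + 1) - U x t).
    by rewrite opprB addrA subrK.
  apply: le_trans (nrBle _ _) _; rewrite /B0 mulrDl lerD ?shiftB//.
  apply: le_trans (hf (curveR _ ht)) _; rewrite -mulrA ler_wpM2l// -exprMn.
  by rewrite lerXn2r ?nnegrE ?nr_ge0 ?curveB// mulr_ge0.
move=> t ht; have htT : nr t <= T by lra.
split; first exact: curveB.
have C0 : 0 <= A * B0 / eta ^+ n by rewrite divr_ge0 ?exprn_ge0 ?(ltW eta0)// mulr_ge0.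
apply/nr_row_le => [|i]; first by rewrite mulr_ge0// exprn_ge0.
have pol j : exists P : {poly C}, forall t, U x t ord0 j = P.[t].
  by exists (newton_poly f n x j) => r; exact: newton_curve_coord.
have [P hP] : exists P : {poly C}, forall t, U x (t + 1) ord0 i = P.[t].
  exists (newton_poly f n x i \Po ('X + 1%:P)) => r.
  by rewrite /U newton_curve_coord horner_comp !hornerE.
pose phi t := f (U x t) ord0 i - P.[t].
have phiE r : phi r = (f (U x r) - U x (r + 1)) ord0 i by rewrite /phi -hP !mxE.
have pphi : papprox1 T phi by apply: papprox1B; exact: papprox_curve pf pol curveR.
have := hA phi T (B0 * s ^+ nu.+1) tT T0 pphi _ _ t ht.
rewrite phiE => h; apply: le_trans (h _ _) _.
- by move=> r hr; rewrite phiE; apply: le_trans (nr_coord _ i) (defB _ hr).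
- move=> k kn; rewrite phiE /U newton_curve_nat ?(ltnW kn)//.
  by rewrite (_ : k%:R + 1 = k.+1%:R) ?natr1// newton_curve_nat//= subrr mxE.
rewrite le_eqVlt; apply/orP; left; apply/eqP.
rewrite /T expr_div_n mulnS addnA add1n exprD exprM; field.
by rewrite !expf_neq0 ?gt_eqF.
Qed.

Lemma orbit_near_newton : exists dl D : R, [/\ 0 < dl, dl <= rho, 0 <= D &
  forall x, 0 < nr x -> nr x <= dl -> forall t : R, 0 <= t <= 1 ->
    nr (U x t%:C%C) <= 2 * nr x /\
    forall k : int, - m%:Z <= k <= m%:Z ->
      nr (orbit_pt f finv (U x t%:C%C) k - U x (t%:C%C + k%:~R)) <= D * nr x ^+ (1 + nu * n.+1)].
Proof.
have rho0' := rho0.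
have [dl [D [dl0 dlr D0 hD]]] := newton_defect.
pose dl' := Num.min dl (rho / (8 * 2 ^+ m)).
have p1 k : (1 : R) <= 2 ^+ k by rewrite exprn_ege1// ler1n.
have dl'0 : 0 < dl' by rewrite lt_min dl0 divr_gt0// mulr_gt0// exprn_gt0.
exists dl', (2 ^+ m * (2 * D)); split=> //; first by rewrite ge_min dlr.
  by rewrite mulr_ge0 ?exprn_ge0// mulr_ge0.
move=> x x0; rewrite le_min => /andP[xd]; rewrite ler_pdivlMr ?mulr_gt0 ?exprn_gt0// => xr t /andP[t0 t1].
set s := nr x in x0 xd xr *; set E := s ^+ (1 + nu * n.+1).
have E0 : 0 <= E by rewrite exprn_ge0// ltW.
have nt (k : int) : - m.+1%:Z <= k <= m%:Z -> nr (t%:C%C + k%:~R : C) <= n.+1%:R.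
  move=> hk; apply: le_trans (nrD _ _) _; rewrite nrC ger0_norm//.
  have : nr (k%:~R : C) <= m.+1%:R.
    case: k hk => k hk; first by rewrite nr_nat ler_nat; move: hk; clear; lia.
    by rewrite NegzE mulrNz nrN nr_nat ler_nat; move: hk; clear; lia.
  have : m.+1%:R <= n%:R :> R by rewrite ler_nat /n; move: m0; clear; lia.
  by rewrite -[n.+1%:R]natr1; lra.
have Ub (k : int) : - m.+1%:Z <= k <= m%:Z -> nr (U x (t%:C%C + k%:~R)) <= 2 * s.
  by move=> hk; have [] := hD x x0 xd _ (nt k hk).
have Ud (k : int) : - m.+1%:Z <= k <= m%:Z ->
    nr (f (U x (t%:C%C + k%:~R)) - U x (t%:C%C + k%:~R + 1)) <= D * E.
  by move=> hk; have [] := hD x x0 xd _ (nt k hk).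
have y0 : nr (U x t%:C%C) <= 2 * s by have := Ub 0; rewrite addr0; apply.
split => //; set y := U x t%:C%C in y0 *.
have s8 : 8 * s <= rho.
  by apply: le_trans xr; rewrite [leLHS]mulrC ler_wpM2l ?(ltW x0)// ler_peMr.
have s2m k : (k <= m)%N -> 2 ^+ k * (2 * s) <= rho.
  move=> km; apply: le_trans xr.
  have : 2 ^+ k <= 2 ^+ m :> R by rewrite ler_weXn2l// ler1n.
  move=> kk; have -> : 2 ^+ k * (2 * s) = s * (2 * 2 ^+ k) by ring.
  by rewrite ler_wpM2l ?(ltW x0)//; apply: ler_pM; rewrite ?exprn_ge0// ler_nat.
have small (g : V -> V) k : (forall x, nr x <= rho -> nr (g x) <= 2 * nr x) -> (k <= m)%N ->
    nr (iter k g y) <= 2 ^+ k * (2 * s).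
  move=> g2; elim: k => [|k ih] km; first by rewrite expr0 mul1r.
  have h := ih (ltnW km); apply: le_trans (g2 _ (le_trans h (s2m _ (ltnW km)))) _.
  by rewrite exprS -mulrA ler_wpM2l.
have fw k : (k <= m)%N -> nr (iter k f y - U x (t%:C%C + k%:~R)) <= (2 ^+ k - 1) * (2 * D) * E.
  elim: k => [|k ih] km; first by rewrite /= addr0 subrr nr0 expr0 subrr !mul0r.
  have {}ih := ih (ltnW km).
  have hk : - m.+1%:Z <= k%:Z <= m%:Z by move: km; clear; lia.
  have r1 : nr (iter k f y) <= rho by apply: le_trans (small f k f2 (ltnW km)) (s2m _ (ltnW km)).
  have r2 : nr (U x (t%:C%C + k%:~R)) <= rho by apply: le_trans (Ub k hk) _; lra.
  have -> : t%:C%C + k.+1%:~R = t%:C%C + k%:~R + 1 :> C by rewrite -addrA [k%:~R + 1]addrC intS rmorphD.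
  apply: le_trans (nrBD _ (f (U x (t%:C%C + k%:~R))) _) _.
  apply: le_trans (lerD (fL r1 r2) (Ud k hk)) _.
  have := mulr_ge0 D0 E0; rewrite exprS; lra.
have bw k : (k <= m)%N -> nr (iter k finv y - U x (t%:C%C - k%:R)) <= (2 ^+ k - 1) * (2 * D) * E.
  elim: k => [|k ih] km; first by rewrite /= subr0 subrr nr0 expr0 subrr !mul0r.
  have {}ih := ih (ltnW km).
  have hk : - m.+1%:Z <= - k.+1%:Z <= m%:Z by move: km; clear; lia.
  have hk' : - m.+1%:Z <= - k%:Z <= m%:Z by move: km; clear; lia.
  have r1 : nr (iter k finv y) <= rho by apply: le_trans (small finv k finv2 (ltnW km)) (s2m _ (ltnW km)).
  have b2 := Ub _ hk; have b3 := Ud _ hk.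
  have e1 : t%:C%C + (- k.+1%:Z)%:~R + 1 = t%:C%C - k%:R :> C.
    rewrite mulrNz (_ : k.+1%:~R = k%:R + 1 :> C) ?natr1// -natr1; ring.
  have e2 : t%:C%C + (- k.+1%:Z)%:~R = t%:C%C - k.+1%:R :> C by rewrite mulrNz.
  rewrite e1 in b3; rewrite e2 in b2 b3.
  have r2 : nr (U x (t%:C%C - k.+1%:R)) <= rho by lra.
  have r3 : nr (f (U x (t%:C%C - k.+1%:R))) <= rho by have := f2 r2; lra.
  rewrite -(finvK r2) /=; apply: le_trans (finvL r1 r3) _.
  have := nrBD (iter k finv y) (U x (t%:C%C - k%:R)) (f (U x (t%:C%C - k.+1%:R))).
  rewrite (nrB (U x _)) => h.
  have := mulr_ge0 D0 E0; rewrite exprS; lra.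
have fin k : (k <= m)%N -> (2 ^+ k - 1) * (2 * D) * E <= 2 ^+ m * (2 * D) * E.
  move=> km; rewrite ler_wpM2r// ler_wpM2r ?mulr_ge0//.
  have : 2 ^+ k <= 2 ^+ m :> R by rewrite ler_weXn2l// ler1n.
  lra.
case=> k hk; first by have km : (k <= m)%N by [move: hk; clear; lia]; exact: le_trans (fw k km) (fin k km).
have km : (k.+1 <= m)%N by move: hk; clear; lia.
by rewrite NegzE mulrNz; exact: le_trans (bw _ km) (fin _ km).
Qed.

End SmallPoints.

End NewtonCurve.

(** * The error of the time-one map *)

Section ErrorBound.
Variables (R : realType) (d : nat).
Local Notation C := R[i].
Local Notation V := 'rV[C]_d.

Lemma in_B_good_pair (r0 eps0 R1 rho : R) (nu m : nat) (f finv : V -> V) :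
  0 < r0 -> 0 < eps0 -> eps0 <= r0 -> (0 < nu)%N -> in_B r0 eps0 nu.+1 f finv ->
  0 < rho -> 2 * rho <= r0 / 8 -> 0 <= R1 ->
  m%:R * (nu%:R * eps0 / r0 ^+ nu.+1) * R1 ^+ nu <= 3 / 4 -> 4 * R1 ^+ nu <= rho ^+ nu ->
  good_pair f finv m R1 rho (eps0 * (rho / r0) ^+ nu.+1)
    (4 * (eps0 * (2 * rho / r0) ^+ nu.+1) / rho).
Proof.
move=> r00 e0 e0r0 nu0 fB rho0 hrho R10 hm hR1.
have rr0 : rho <= r0 by lra.
have bd (g : V -> V) (s : R) : (forall x, nr x <= r0 -> nr (g x - x) <= eps0 * (nr x / r0) ^+ nu.+1) ->
    s <= r0 -> forall x, nr x <= s -> nr (g x - x) <= eps0 * (s / r0) ^+ nu.+1.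
  move=> hg sr x hx; apply: le_trans (hg _ (le_trans hx sr)) _.
  rewrite ler_wpM2l ?(ltW e0)// lerXn2r ?nnegrE ?divr_ge0 ?nr_ge0 ?(ltW r00)//.
    by apply: le_trans hx; exact: nr_ge0.
  by rewrite ler_wpM2r// invr_ge0 ltW.
have bf := B_bound_f r00 (ltn0Sn nu) fB.
have bfi := B_bound_finv r00 (ltn0Sn nu) fB.
have pf s : 0 < s -> s < r0 -> papprox s f by exact: (B_papprox_f fB).
have pfi s : 0 < s -> s < r0 -> papprox s finv by exact: (B_papprox_finv fB).
have lip (g : V -> V) : (forall x, nr x <= r0 -> nr (g x - x) <= eps0 * (nr x / r0) ^+ nu.+1) ->
    papprox (2 * rho) g -> forall x y, nr x <= rho -> nr y <= rho ->
    nr ((g x - x) - (g y - y)) <= 4 * (eps0 * (2 * rho / r0) ^+ nu.+1) / rho * nr (x - y).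
  move=> hg pg x y hx hy; apply: (@lipschitz_map R d (fun x => g x - x)) => //.
    by apply: papproxB => //; exact: papprox_id.
  by apply: bd => //; lra.
have it (g : V -> V) : (forall x, nr x <= r0 -> nr (g x - x) <= eps0 * (nr x / r0) ^+ nu.+1) ->
    forall x k, nr x <= R1 -> (k <= m)%N -> nr (iter k g x) <= rho.
  move=> hg x k hx km; apply: (@orbit_growth R d g r0 eps0 (R1 ^+ nu) rho nu m) => //.
  - exact: ltW.
  - by rewrite exprn_ge0.
  - exact: ltW.
  - by rewrite lerXn2r ?nnegrE ?nr_ge0.
split.
- by apply: pf => //; lra.
- by apply: pfi => //; lra.
- exact: bd.
- exact: bd.
- by apply: lip bf _; apply: pf; lra.
- by apply: lip bfi _; apply: pfi; lra.
- by move=> x hx; apply: (B_cancel_ffinv r00 e0 e0r0 (ltn0Sn nu) fB); lra.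
- exact: it.
- exact: it.
- by rewrite divr_ge0 ?(ltW rho0)// mulr_ge0// mulr_ge0 ?(ltW e0)// exprn_ge0// divr_ge0 ?(ltW r00)// mulr_ge0// ltW.
Qed.

(* [Phi x] and [f x] are the time-one values of the integral curve and of the
   Newton curve from [x]; the latter solves the equation up to a small defect. *)
Lemma flow_error_order (f finv : V -> V) (r0 eps0 R0 R1 rho b L : R) (nu m : nat) (Phi : V -> V) :
  0 < r0 -> 0 < eps0 -> eps0 <= r0 -> (0 < nu)%N -> (0 < m)%N ->
  in_B r0 eps0 nu.+1 f finv ->
  0 < rho -> 2 * rho <= r0 / 8 -> 0 < R0 -> R0 < R1 ->
  forall a l : R, good_pair f finv m R1 rho a l -> l <= 1 ->
  lip_field (interp_field f finv m) R1 b L ->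
  (forall g, nr (g 0) <= R0 ->
     (forall t, 0 <= t <= 1 -> vderiv g t (interp_field f finv m (g t))) -> g 1 = Phi (g 0)) ->
  (forall (g : R -> V) (dl c : R), nr (g 0) <= R0 -> 0 <= dl -> 0 <= c ->
    (forall t, 0 <= t <= 1 -> nr (g t) <= R1) ->
    (forall s h : R, 0 <= s -> 0 <= h -> s + h <= 1 ->
     nr (g (s + h) - g s - h%:C%C *: interp_field f finv m (g s)) <= h * (dl + c * h)) ->
    nr (g 1 - Phi (g 0)) <= 2 * dl) ->
  order_ge (1 + nu * (2 * m).+1) (fun x => Phi x - f x).
Proof.
move=> r00 e0 e0r0 nu0 m0 fB rho0 hrho R00 R01 a l G l1 LF hPhi1 hPhi2.
have bf := B_bound_f r00 (ltn0Sn nu) fB.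
have bfi := B_bound_finv r00 (ltn0Sn nu) fB.
have K0 : 0 <= eps0 / r0 ^+ nu.+1 by rewrite divr_ge0 ?exprn_ge0 ?(ltW e0) ?(ltW r00).
have l0 := good_l G.
have rr0 (x : V) : nr x <= rho -> nr x <= r0 by move=> hx; lra.
have hf x : nr x <= rho -> nr (f x - x) <= eps0 / r0 ^+ nu.+1 * nr x ^+ nu.+1.
  by move=> hx; have := bf x (rr0 _ hx); rewrite expr_div_n mulrA mulrAC.
have f2 x : nr x <= rho -> nr (f x) <= 2 * nr x.
  by move=> hx; apply: (half_small r00 e0 e0r0 (ltn0Sn nu) bf); exact: rr0.
have finv2 x : nr x <= rho -> nr (finv x) <= 2 * nr x.
  by move=> hx; apply: (half_small r00 e0 e0r0 (ltn0Sn nu) bfi); exact: rr0.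
have l2 : 1 + l <= 2 by lra.
have fL x y : nr x <= rho -> nr y <= rho -> nr (f x - f y) <= 2 * nr (x - y).
  move=> hx hy; apply: le_trans (step_lip (good_lip_f G hx hy)) _.
  by rewrite ler_wpM2r ?nr_ge0.
have finvL x y : nr x <= rho -> nr y <= rho -> nr (finv x - finv y) <= 2 * nr (x - y).
  move=> hx hy; apply: le_trans (step_lip (good_lip_finv G hx hy)) _.
  by rewrite ler_wpM2r ?nr_ge0.
have finvK x : nr x <= rho -> finv (f x) = x.
  by move=> hx; apply: (B_cancel_finvf r00 e0 e0r0 (ltn0Sn nu) fB); lra.
have [dl [D [dl0 dlr D0 hD]]] :=
  orbit_near_newton nu0 m0 rho0 K0 (good_papprox_f G) hf f2 finv2 fL finvL finvK.
have R10 : 0 < R1 by lra.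
have S0 := stirling_norm_ge0 R m.
exists (2 * (stirling_norm R m * (2 * D))), (Num.min dl (Num.min (R1 / 2) R0)).
split; first by rewrite !lt_min dl0 R00 divr_gt0.
move=> x; rewrite !le_min => /and3P[xd xR1 xR0].
have [xe0|x0] := eqVneq x 0.
  have f0 := B_f0 fB; have fi0 := B_finv0 fB.
  have o0 k : orbit_pt f finv 0 k = 0.
    have it (g : V -> V) j : g 0 = 0 -> iter j g 0 = 0 by move=> g0; elim: j => //= j ->.
    by case: k => k /=; rewrite it.
  have n0R1 : nr (0 : V) <= R1 by rewrite nr0 ltW.
  have X0 : interp_field f finv m 0 = 0.
    apply/eqP; rewrite -nr_eq0 eq_le nr_ge0 andbT (interp_fieldE G)//.
    apply: le_trans (stirling_bound (e := 0) _) _; last by rewrite !mulr0.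
    by move=> k _; rewrite o0 nr0.
  have P0 : 0 = Phi 0.
    apply: (hPhi1 (fun=> 0)); first by rewrite nr0 ltW.
    by move=> t _; rewrite X0; exact: vderiv_cst.
  by rewrite xe0 -P0 f0 subrr nr0 mulr_ge0 ?exprn_ge0// mulr_ge0// mulr_ge0// mulr_ge0.
have nx : 0 < nr x by rewrite lt_neqAle eq_sym nr_eq0 x0 nr_ge0.
pose g (t : R) := newton_curve f (2 * m) x t%:C%C.
have g0 : g 0 = x by rewrite /g rmorph0 newton_curve0.
have g1 : g 1 = f x.
  by rewrite /g rmorph1 (newton_curve_nat f x (k := 1))// muln_gt0.
have gR t : 0 <= t <= 1 -> nr (g t) <= R1.
  by move=> ht; have [h _] := hD x nx xd t ht; apply: le_trans h _; lra.
have [c [c0 hc]] := newton_curve_taylor1 f (2 * m) x.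
have := hPhi2 g (stirling_norm R m * (2 * (D * nr x ^+ (1 + nu * (2 * m).+1)))) c.
rewrite g0 g1 nrB => h; apply: le_trans (h xR0 _ c0 gR _) _.
- by rewrite mulr_ge0// mulr_ge0// mulr_ge0// exprn_ge0 ?nr_ge0.
- move=> s h' s0 h0 sh.
  have sin : 0 <= s <= 1 by apply/andP; split; lra.
  have ns : nr (s%:C%C : C) <= 1 by rewrite nrC ger0_norm//; lra.
  have nh : nr (h'%:C%C : C) <= 1 by rewrite nrC ger0_norm//; lra.
  have h1 := hc _ _ ns nh; rewrite nrC ger0_norm// in h1.
  have [_ ho] := hD x nx xd s sin.
  rewrite -stirling_newton_curve in h1.
  set Y := stirling m _ in h1.
  have h2 : nr (Y - interp_field f finv m (g s)) <=
      stirling_norm R m * (2 * (D * nr x ^+ (1 + nu * (2 * m).+1))).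
    rewrite (interp_fieldE G) ?gR// -stirlingB; apply: stirling_bound => k hk.
    by rewrite nrB; exact: ho.
  have -> : g (s + h') - g s - h'%:C%C *: interp_field f finv m (g s) =
    (newton_curve f (2 * m) x (s%:C%C + h'%:C%C) - newton_curve f (2 * m) x s%:C%C - h'%:C%C *: Y)
     + h'%:C%C *: (Y - interp_field f finv m (g s)).
    by rewrite /g rmorphD scalerBr addrA subrK.
  apply: le_trans (nrD _ _) _; rewrite nrZ nrC ger0_norm// mulrDr addrC lerD//.
    by rewrite ler_wpM2l.
  by rewrite mulrCA -expr2.
by rewrite le_eqVlt; apply/orP; left; apply/eqP; ring.
Qed.

(* The Schwarz lemma at scale [R0 = r / q]: the error has order
   [1 + nu (2 m + 1)] at the origin, and [q ^ nu = 1 / e]. *)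
Lemma interp_flow_error (f finv : V -> V) (r0 eps0 r R0 R1 rho q : R) (nu m : nat) :
  0 < r0 -> 0 < eps0 -> eps0 <= r0 -> (0 < nu)%N -> (0 < m)%N ->
  in_B r0 eps0 nu.+1 f finv ->
  0 < r -> 0 < q -> q < 1 -> r = q * R0 -> R0 < R1 -> 0 < rho -> 2 * rho <= r0 / 8 ->
  m%:R * (nu%:R * eps0 / r0 ^+ nu.+1) * R1 ^+ nu <= 3 / 4 -> 4 * R1 ^+ nu <= rho ^+ nu ->
  let a := eps0 * (rho / r0) ^+ nu.+1 in
  let l := 4 * (eps0 * (2 * rho / r0) ^+ nu.+1) / rho in
  let b := stirling_norm R m * a in
  l <= 1 -> stirling_norm R m * (l * (1 + l) ^+ m) <= 1 / 4 ->
  R0 + 2 * b < R1 -> 2 * b + a <= 4 * eps0 * (1 - q) ->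
  let X := interp_field f finv m in
  let D := interp_dom r0 f finv m in
  (forall x, cball r x -> flow_rel D X 1 x !=set0) /\
  (supnorm r (fun x => (flow D X 1 x - f x)%R) <= (4 * eps0 * q ^+ (2 * m * nu))%:E)%E.
Proof.
move=> r00 e0 e0r0 nu0 m0 fB r0' q0 q1 rq R01 rho0 hrho hm hR1 a l b l1 hL hb hB X D.
have R00 : 0 < R0 by move: r0'; rewrite rq pmulr_rgt0.
have rR0 : r <= R0 by rewrite rq ler_piMl// ltW.
have R10 : 0 <= R1 by lra.
have G := in_B_good_pair r00 e0 e0r0 nu0 fB rho0 hrho R10 hm hR1.
rewrite -/a -/l in G.
have l0 : 0 <= l := good_l G.
have a0 : 0 <= a by rewrite mulr_ge0 ?(ltW e0)// exprn_ge0// divr_ge0 ?(ltW rho0) ?(ltW r00).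
have S0 := stirling_norm_ge0 R m.
have LF : lip_field X R1 b (stirling_norm R m * (l * (1 + l) ^+ m)).
  split=> //.
  - by rewrite mulr_ge0.
  - by rewrite mulr_ge0// mulr_ge0// exprn_ge0// addr_ge0.
  - by move=> x hx; exact: (interp_field_bound G).
  - by move=> x y hx hy; exact: (interp_field_lip G).
have [Phi [pPhi ePhi uPhi aPhi]] := flow_exists LF (ltW R00) hb (interp_field_papprox G R10).
have oE := flow_error_order r00 e0 e0r0 nu0 m0 fB rho0 hrho R00 R01 G l1 LF uPhi aPhi.
have b0 : 0 <= b by rewrite mulr_ge0.
have rhor : rho <= r0 by lra.
have relE x y : nr x <= R0 -> flow_rel D X 1 x y -> y = Phi x.
  move=> hx [g [g0 hg <-]]; have := uPhi g; rewrite g0; apply=> //.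
  by move=> t /hg[_ h] i; exact: h.
have relx x : nr x <= R0 -> flow_rel D X 1 x (Phi x).
  move=> hx; have [g [g0 g1 gR gd]] := ePhi x hx.
  exists g; split => // t ht; split; last by move=> i; exact: gd.
  by apply: (interp_dom_ball G) => //; exact: gR.
have flowE x : nr x <= R0 -> flow D X 1 x = Phi x.
  move=> hx; apply: relE => //; rewrite /flow.
  by case: xgetP => [y _ //|/(_ (Phi x))]; have := relx x hx.
split.
  by move=> x /cballE hx; exists (Phi x); apply: relx; lra.
apply: supnorm_ge => x hx.
have hxR : nr x <= R0 by lra.
rewrite flowE//.
have R0rho : R0 <= rho.
  rewrite -(ler_pXn2r nu0) ?nnegrE ?(ltW R00) ?(ltW rho0)//.
  have h1 : R0 ^+ nu <= R1 ^+ nu by rewrite lerXn2r ?nnegrE ?(ltW R00)// ltW.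
  have : 0 <= R1 ^+ nu by rewrite exprn_ge0.
  by move: h1 hR1; lra.
have pf : papprox R0 f by apply: papprox_le R0rho (good_papprox_f G).
have pE : papprox R0 (fun x => Phi x - f x) by exact: papproxB.
have EB y : nr y <= R0 -> nr (Phi y - f y) <= 2 * b + a.
  move=> hy; have [g [g0 g1 gR gd]] := ePhi y hy.
  have -> : Phi y - f y = (g 1 - g 0) - (f y - y) by rewrite g0 g1 opprB addrA subrK.
  apply: le_trans (nrBle _ _) _; apply: lerD; last by apply: (good_bound_f G); lra.
  have := @vderiv_mean_value R d g (fun t => X (g t)) 0 1 b ler01.
  rewrite subr0 mulr1; apply=> t ht; split; first exact: gd.
  by apply: (lf_bound LF); exact: gR.
have hq : nr x <= q * R0 by rewrite -rq.
have := schwarz_map q0 q1 pE EB oE hq => h; apply: le_trans h _.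
have q10 : 0 < 1 - q by rewrite subr_gt0.
rewrite ler_pdivrMr//; apply: (@le_trans _ _ ((2 * b + a) * q ^+ (2 * m * nu))).
  apply: ler_wpM2l; first by rewrite addr_ge0// mulr_ge0.
  apply: ler_wiXn2l; rewrite ?(ltW q0) ?(ltW q1)//.
  by rewrite add1n ltnW// ltnS mulnC leq_mul2l leqnSn orbT.
by rewrite [leRHS]mulrAC ler_wpM2r ?exprn_ge0 ?(ltW q0)//.
Qed.

End ErrorBound.

(** * Choice of the parameters *)

Ltac pos := repeat match goal with
  | |- is_true (0 < _) => done
  | |- is_true (0 < _ * _) => apply: mulr_gt0
  | |- is_true (0 < _ ^-1) => rewrite invr_gt0
  | |- is_true (0 < _ ^+ _) => apply: exprn_gt0
  | |- is_true (0 < expR _) => exact: expR_gt0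
  | |- is_true (0 < Num.sqrt _) => rewrite sqrtr_gt0
  | |- is_true (0 < _ + _) => apply: addr_gt0
  end.

Lemma exists_interp_radius (R : realType) (eps0 r0 K : R) (nu : nat) :
  0 < eps0 -> 0 < r0 -> 0 < K -> (0 < nu)%N ->
  K = 1 / (nu%:R * Num.sqrt 2 * expR 1 ^+ 2) * (r0 / eps0) ->
  let q := expR (- nu%:R^-1) : R in
  exists r1 : R, 0 < r1 < r0 /\ forall r : R, 0 < r < r1 ->
  let m := Num.trunc (K * (r0 / r) ^+ nu) in
  let rho := 4 * expR 2 * r in
  let R0 := expR nu%:R^-1 * r in
  let R1 := expR (2 / nu%:R) * r in
  let a := eps0 * (rho / r0) ^+ nu.+1 in
  let l := 4 * (eps0 * (2 * rho / r0) ^+ nu.+1) / rho in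
  let b := stirling_norm R m * a in
  [/\ (0 < m)%N, R0 < R1, 2 * rho <= r0 / 8,
     m%:R * (nu%:R * eps0 / r0 ^+ nu.+1) * R1 ^+ nu <= 3 / 4 & 4 * R1 ^+ nu <= rho ^+ nu] /\
  [/\ l <= 1, stirling_norm R m * (l * (1 + l) ^+ m) <= 1 / 4,
     R0 + 2 * b < R1 & 2 * b + a <= 4 * eps0 * (1 - q)].
Proof.
move=> e0 r00 K0 nu0 KE q.
have nuR : (0 : R) < nu%:R by rewrite ltr0n.
have nuI : (0 : R) < nu%:R^-1 by rewrite invr_gt0.
have q0 : 0 < q by exact: expR_gt0.
have q1 : q < 1 by rewrite expR_lt1 oppr_lt0.
have q1' : 0 < 1 - q by rewrite subr_gt0.
pose c4 : R := 4 * expR 2.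
have e21 : (1 : R) <= expR 2 by have := expR_ge1Dx (2 : R); lra.
have c41 : 1 <= c4 by rewrite /c4; lra.
have c40 : 0 < c4 by lra.
pose Ca := eps0 * (c4 / r0) ^+ nu.+1.
have Ca0 : 0 < Ca by rewrite /Ca; pos.
pose Cl := 4 * (eps0 * (2 * c4 / r0) ^+ nu.+1) / c4.
have Cl0 : 0 < Cl by rewrite /Cl; pos.
pose M := K * r0 ^+ nu * Cl.
pose g : R := expR (2 / nu%:R) - expR nu%:R^-1.
have g0 : 0 < g by rewrite subr_gt0 ltr_expR; lra.
pose kp := Num.min (1 / (4 * Cl * expR M)) (g / (4 * Ca)).
have kp0 : 0 < kp by rewrite lt_min; apply/andP; split; pos.
have rn0 : 0 < r0 ^+ nu by rewrite exprn_gt0.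
pose r1 := Num.min (Num.min (Num.min 1 (r0 / 2)) (Num.min (r0 / (16 * c4)) (kp ^+ 2 / (8 * K * r0 ^+ nu))))
  (Num.min (Num.min Cl^-1 (4 * eps0 * (1 - q) / (g + Ca))) (K * r0 ^+ nu)).
exists r1; split.
  apply/andP; split.
    by rewrite !lt_min ltr01; do !(apply/andP; split); pos.
  have : r1 <= r0 / 2 by rewrite /r1 !ge_min lexx !orbT.
  lra.
move=> r /andP[rp rr1] m rho R0 R1 a l b.
move: rr1; rewrite /r1 !lt_min => /andP[/andP[/andP[h1 h2] /andP[h3 h4]] /andP[/andP[h5 h6] h7]].
have rnu0 : 0 < r ^+ nu by rewrite exprn_gt0.
have rnur : r ^+ nu <= r.
  by case: (nu) nu0 => // k _; rewrite exprS ler_piMr ?(ltW rp)// exprn_ile1// ltW.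
have PE : (r0 / r) ^+ nu * r ^+ nu = r0 ^+ nu by rewrite -exprMn divfK// gt_eqF.
have mle : m%:R <= K * (r0 / r) ^+ nu.
  by rewrite truncn_le; apply: ltW; pos.
have mr : m%:R * r ^+ nu <= K * r0 ^+ nu.
  by rewrite -PE mulrA ler_wpM2r// ltW.
have m0 : (0 < m)%N.
  rewrite truncn_gt0 -(ler_pM2r rnu0) mul1r -mulrA PE; apply: le_trans rnur (ltW h7).
have aE : a = Ca * r ^+ nu * r.
  rewrite /a /Ca /rho -/c4 mulrAC exprMn [r ^+ nu.+1]exprSr; ring.
have lE : l = Cl * r ^+ nu.
  rewrite /l /Cl /rho -/c4 (_ : 2 * (c4 * r) / r0 = (2 * c4 / r0) * r); last by ring.
  by rewrite exprMn [r ^+ nu.+1]exprS; field; rewrite !gt_eqF.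
have R1E : R1 ^+ nu = expR 2 * r ^+ nu.
  by rewrite /R1 exprMn -expRM_natl mulrCA divff ?gt_eqF// mulr1.
have S0 := stirling_norm_ge0 R m.
have Skp : stirling_norm R m * r ^+ nu <= kp.
  rewrite -(ler_pXn2r (isT : (0 < 2)%N)) ?nnegrE ?mulr_ge0 ?(ltW rnu0) ?(ltW kp0)//.
  rewrite exprMn; apply: (@le_trans _ _ (8 * m%:R * (r ^+ nu) ^+ 2)).
    apply: ler_wpM2r; first by rewrite sqr_ge0.
    apply: le_trans (stirling_norm_sqr R m) _.
    have : (1 : R) <= m%:R by rewrite ler1n.
    by rewrite -natr1; lra.
  have -> : 8 * m%:R * (r ^+ nu) ^+ 2 = 8 * (m%:R * r ^+ nu) * r ^+ nu by ring.
  apply: (@le_trans _ _ (8 * (K * r0 ^+ nu) * r)).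
    by apply: ler_pM; rewrite ?mulr_ge0 ?(ltW rnu0)// ler_wpM2l.
  move: h4; rewrite ltr_pdivlMr; last by rewrite mulr_gt0// mulr_gt0.
  by move=> h; rewrite mulrC mulrA ltW.
have l0 : 0 <= l by rewrite lE mulr_ge0 ?(ltW Cl0) ?(ltW rnu0).
have d4 : 0 < 4 * Ca by pos.
have b2 : 2 * b <= g / 2 * r.
  have : stirling_norm R m * r ^+ nu <= g / (4 * Ca) by apply: le_trans Skp _; rewrite ge_min lexx orbT.
  rewrite ler_pdivlMr// => h.
  have -> : 2 * b = stirling_norm R m * r ^+ nu * (4 * Ca) / 2 * r by rewrite /b aE; field.
  by rewrite ler_wpM2r ?(ltW rp)// ler_wpM2r.
split; split => //.
- by rewrite /R0 /R1 ltr_pM2r// ltr_expR; lra.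
- move: h3; rewrite ltr_pdivlMr; last by pos.
  by rewrite /rho -/c4; lra.
- rewrite R1E.
  have -> : m%:R * (nu%:R * eps0 / r0 ^+ nu.+1) * (expR 2 * r ^+ nu) =
     (m%:R * r ^+ nu) * (nu%:R * eps0 / r0 ^+ nu.+1 * expR 2) by ring.
  apply: (@le_trans _ _ (K * r0 ^+ nu * (nu%:R * eps0 / r0 ^+ nu.+1 * expR 2))).
    by rewrite ler_wpM2r//; apply: ltW; pos.
  have s0 : 0 < Num.sqrt 2 :> R by rewrite sqrtr_gt0.
  have -> : K * r0 ^+ nu * (nu%:R * eps0 / r0 ^+ nu.+1 * expR 2) = (Num.sqrt 2)^-1.
    rewrite KE [r0 ^+ nu.+1]exprS (_ : expR 2 = expR 1 ^+ 2); last by rewrite -expRM_natl mulr1.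
    have := gt_eqF rn0; have := gt_eqF (expR_gt0 (1 : R)); move: (expR 1) (r0 ^+ nu) => E P E0 P0.
    field; rewrite ?E0 ?P0 !gt_eqF//.
  rewrite -[_^-1]mul1r ler_pdivrMr//.
  have s2 : Num.sqrt 2 ^+ 2 = 2 :> R by rewrite sqr_sqrtr.
  nra.
- rewrite R1E /rho -/c4 exprMn mulrA ler_wpM2r ?(ltW rnu0)// -/c4.
  by case: (nu) nu0 => // k _; rewrite exprS ler_peMr ?(ltW c40)// exprn_ege1.
- rewrite lE; apply: (@le_trans _ _ (Cl * r)); first by rewrite ler_wpM2l ?(ltW Cl0).
  by move: h5; rewrite -(ltr_pM2l Cl0) mulfV ?gt_eqF// => /ltW.
- have hM : (1 + l) ^+ m <= expR M.
    apply: (@le_trans _ _ (expR l ^+ m)).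
      by rewrite lerXn2r ?nnegrE ?expR_ge0 ?addr_ge0// expR_ge1Dx.
    rewrite -expRM_natl ler_expR lE /M.
    have -> : m%:R * (Cl * r ^+ nu) = (m%:R * r ^+ nu) * Cl by ring.
    by rewrite ler_wpM2r ?(ltW Cl0).
  have hk : stirling_norm R m * r ^+ nu <= 1 / (4 * Cl * expR M) by apply: le_trans Skp _; rewrite ge_min lexx.
  have -> : stirling_norm R m * (l * (1 + l) ^+ m) = (stirling_norm R m * r ^+ nu) * (Cl * (1 + l) ^+ m).
    by rewrite {1}lE; ring.
  apply: (@le_trans _ _ (1 / (4 * Cl * expR M) * (Cl * expR M))).
    apply: ler_pM => //; first by rewrite mulr_ge0 ?(ltW rnu0).
      by rewrite mulr_ge0 ?(ltW Cl0)// exprn_ge0// addr_ge0.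
    by rewrite ler_wpM2l ?(ltW Cl0).
  by rewrite le_eqVlt; apply/orP; left; apply/eqP; field; rewrite !gt_eqF ?expR_gt0.
- rewrite /R0 /R1; have : 0 < g * r by rewrite mulr_gt0.
  by rewrite /g in b2 *; lra.
have hg : a <= Ca * r.
  by rewrite aE ler_wpM2r ?(ltW rp)// ler_piMr ?(ltW Ca0)// (le_trans rnur)// ltW.
have gC0 : 0 < g + Ca by rewrite addr_gt0.
have : r * (g + Ca) <= 4 * eps0 * (1 - q).
  by move: h6; rewrite ltr_pdivlMr// => /ltW.
have : 0 < g * r by rewrite mulr_gt0.
by move: b2 hg; lra.
Qed.

Theorem theorem5 (R : realType) (d : nat) (hd : (0 < d)%N)
    (eps0 r0 : R) (heps0 : 0 < eps0) (hr0 : 0 < r0) (heps0r0 : eps0 <= r0)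
    (n0 : nat) (hn0 : (2 <= n0)%N) :
  exists (r1 : R) (m : R -> nat),
    [/\ 0 < r1 < r0,
        (exists2 E : R -> R,
           E =O_ (0^'+) (fun r : R => r ^+ (n0 - 1)) &
           forall r : R, 0 < r < r1 ->
             (0 < m r)%N /\
             (m r)%:R = (r0 / r) ^+ (n0 - 1) *
               (1 / ((n0 - 1)%:R * Num.sqrt 2 * expR 1 ^+ 2) * (r0 / eps0)
                + E r)) &
        forall f finv : 'rV[R[i]]_d -> 'rV[R[i]]_d,
          in_B r0 eps0 n0 f finv ->
          forall r : R, 0 < r < r1 ->
            let X := interp_field f finv (m r) in
            let D := interp_dom r0 f finv (m r) in
            (forall x, cball r x -> flow_rel D X 1 x !=set0) /\
            (supnorm r (fun x => (flow D X 1 x - f x)%R)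
               <= (4 * eps0 * expR (- 2 * (m r)%:R))%:E)%E].
Proof.
case: n0 hn0 => [//|nu] hn0; rewrite subSS subn0.
have nu0 : (0 < nu)%N by [].
have nuR : (0 : R) < nu%:R by rewrite ltr0n.
pose K : R := 1 / (nu%:R * Num.sqrt 2 * expR 1 ^+ 2) * (r0 / eps0).
have K0 : 0 < K.
  by rewrite mulr_gt0 ?divr_gt0 ?mulr_gt0 ?sqrtr_gt0 ?exprn_gt0 ?expR_gt0.
have [r1 [r1r0 hr1]] := exists_interp_radius heps0 hr0 K0 nu0 erefl.
pose m (r : R) := Num.trunc (K * (r0 / r) ^+ nu).
exists r1, m; split => //.
  exists (fun r => (m r)%:R / (r0 / r) ^+ nu - K).
    apply/eqO_exP; exists (r0 ^- nu); first by rewrite invr_gt0 exprn_gt0.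
    near=> r; have rp : 0 < r by near: r; exact: nbhs_right_gt.
    have P0 : 0 < (r0 / r) ^+ nu by rewrite exprn_gt0// divr_gt0.
    have := @truncn_itv R (K * (r0 / r) ^+ nu); rewrite mulr_ge0 ?(ltW K0) ?(ltW P0)//.
    move=> /(_ isT) /andP[h1 h2]; rewrite -/(m r) in h1 h2.
    have -> : r0 ^- nu * `|r ^+ nu| = ((r0 / r) ^+ nu)^-1.
      rewrite ger0_norm ?exprn_ge0 ?(ltW rp)// expr_div_n invf_div mulrC//.
    rewrite ler_norml lerBrDr lerBlDr ler_pdivrMr// mulrDl mulVf ?gt_eqF// addrC.
    rewrite ler_pdivlMr// mulrDl mulNr mulVf ?gt_eqF//.
    by move: h1 h2; rewrite -natr1; lra.
  move=> r rr; have [[m0 _ _ _ _] _] := hr1 r rr; split => //.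
  have rp : 0 < r by case/andP: rr.
  rewrite addrCA subrr addr0 mulrC divfK// expf_neq0// mulf_neq0 ?invr_eq0 ?gt_eqF//.
move=> f finv fB r rr.
have rp : 0 < r by case/andP: rr.
have [[m0 R01 hrho hm hR1] [l1 hL hb hB]] := hr1 r rr.
have q0 : 0 < expR (- nu%:R^-1) :> R by exact: expR_gt0.
have q1 : expR (- nu%:R^-1) < 1 :> R by rewrite expR_lt1 oppr_lt0 invr_gt0.
have rho0 : 0 < 4 * expR 2 * r by rewrite mulr_gt0// mulr_gt0// expR_gt0.
have rq : r = expR (- nu%:R^-1) * (expR nu%:R^-1 * r) by rewrite mulrA -expRD addNr expR0 mul1r.
have := interp_flow_error hr0 heps0 heps0r0 nu0 m0 fB rp q0 q1 rq R01 rho0 hrho hm hR1 l1 hL hb hB.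
have -> : expR (- nu%:R^-1) ^+ (2 * m r * nu) = expR (- 2 * (m r)%:R) :> R.
  rewrite -expRM_natl; congr expR; rewrite !natrM; field; exact: lt0r_neq0.
by [].
Unshelve. all: by end_near. Qed.
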